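(* Let $a\ge\tau$ and $\xi\ge\frac{2\tau}{a}$. Then the system $U'=\mathcal{A}U$ on $\mathcal{H}$ (defined in the context) is exponentially stable, i.e. there exist constants $M>0$ and $w>0$ such that $\|e^{t\mathcal{A}}\|_{\mathcal{L}(\mathcal{H})}\le Me^{-wt}$ for all $t\ge0$.
   Context: $H$ is a (complex) Hilbert space with inner product $(\cdot,\cdot)_H$ and norm $\|\cdot\|_H$; $A:D(A)\subset H\to H$ is a self-adjoint, strictly positive (unbounded) operator (i.e. $(Ax,x)_H\ge c\|x\|_H^2$ on $D(A)$ for some $c>0$); $\alpha\in[0,1]$; $\tau>0$ (delay), $a>0$, $\xi>0$ are constants. $B:D(B)\subset H\to H$ and $C:D(C)\subset H\to H$ are closed densely defined linear operators with adjoints $B^*$, $C^*$, and it is assumed that $A=BB^*$; that there is $c_1>0$ with $\|B^*v\|_H\ge c_1\|v\|_H$ for all $v\in D(B^* )$; that $D(A^\alpha)\subset D(C)$ and $D(B^* )\subset D(C^* )$; and that there is $c_2>0$ with $\|C^*v\|_H\le c_2\|B^*v\|_H$ for all $v\in D(B^* )$. The delayed system is $$u''(t)+Au(t-\tau)+aAu'(t)-C\theta(t)=0,\qquad \theta'(t)+A^{\alpha}\theta(t)+C^*u'(t)=0,\qquad t>0,$$ with $u(0)=u_0$, $u'(0)=u_1$, $\theta(0)=\theta_0$, $B^*u(t-\tau)=\phi(t-\tau)$ for $t\in(0,\tau)$. With $z(\rho,t)=B^*u(t-\tau\rho)$, $\rho\in(0,1)$, and $U=(u,u',\theta,z)^\top$,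 it is rewritten as $U'=\mathcal{A}U$, $U(0)=(u_0,u_1,\theta_0,\phi(-\tau\,\cdot))^\top$, where $$\mathcal{A}\begin{pmatrix} u \\ v \\ \theta \\ z \end{pmatrix}=\begin{pmatrix} v \\ -B\big(z(1)+aB^*v\big)+C\theta \\ -A^\alpha\theta-C^*v \\ -\frac1\tau z_\rho \end{pmatrix}$$ with domain $D(\mathcal{A})$ consisting of all $(u,v,\theta,z)^\top\in D(B^* )\times D(B^* )\times D(A^\alpha)\times H^1((0,1),H)$ such that $z(0)=B^*u$ and $aB^*v+z(1)\in D(B)$, in the Hilbert space $\mathcal{H}=D(B^* )\times H\times H\times L^2((0,1),H)$ with scalar product $$\big((u,v,\theta,z)^\top,(u_1,v_1,\theta_1,z_1)^\top\big)_{\mathcal{H}}=(B^*u,B^*u_1)_H+(v,v_1)_H+(\theta,\theta_1)_H+\xi\int_0^1(z,z_1)_H\,d\rho.$$ Under the stated hypotheses $\mathcal{A}$ generates a $\mathcal{C}_0$-semigroup $e^{t\mathcal{A}}$ on $\mathcal{H}$. *)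

(* Defs.v *)
From HB Require Import structures.
From mathcomp Require Import all_boot all_order all_algebra.
From mathcomp Require Import complex.
From mathcomp Require Import all_classical all_reals all_analysis.

Set Implicit Arguments.
Unset Strict Implicit.
Unset Printing Implicit Defensive.

Import Order.TTheory GRing.Theory Num.Theory.
Import numFieldNormedType.Exports.

Local Open Scope classical_set_scope.
Local Open Scope complex_scope.
Local Open Scope ring_scope.

(* A possibly unbounded operator X ⊃ dom -> X.  The values of [app] outside
   [dom] are junk and never matter: operators are compared with [op_eq]. *)
Record uop (X : Type) := Uop { dom : set X ; app : X -> X }.

Definition op_eq (X : Type) (S T : uop X) : Prop :=
  dom S = dom T /\ forall x, dom S x -> app S x = app T x.

Definition op_comp (X : Type) (S T : uop X) : uop X :=
  Uop [set x | dom T x /\ dom S (app T x)] (fun x => app S (app T x)).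

Definition linear_op (K : pzRingType) (X : lmodType K) (T : uop X) : Prop :=
  dom T 0 /\
  forall (k : K) x y, dom T x -> dom T y ->
    dom T (k *: x + y) /\ app T (k *: x + y) = k *: app T x + app T y.

Section complex_integral.
Context {R : realType}.

Definition cintegral (D : set R) (f : R -> R[i]) : R[i] :=
  Complex (\int[lebesgue_measure]_(x in D) complex.Re (f x))
          (\int[lebesgue_measure]_(x in D) complex.Im (f x)).

End complex_integral.

Section hilbert_operators.
Context {R : realType} {H : completeNormedModType R[i]}.
Variable dot : {dot H for Num.conj}.
Implicit Types (T : uop H) (x y : H).

Definition densely_defined T : Prop := dense (dom T).

Definition closed_op T : Prop :=
  closed [set p : H * H | dom T p.1 /\ p.2 = app T p.1].

Definition adjoint_value T y : set H :=
  [set z | forall x, dom T x -> dot (app T x) y = dot x z].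

(* For a densely defined [T] the set [adjoint_value T y] has at most one
   element. *)
Definition adjoint T : uop H :=
  Uop [set y | adjoint_value T y !=set0] (fun y => xget 0 (adjoint_value T y)).

Definition self_adjoint T : Prop :=
  [/\ linear_op T, densely_defined T & op_eq T (adjoint T)].

Definition strictly_positive T : Prop :=
  exists2 c : R, 0 < c &
    forall x, dom T x -> c%:C * `|x| ^+ 2 <= dot (app T x) x.

(* (t + T)^-1 x *)
Definition resolvent T (t : R) x : H :=
  xget 0 [set y | dom T y /\ t%:C *: y + app T y = x].

(* For T self-adjoint strictly positive and 0 < alpha < 1, the bounded operator
     T^-alpha = sin(pi alpha)/pi \int_0^oo t^-alpha (t + T)^-1 dt,
   the integral being tested against every vector of H. *)
Definition neg_power T (alpha : R) x : H :=
  xget 0 [set w | forall y, dot w y =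
    (sin (pi * alpha) / pi)%:C *
    cintegral `]0, +oo[ (fun t => (t `^ (- alpha))%:C * dot (resolvent T t x) y)].

(* T^alpha for 0 <= alpha <= 1: T^0 = 1, T^1 = T and T^alpha = (T^-alpha)^-1
   otherwise. *)
Definition frac_power T (alpha : R) : uop H :=
  if alpha == 0 then Uop setT id
  else if alpha == 1 then T
  else Uop (range (neg_power T alpha))
           (fun y => xget 0 [set x | neg_power T alpha x = y]).

End hilbert_operators.

(* L^2((0,1),H) and H^1((0,1),H).  Classes of functions are represented by
   functions on the whole of R, of which only the values a.e. on (0,1) matter. *)
Section bochner_spaces.
Context {R : realType} {H : completeNormedModType R[i]}.
Variable dot : {dot H for Num.conj}.
Implicit Types z g : R -> H.

Definition simple_map (s : R -> H) : Prop :=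
  finite_set (range s) /\ forall y, measurable (s @^-1` [set y]).

Definition strongly_measurable (D : set R) z : Prop :=
  exists2 s : nat -> R -> H, (forall n, simple_map (s n)) &
    {ae lebesgue_measure, forall x, D x -> s n x @[n --> \oo] --> z x}.

Definition L2_01 z : Prop :=
  strongly_measurable `]0, 1[ z /\
  (\int[lebesgue_measure]_(x in `]0%R, 1%R[) ((complex.Re `|z x|) ^+ 2)%:E
     < +oo)%E.

Definition test_fun (phi : R -> R) : Prop :=
  [/\ forall x, derivable phi x 1,
      continuous (derive1 phi) &
      exists a b : R, [/\ 0 < a, b < 1 &
        forall x, ~~ (a <= x <= b) -> phi x = 0]].

(* \int z phi' = - \int g phi in H, tested against every vector of H. *)
Definition weak_derivative z g : Prop :=
  forall (phi : R -> R) (y : H), test_fun phi ->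
    cintegral `]0, 1[ (fun x => (derive1 phi x)%:C * dot (z x) y) =
    - cintegral `]0, 1[ (fun x => (phi x)%:C * dot (g x) y).

Definition H1_derivatives z : set (R -> H) :=
  [set g | L2_01 g /\ weak_derivative z g].

Definition H1_01 z : Prop := L2_01 z /\ H1_derivatives z !=set0.

Definition wderiv z : R -> H := xget 0 (H1_derivatives z).

(* The representative of z : H^1 which is continuous on [0,1]; it carries the
   boundary values z(0) and z(1). *)
Definition continuous_rep z : R -> H :=
  xget 0 [set zc : R -> H | {within `[0%R : R, 1%R : R], continuous zc} /\
                   {ae lebesgue_measure, forall x : R, 0 < x < 1 -> zc x = z x}].

End bochner_spaces.

(* C_0-semigroups on a space given as a subspace [K] of [X] with a seminorm
   [p], elements of [K] at distance 0 being identified. *)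
Section semigroups.
Context {R : realType} {X : lmodType R[i]}.
Variables (K : set X) (p : X -> R).
Implicit Types (S : R -> X -> X) (T : uop X).

Definition op_norm (F : X -> X) : \bar R :=
  ereal_sup [set (p (F x))%:E | x in [set x | K x /\ p x <= 1]].

Record C0_semigroup S : Prop := {
  sg_stable : forall t x, 0 <= t -> K x -> K (S t x) ;
  sg_linear : forall t (k : R[i]) x y, 0 <= t -> K x -> K y ->
    p (S t (k *: x + y) - (k *: S t x + S t y)) = 0 ;
  sg_bounded : forall t, 0 <= t -> (op_norm (S t) < +oo)%E ;
  sg_0 : forall x, K x -> p (S 0 x - x) = 0 ;
  sg_add : forall s t x, 0 <= s -> 0 <= t -> K x ->
    p (S (s + t) x - S s (S t x)) = 0 ;
  sg_continuous : forall x, K x -> p (S t x - x) @[t --> 0^'+] --> (0 : R) }.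

Definition right_derivative S x y : Prop :=
  p ((h^-1)%:C *: (S h x - x) - y) @[h --> 0^'+] --> (0 : R).

Definition infinitesimal_generator S T : Prop :=
  (forall x, dom T x <-> K x /\ exists2 y, K y & right_derivative S x y) /\
  (forall x, dom T x -> K (app T x) /\ right_derivative S x (app T x)).

End semigroups.

Definition state (R : realType) (H : completeNormedModType R[i]) :
  lmodType R[i] := (H * H * H * (R -> H))%type.

Section delay_system.
Context {R : realType} {H : completeNormedModType R[i]}.
Variables (dot : {dot H for Num.conj}) (A B C : uop H) (alpha tau a xi : R).

Local Notation Bs := (adjoint dot B).
Local Notation Cs := (adjoint dot C).
Local Notation Aa := (frac_power dot A alpha).

Definition energy_space : set (state H) :=
  [set U | let: (u, v, th, z) := U in dom Bs u /\ L2_01 z].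

Definition energy_dot (U U1 : state H) : R[i] :=
  let: (u, v, th, z) := U in
  let: (u1, v1, th1, z1) := U1 in
  dot (app Bs u) (app Bs u1) + dot v v1 + dot th th1 +
  xi%:C * cintegral `]0, 1[ (fun rho => dot (z rho) (z1 rho)).

Definition energy_norm (U : state H) : R :=
  Num.sqrt (complex.Re (energy_dot U U)).

Definition delay_op : uop (state H) := Uop
  [set U : state H | let: (u, v, th, z) := U in
    [/\ [/\ dom Bs u, dom Bs v, dom Aa th & H1_01 dot z],
        continuous_rep z 0 = app Bs u &
        dom B (a%:C *: app Bs v + continuous_rep z 1)]]
  (fun U => let: (u, v, th, z) := U in
    (v,
     - app B (continuous_rep z 1 + a%:C *: app Bs v) + app C th,
     - app Aa th - app Cs v,
     (- tau^-1)%:C \*: wderiv dot z)).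

End delay_system.

(* Main.v *)
Require Import Defs.
From HB Require Import structures.
From mathcomp Require Import all_boot all_order all_algebra.
From mathcomp Require Import complex.
From mathcomp Require Import all_classical all_reals all_analysis.
From mathcomp Require Import measurable_realfun ring lra.
Import Order.TTheory GRing.Theory Num.Theory.
Import numFieldNormedType.Exports.
Local Open Scope classical_set_scope.
Local Open Scope complex_scope.
Local Open Scope ring_scope.

Set Implicit Arguments.
Unset Strict Implicit.
Unset Printing Implicit Defensive.

(** Along an orbit issued from the domain write [X = B* u], [P = B* v] and
    [b = X(t) - X(t - tau)].  The domain condition [z(0) = B* u] and the
    transport equation for [z] give [z(rho, t) = X(t - tau rho)] as soon as
    [t >= tau]; in particular the boundary value [z(1, t)] is the delayed
    [X(t - tau)], so that [v' = - B (X(t - tau) + a P) + C theta] and the system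
    is a delay equation for the three vectors [v], [X], [theta].  As [X' = P],
    the delayed term is [X - b] where [b] is the integral of [P] over one delay,
    which the damping [a P] dominates as soon as [a >= tau].

    The stability is obtained from an explicit Lyapunov functional.  Let [Q' =
    |P|^2] and let [m] be the integral of [Q(t) - Q(r)] for [r] between [t - tau]
    and [t].  Then [F = (|v|^2 + |X|^2 + |theta|^2 + m) / 2] satisfies
    [F' = - (a - tau) |P|^2 - D - Re (A^alpha theta, theta)], where [2 D] is the
    integral of [|P(r) - P(t)|^2] over the same window.  The contributions of
    [C] and [C*] cancel, and [A^alpha] is coercive.  When [a = tau] this controls
    the variation of [P] but not [P], and it never controls [X].  Both are
    recovered by adding a small multiple of [Psi = Re (v, u) + (a - tau) / 2 |X|^2
    - N Re (w, X)], where [w] is the integral of [X(t) - X(r)] over the window: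
    the first term produces [- |X|^2], and the last one produces [- |P|^2] because
    [w] differs from [tau^2 / 2 P(t)] by at most a constant times [D^(1/2)].  The sum is
    comparable to [F] and decays exponentially; the history component decays with
    it, being a piece of the past of [X].  The theorem follows by density of the
    domain.

    The following facts give access to this computation.  The energy space is
    complete ([energy_banach], from the completeness [L2_complete] of the space
    of square integrable functions), hence the semigroup is locally bounded, its
    generator has a dense domain and orbits of the domain are differentiable
    ([bounded_on], [generator_dense], [orbit_two_sided]).  A weakly differentiable
    function has a continuous representative ([continuous_rep_spec]), and these
    representatives are transported along the orbit ([orbit_history]).  The power
    [A^alpha], defined through an integral of resolvents, is coercive
    ([frac_power_coercive]).  The Lyapunov argument proper is [lyap_derivative]
    and [lyapunov_decay]. *)

(** * Identities in modules *)

Section module_expressions.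
Variables (K : comPzRingType) (V : lmodType K).

Inductive mexp :=
  | MAtom of nat | MZero | MAdd of mexp & mexp | MOpp of mexp
  | MScale of K & mexp.

Fixpoint meval (env : seq V) e : V :=
  match e with
  | MAtom n => nth 0 env n
  | MZero => 0
  | MAdd a b => meval env a + meval env b
  | MOpp a => - meval env a
  | MScale k a => k *: meval env a
  end.

Fixpoint mcoef e n : K :=
  match e with
  | MAtom m => if Nat.eqb m n then 1 else 0
  | MZero => 0
  | MAdd a b => mcoef a n + mcoef b n
  | MOpp a => - mcoef a n
  | MScale k a => k * mcoef a n
  end.

Lemma meval_coef env e : meval env e = \sum_(i < size env) mcoef e i *: env`_i.
Proof.
elim: e => [m||a IHa b IHb|a IHa|k a IHa] /=; rewrite ?IHa ?IHb.
- have eqbE i : Nat.eqb m i = (i == m :> nat).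
    by apply/idP/eqP => [/PeanoNat.Nat.eqb_eq//|->]; rewrite PeanoNat.Nat.eqb_refl.
  have [lt_m|ge_m] := ltnP m (size env).
    rewrite (bigD1 (Ordinal lt_m))//= eqbE eqxx scale1r big1 ?addr0// => i.
    by rewrite -val_eqE eqbE /= => /negbTE ->; rewrite scale0r.
  rewrite nth_default// big1// => i _; rewrite eqbE.
  by rewrite ltn_eqF ?scale0r// (leq_trans (ltn_ord i)).
- by rewrite big1// => i _; rewrite scale0r.
- by rewrite -big_split; apply: eq_bigr => i _; rewrite scalerDl.
- by rewrite -sumrN; apply: eq_bigr => i _; rewrite scaleNr.
- by rewrite scaler_sumr; apply: eq_bigr => i _; rewrite scalerA.
Qed.

Fixpoint mcoefs_eq n e1 e2 : Prop :=
  match n with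
  | 0 => True
  | n'.+1 => mcoef e1 n' = mcoef e2 n' /\ mcoefs_eq n' e1 e2
  end.

Lemma mcoefs_eqP env e1 e2 :
  mcoefs_eq (size env) e1 e2 -> meval env e1 = meval env e2.
Proof.
move=> h; rewrite !meval_coef; apply: eq_bigr => i _; congr (_ *: _).
case: i => i /=; elim: (size env) h => //= n IH [e h].
by rewrite ltnS leq_eqVlt => /predU1P[->|/IH]; [exact: e|exact].
Qed.

End module_expressions.

Ltac madd_atom x env :=
  lazymatch env with
  | nil => constr:(cons x nil)
  | cons x _ => env
  | cons ?y ?t => let t' := madd_atom x t in constr:(cons y t')
  end.

Ltac matoms e env :=
  lazymatch e with
  | (?a + ?b)%R => let env := matoms a env in matoms b env
  | (- ?a)%R => matoms a env
  | (_ *: ?a)%R => matoms a env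
  | 0%R => env
  | ?x => madd_atom x env
  end.

Ltac mindex x env :=
  lazymatch env with
  | cons x _ => constr:(O)
  | cons _ ?t => let n := mindex x t in constr:(S n)
  end.

Ltac mquote K env e :=
  lazymatch e with
  | (?a + ?b)%R =>
      let a' := mquote K env a in let b' := mquote K env b in
      constr:(@MAdd K a' b')
  | (- ?a)%R => let a' := mquote K env a in constr:(@MOpp K a')
  | (?k *: ?a)%R => let a' := mquote K env a in constr:(@MScale K k a')
  | 0%R => constr:(@MZero K)
  | ?x => let n := mindex x env in constr:(@MAtom K n)
  end.

(** Decides identities between vectors by comparing coefficients. *)
Ltac lmod K V :=
  lazymatch goal with
  | |- ?e1 = ?e2 =>
      let env := matoms e1 (@nil V) in
      let env := matoms e2 env in
      let e1' := mquote K env e1 in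
      let e2' := mquote K env e2 in
      refine (@mcoefs_eqP K V env e1' e2' _); cbn [mcoefs_eq mcoef size Nat.eqb];
      repeat (split; [try by ring|]); try exact I
  end.

(** * The real inner product *)

Section real_inner_product.
Context {R : realType} {H : completeNormedModType R[i]}.
Variable dot : {dot H for Num.conj}.
Hypothesis norm_dot : forall x : H, `|x| ^+ 2 = dot x x.

(** Norms and inner products live in the complex field; the estimates are made on
    their real parts. *)
Definition nm (x : H) : R := complex.Re `|x|.

Definition rdot (x y : H) : R := complex.Re (dot x y).
Local Notation ip := rdot.

Lemma nmE x : `|x| = (nm x)%:C.
Proof. by rewrite /nm RRe_real// ger0_real. Qed.

Lemma nm_ge0 x : 0 <= nm x.
Proof. by rewrite -ler0c -nmE. Qed.

Lemma nm2 x : nm x ^+ 2 = ip x x.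
Proof. by rewrite /ip -norm_dot nmE -rmorphXn. Qed.

Lemma rCD (r s : R) : (r + s)%:C = r%:C + s%:C :> R[i].
Proof. by rewrite rmorphD. Qed.
Lemma rCM (r s : R) : (r * s)%:C = r%:C * s%:C :> R[i].
Proof. by rewrite rmorphM. Qed.
Lemma ReD (x y : R[i]) : complex.Re (x + y) = complex.Re x + complex.Re y.
Proof. by case: x y => [a b] [c d]. Qed.
Lemma ReN (x : R[i]) : complex.Re (- x) = - complex.Re x.
Proof. by case: x. Qed.
Lemma ReZ r (x : R[i]) : complex.Re (r%:C * x) = r * complex.Re x.
Proof. by case: x => a b /=; rewrite mul0r subr0. Qed.

Lemma ipDl x y z : ip (x + y) z = ip x z + ip y z.
Proof. by rewrite /ip linearDl ReD. Qed.
Lemma ipDr x y z : ip z (x + y) = ip z x + ip z y.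
Proof. by rewrite /ip linearDr ReD. Qed.
Lemma ipNl x z : ip (- x) z = - ip x z.
Proof. by rewrite /ip linearNl ReN. Qed.
Lemma ipNr x z : ip z (- x) = - ip z x.
Proof. by rewrite /ip linearNr ReN. Qed.
Lemma ipBl x y z : ip (x - y) z = ip x z - ip y z.
Proof. by rewrite ipDl ipNl. Qed.
Lemma ipBr x y z : ip z (x - y) = ip z x - ip z y.
Proof. by rewrite ipDr ipNr. Qed.
Lemma ip0l z : ip 0 z = 0. Proof. by rewrite /ip linear0l. Qed.
Lemma ip0r z : ip z 0 = 0. Proof. by rewrite /ip linear0r. Qed.
Lemma ipC x y : ip x y = ip y x.
Proof.
rewrite /ip (hermC dot) expr0 mul1r.
by rewrite /=; case: (dot y x).
Qed.
Lemma ipZl r x y : ip (r%:C *: x) y = r * ip x y.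
Proof. by rewrite /ip linearZl_LR /= ReZ. Qed.
Lemma ipZr r x y : ip x (r%:C *: y) = r * ip x y.
Proof. by rewrite ipC ipZl ipC. Qed.

Lemma nmN x : nm (- x) = nm x. Proof. by rewrite /nm normrN. Qed.
Lemma nmC x y : nm (x - y) = nm (y - x). Proof. by rewrite /nm distrC. Qed.
Lemma nm0 : nm 0 = 0. Proof. by rewrite /nm normr0. Qed.
Lemma nmD x y : nm (x + y) <= nm x + nm y.
Proof. by rewrite -lecR rCD -!nmE; exact: ler_normD. Qed.
Lemma nmB x y : nm (x - y) <= nm x + nm y.
Proof. by rewrite -(nmN y) nmD. Qed.
Lemma nmZ (k : R[i]) x : nm (k *: x) = complex.Re `|k| * nm x.
Proof.
by rewrite /nm normrZ nmE -{1}(@RRe_real _ `|k|) ?ger0_real// -rmorphM.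
Qed.
Lemma Re_norm_real (r : R) : complex.Re `|r%:C| = `|r|.
Proof. by rewrite normc_def /= expr0n addr0 sqrtr_sqr. Qed.
Lemma nmZr r x : nm (r%:C *: x) = `|r| * nm x.
Proof. by rewrite nmZ Re_norm_real. Qed.
Lemma nm_eq0 x : nm x = 0 -> x = 0.
Proof. by move=> x0; apply/normr0_eq0; rewrite nmE x0. Qed.

Lemma nmD2 x y : nm (x + y) ^+ 2 = nm x ^+ 2 + 2 * ip x y + nm y ^+ 2.
Proof. by rewrite !nm2 !ipDl !ipDr (ipC y x); ring. Qed.
Lemma nmB2 x y : nm (x - y) ^+ 2 = nm x ^+ 2 - 2 * ip x y + nm y ^+ 2.
Proof. by rewrite nmD2 ipNr nmN; ring. Qed.

(** The weighted Young inequality; every absorption argument below is an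
    instance of it with a suitable weight. *)
Lemma ip_young (l : R) x y : 0 < l ->
  ip x y <= l / 2 * nm x ^+ 2 + nm y ^+ 2 / (2 * l).
Proof.
move=> l0; have := nm_ge0 (l%:C *: x - y).
have := sqr_ge0 (nm (l%:C *: x - y)); rewrite nmB2 nmZr ipZl exprMn.
rewrite real_normK ?num_real// => + _ => h.
have : ip x y * (2 * l) <= (l / 2 * nm x ^+ 2 + nm y ^+ 2 / (2 * l)) * (2 * l).
  have -> : (l / 2 * nm x ^+ 2 + nm y ^+ 2 / (2 * l)) * (2 * l) =
    l ^+ 2 * nm x ^+ 2 + nm y ^+ 2 by field; rewrite gt_eqF.
  lra.
by rewrite ler_pM2r// mulr_gt0.
Qed.

Lemma ip_le x y : ip x y <= nm x * nm y.
Proof.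
have [->|x0] := eqVneq x 0; first by rewrite ip0l nm0 mul0r.
have [->|y0] := eqVneq y 0; first by rewrite ip0r nm0 mulr0.
have xp : 0 < nm x by rewrite lt_def nm_ge0 andbT; apply/eqP => /nm_eq0; apply/eqP.
have yp : 0 < nm y by rewrite lt_def nm_ge0 andbT; apply/eqP => /nm_eq0; apply/eqP.
have := @ip_young (nm y / nm x) x y (divr_gt0 yp xp).
by congr (_ <= _); field; rewrite !gt_eqF.
Qed.

Lemma ip_abs x y : `|ip x y| <= nm x * nm y.
Proof. by rewrite ler_norml ip_le andbT -(nmN x) lerNl -ipNl ip_le. Qed.

(** Complex identities can be read off the real form because the subspaces on
    which they are tested are stable under multiplication by [i]. *)
Lemma dot_ip (x y x' y' : H) :
  ip x y = ip x' y' -> ip ('i *: x) y = ip ('i *: x') y' ->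
  dot x y = dot x' y'.
Proof.
rewrite /ip !linearZl_LR /= ![('i : R[i]) * _]mulrC !ReiNIm => e /oppr_inj f.
by apply/eqP; rewrite eq_complex e f !eqxx.
Qed.

Lemma cvg_nmP (x : nat -> H) l : (x n @[n --> \oo] --> l) <->
  forall e : R, 0 < e -> exists N, forall n, (N <= n)%N -> nm (x n - l) < e.
Proof.
split=> [/cvgrPdist_lt h e e0|h].
  have /h[N _ hN] : 0 < e%:C :> R[i] by rewrite ltcR.
  by exists N => n Nn; rewrite nmC -ltcR -nmE; exact: hN.
apply/cvgrPdist_lt => e e0; have eE : e = (complex.Re e)%:C.
  by rewrite RRe_real// gtr0_real.
have /h[N hN] : 0 < complex.Re e by rewrite -ltcR -eE.
by exists N => // n Nn /=; rewrite nmE eE ltcR nmC; exact: hN.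
Qed.

Lemma nm_complete (x : nat -> H) :
  (forall e : R, 0 < e -> exists N, forall n m, (N <= n)%N -> (N <= m)%N ->
    nm (x n - x m) < e) ->
  exists l, forall e : R, 0 < e -> exists N, forall n, (N <= n)%N ->
    nm (x n - l) < e.
Proof.
move=> h; have : cvg (x n @[n --> \oo]).
  apply/cauchy_cvgP/cauchy_exP => e e0; have eE : e = (complex.Re e)%:C.
    by rewrite RRe_real// gtr0_real.
  have /h[N hN] : 0 < complex.Re e by rewrite -ltcR -eE.
  exists (x N); exists N => // n /= Nn.
  by rewrite -ball_normE /ball_ /= nmE eE ltcR; exact: hN.
by move=> /cvg_ex[l /cvg_nmP hl]; exists l.
Qed.

End real_inner_product.

(** * Adjoints and orthogonality *)

Section unbounded_operators.
Context {R : realType} {H : completeNormedModType R[i]}.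
Variable dot : {dot H for Num.conj}.
Hypothesis norm_dot : forall x : H, `|x| ^+ 2 = dot x x.
Local Notation ip := (rdot dot).

Lemma nm_gt0 (x : H) : x != 0 -> 0 < nm x.
Proof. by move=> x0; rewrite lt_def nm_ge0 andbT; apply/eqP => /nm_eq0; apply/eqP. Qed.

Lemma eq_of_nm_small (x : H) : (forall e : R, 0 < e -> nm x <= e) -> x = 0.
Proof.
move=> h; apply: nm_eq0; apply/eqP; rewrite eq_le nm_ge0 andbT.
by apply/ler_addgt0Pr => e e0; rewrite add0r h.
Qed.

Lemma sqr_le_inv (x : R) e : 0 <= x -> 0 < e -> x ^+ 2 <= e ^+ 2 -> x <= e.
Proof. by move=> x0 e0; rewrite ler_pXn2r// ?nnegrE// ltW. Qed.

Lemma sqr_lt_inv (x : R) e : 0 <= x -> 0 < e -> x ^+ 2 < e ^+ 2 -> x < e.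
Proof. by move=> x0 e0; rewrite ltr_pXn2r// ?nnegrE// ltW. Qed.

Lemma linD (T : uop H) x y : linear_op T -> dom T x -> dom T y ->
  dom T (x + y) /\ app T (x + y) = app T x + app T y.
Proof. by move=> [_ h] Tx Ty; have := h 1 x y Tx Ty; rewrite !scale1r. Qed.

Lemma linZ (T : uop H) k x : linear_op T -> dom T x ->
  dom T (k *: x) /\ app T (k *: x) = k *: app T x.
Proof.
move=> [T0 h] Tx.
have e0 : app T 0 = 0.
  have [_] := h 1 0 0 T0 T0; rewrite !scale1r addr0 => /(congr1 (fun z => z - app T 0)).
  by rewrite /= addrK subrr => <-.
by have := h k x 0 Tx T0; rewrite !addr0 e0 addr0.
Qed.

Lemma linB (T : uop H) x y : linear_op T -> dom T x -> dom T y ->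
  dom T (x - y) /\ app T (x - y) = app T x - app T y.
Proof.
move=> lT Tx Ty; have [Ty' e] := linZ (-1) lT Ty.
by have := linD lT Tx Ty'; rewrite e !scaleN1r.
Qed.

Lemma adjoint_spec (T : uop H) y : dom (adjoint dot T) y ->
  forall x, dom T x -> dot (app T x) y = dot x (app (adjoint dot T) y).
Proof. by move=> [z zP]; exact: (xgetPex 0 (ex_intro _ z zP)). Qed.

Lemma adjoint_ip (T : uop H) y : dom (adjoint dot T) y ->
  forall x, dom T x -> ip (app T x) y = ip x (app (adjoint dot T) y).
Proof. by move=> Ty x Tx; rewrite /rdot (adjoint_spec Ty). Qed.

Lemma dense_ip_eq0 (S : set H) (w : H) : dense S ->
  (forall x, S x -> ip x w = 0) -> w = 0.
Proof.
move=> dS Sw; apply/eqP/negPn/negP => w0.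
have wp := nm_gt0 w0.
have [x []] : ball w `|w| `&` S !=set0.
  by apply: dS; [exists w; apply: ballxx; rewrite normr_gt0|exact: ball_open].
rewrite -ball_normE /ball_ /= !nmE ltcR => xw /Sw xw0.
have := ip_le norm_dot (w - x) w; rewrite ipBl xw0 subr0 -nm2//.
by rewrite expr2 ler_pM2r// leNgt xw.
Qed.

(** Real parts suffice to characterize the adjoint: the domain of [T] is stable
    under multiplication by the imaginary unit. *)
Lemma adjoint_char (T : uop H) y z : linear_op T -> densely_defined T ->
  (forall x, dom T x -> ip (app T x) y = ip x z) ->
  dom (adjoint dot T) y /\ app (adjoint dot T) y = z.
Proof.
move=> lT dT yz; have zP : adjoint_value dot T y z.
  move=> x Tx; apply: dot_ip; first exact: yz.
  by have [Tix <-] := linZ 'i lT Tx; exact: yz.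
have dy : dom (adjoint dot T) y by exists z.
split=> //; apply/subr0_eq/(dense_ip_eq0 dT) => x Tx.
by rewrite ipBr {1}/rdot -(adjoint_spec dy)// zP// subrr.
Qed.

Lemma adjoint_linear (T : uop H) : linear_op T -> densely_defined T ->
  linear_op (adjoint dot T).
Proof.
move=> lT dT; split.
  by apply: (proj1 (@adjoint_char T 0 0 lT dT _)) => x _; rewrite !ip0r.
move=> k x y Tx Ty.
have h w : dom T w -> dot (app T w) (k *: x + y) =
    dot w (k *: app (adjoint dot T) x + app (adjoint dot T) y).
  move=> Tw; rewrite !linearDr !linearZr_LR /=.
  by rewrite (adjoint_spec Tx)// (adjoint_spec Ty).
by apply: adjoint_char => // w Tw; rewrite /rdot h.
Qed.

Lemma ip_lim0 (x : H) (u : nat -> H) l :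
  (forall e : R, 0 < e -> exists N, forall n, (N <= n)%N -> nm (u n - l) < e) ->
  forall e : R, 0 < e -> exists N, forall n, (N <= n)%N -> `|ip x (u n) - ip x l| < e.
Proof.
move=> h e e0; have d0 : 0 < e / (nm x + 1).
  by rewrite divr_gt0// ltr_wpDl// nm_ge0.
have [N hN] := h _ d0; exists N => n Nn; rewrite -ipBr.
apply: (le_lt_trans (ip_abs norm_dot _ _)).
have := hN _ Nn; rewrite ltr_pdivlMr ?ltr_wpDl ?nm_ge0//.
by have := nm_ge0 (u n - l); have := nm_ge0 x; lra.
Qed.

Lemma adjoint_closed (T : uop H) (u : nat -> H) y z :
  linear_op T -> densely_defined T ->
  (forall n, dom (adjoint dot T) (u n)) ->
  (forall e : R, 0 < e -> exists N, forall n, (N <= n)%N -> nm (u n - y) < e) ->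
  (forall e : R, 0 < e -> exists N, forall n, (N <= n)%N ->
     nm (app (adjoint dot T) (u n) - z) < e) ->
  dom (adjoint dot T) y /\ app (adjoint dot T) y = z.
Proof.
move=> lT dT Tu uy uz; apply: adjoint_char => // x Tx.
apply/subr0_eq/eqP; rewrite -normr_eq0 eq_le normr_ge0 andbT.
apply/ler_addgt0Pr => e e0; have e2 : 0 < e / 2 by rewrite divr_gt0.
have [N1 h1] := ip_lim0 (app T x) uy e2; have [N2 h2] := ip_lim0 x uz e2.
have := h1 _ (leq_maxl N1 N2); have := h2 _ (leq_maxr N1 N2).
rewrite -(adjoint_ip (Tu _))// add0r !ltr_norml ler_norml.
by move=> /andP[? ?] /andP[? ?]; apply/andP; split; lra.
Qed.

(** The point of the subspace nearest to [x0], found by minimising the distance,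
    differs from [x0] by a vector orthogonal to the subspace. *)
Lemma subspace_full (M : set H) : M 0 ->
  (forall (r : R) x y, M x -> M y -> M (r%:C *: x + y)) ->
  (forall (u : nat -> H) l, (forall n, M (u n)) ->
    (forall e : R, 0 < e -> exists N, forall n, (N <= n)%N -> nm (u n - l) < e) -> M l) ->
  (forall y, (forall m, M m -> ip m y = 0) -> y = 0) ->
  forall x, M x.
Proof.
move=> M0 Ml Mc Mo x0.
set S := [set nm (x0 - m) ^+ 2 | m in M].
have Slb : lbound S 0 by move=> _ [m _ <-]; exact: sqr_ge0.
have Si : has_inf S by split; [exists (nm (x0 - 0) ^+ 2); exists 0|exists 0].
set d := inf S.
have dle m : M m -> d <= nm (x0 - m) ^+ 2.
  by move=> Mm; apply: ge_inf; [exists 0|exists m].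
have /choice[u uP] : forall n : nat, exists m, M m /\ nm (x0 - m) ^+ 2 < d + n.+1%:R^-1.
  move=> n; have n0 : 0 < n.+1%:R^-1 :> R by rewrite invr_gt0.
  by have [_ [m Mm <-] mP] := inf_adherent n0 Si; exists m.
have uM n : M (u n) by case: (uP n).
have half n m : nm (u n - u m) ^+ 2 <= 2 * (n.+1%:R^-1 + m.+1%:R^-1).
  set w := ((2^-1)%:C *: (u n + u m) : H).
  have Mw : M w.
    rewrite -[w]addr0; apply: (Ml) => //.
    by rewrite -[u n]scale1r; exact: (Ml 1).
  have := dle _ Mw; have [_] := uP n; have [_] := uP m.
  have : nm (u n - u m) ^+ 2 = 2 * nm (x0 - u n) ^+ 2 + 2 * nm (x0 - u m) ^+ 2
      - 4 * nm (x0 - w) ^+ 2.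
    rewrite !(nmB2 norm_dot) nmZr ipZr ipDr exprMn real_normK ?num_real//.
    by rewrite (nmD2 norm_dot); field.
  by move: (n.+1%:R^-1) (m.+1%:R^-1) (nm _ ^+ 2) (nm _ ^+ 2) (nm _ ^+ 2) => *; lra.
have [l lP] : exists l, forall e : R, 0 < e -> exists N, forall n, (N <= n)%N ->
    nm (u n - l) < e.
  apply: nm_complete => e e0.
  have [N hN] : exists N, forall n, (N <= n)%N -> n.+1%:R^-1 < e ^+ 2 / 4 :> R.
    have e4 : 0 < e ^+ 2 / 4 by rewrite divr_gt0// exprn_gt0.
    have [N _ hN] := near_infty_natSinv_lt (PosNum e4).
    by exists N => n Nn; exact: hN.
  exists N => n m /hN hn /hN hm; have h := half n m.
  apply: sqr_lt_inv; rewrite ?nm_ge0//.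
  by move: (n.+1%:R^-1) (m.+1%:R^-1) h hn hm => p q *; lra.
have Mlim := Mc u l uM lP.
have ld : nm (x0 - l) ^+ 2 <= d.
  have key : forall e : R, 0 < e -> nm (x0 - l) <= Num.sqrt d + e.
    move=> e e0; have e2 : 0 < e / 2 by lra.
    have [N1 h1] := lP _ e2.
    have e4 : 0 < (e / 2) ^+ 2 by rewrite exprn_gt0.
    have [N2 _ h2] := near_infty_natSinv_lt (PosNum e4).
    set n := maxn N1 N2.
    have n1 := h1 n (leq_maxl _ _); have n2 : n.+1%:R^-1 < (e / 2) ^+ 2 by exact: h2 (leq_maxr _ _).
    have [_ n3] := uP n.
    have d0 : 0 <= d by apply: lb_le_inf; [case: Si|].
    have n4 : nm (x0 - u n) <= Num.sqrt d + e / 2.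
      apply: sqr_le_inv; rewrite ?nm_ge0 ?ltr_wpDl ?sqrtr_ge0//.
      rewrite sqrrD sqr_sqrtr//; have := sqrtr_ge0 d => sd.
      by have := mulr_ge0 sd (ltW e2); move: (n.+1%:R^-1) n2 n3 => p *; rewrite -mulr_natl; lra.
    have := nmD (x0 - u n) (u n - l); rewrite addrA subrK; lra.
  have d0 : 0 <= d by apply: lb_le_inf; [case: Si|].
  have : nm (x0 - l) <= Num.sqrt d by apply/ler_addgt0Pr.
  rewrite -(@ler_pXn2r _ 2)// ?nnegrE ?nm_ge0 ?sqrtr_ge0//.
  by rewrite sqr_sqrtr.
suff : x0 - l = 0 by move/subr0_eq => ->.
apply: Mo => m Mm.
(* minimality along the line through the nearest point in direction [m] *)
have quad (r : R) : 0 <= r ^+ 2 * nm m ^+ 2 - 2 * r * ip m (x0 - l).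
  have := dle _ (Ml r m l Mm Mlim).
  have -> : x0 - (r%:C *: m + l) = (x0 - l) - r%:C *: m by rewrite opprD addrCA addrC.
  rewrite (nmB2 norm_dot) nmZr ipZr exprMn real_normK ?num_real// ipC.
  by move: ld; set p := ip _ _; lra.
have [m0|m0] := eqVneq (nm m) 0; first by rewrite (nm_eq0 m0) ip0l.
have m2 : 0 < nm m ^+ 2 by rewrite exprn_gt0// lt_def m0 nm_ge0.
have := quad (ip m (x0 - l) / nm m ^+ 2); set p := ip _ _.
have -> : (p / nm m ^+ 2) ^+ 2 * nm m ^+ 2 - 2 * (p / nm m ^+ 2) * p =
  - (p ^+ 2 / nm m ^+ 2) by field.
rewrite oppr_ge0 pmulr_lle0 ?invr_gt0// => p2.
by apply/eqP; rewrite -sqrf_eq0 eq_le p2 sqr_ge0.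
Qed.

End unbounded_operators.

(** * The kernel of the negative powers *)

Section power_integral.
Context {R : realType}.
Local Notation mu := (@lebesgue_measure R).

Lemma integral_powR_itv (p x y : R) : p + 1 != 0 -> 0 < x -> x < y ->
  (\int[mu]_(t in `[x, y]) (t `^ p)%:E = ((y `^ (p + 1) - x `^ (p + 1)) / (p + 1))%:E)%E.
Proof.
move=> p1 x0 xy.
have dpow (q t : R) : 0 < t -> derivable (fun t => t `^ q) t 1.
  by move=> t0; apply: derivable_powR; rewrite in_itv/= t0.
have cpow (q t : R) : 0 < t -> {for t, continuous (fun t => t `^ q)}.
  by move=> t0; apply/differentiable_continuous/derivable1_diffP/dpow.
have cF (t : R) : 0 < t -> {for t, continuous (fun t => (p + 1)^-1 * t `^ (p + 1))}.
  by move=> t0; apply: cvgM; [exact: cvg_cst|exact: cpow].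
have Fd (t : R) : 0 < t -> is_derive t 1 (fun t => (p + 1)^-1 * t `^ (p + 1)) (t `^ p).
  move=> t0; have h := is_derive1_powR (p + 1) t0.
  apply: is_derive_eq; rewrite /GRing.scale /=.
  by rewrite addrK mulrA mulVf// mul1r.
rewrite (@continuous_FTC2 _ _ (fun t => (p + 1)^-1 * t `^ (p + 1)))//.
- by rewrite -EFinB -mulrBr mulrC.
- apply: continuous_in_subspaceT => t; rewrite inE/= in_itv/= => /andP[xt _].
  by apply: cpow; exact: lt_le_trans xt.
- split.
  + move=> t; rewrite in_itv/= => /andP[xt _].
    by have [] := Fd _ (lt_trans x0 xt).
  + by apply: cvg_at_right_filter; exact: cF.
  + by apply: cvg_at_left_filter; apply: cF; exact: lt_trans xy.
- move=> t; rewrite in_itv/= => /andP[xt _].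
  by rewrite derive1E; have [_ ->] := Fd _ (lt_trans x0 xt).
Qed.

Lemma measurable_powR_div (al c : R) (D : set R) : 0 < c ->
  D `<=` `]0, +oo[ -> measurable D ->
  measurable_fun D (fun t : R => t `^ (- al) / (t + c)).
Proof.
move=> c0 D0 mD; apply: measurable_funM.
  exact: (measurable_funS _ _ (@measurable_powR R _)).
suff : measurable_fun (`]0, +oo[%classic : set R) (fun t : R => (t + c)^-1).
  exact: measurable_funS.
apply: open_continuous_measurable_fun; first exact: interval_open.
move=> t; rewrite inE/= in_itv/= andbT => t0.
apply: cvgV; first by rewrite gt_eqF// addr_gt0.
by apply: cvgD; [exact: cvg_id|exact: cvg_cst].
Qed.

(** The kernel behaves like [t^-al] at [0] and like [t^(-al-1)] at infinity. *)
Lemma integrable_power_kernel (al c : R) : 0 < al -> al < 1 -> 0 < c ->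
  mu.-integrable `]0, +oo[ (EFin \o (fun t : R => t `^ (- al) / (t + c))).
Proof.
move=> al0 al1 c0; set g := fun t : R => _.
have g0 t : 0 < t -> 0 <= g t by move=> t0; rewrite /g divr_ge0 ?powR_ge0// ltW// addr_gt0.
pose F (n : nat) : set R := `[n.+2%:R^-1, n.+2%:R]%classic.
have n2 (n : nat) : 0 < n.+2%:R^-1 :> R by rewrite invr_gt0.
have n21 (n : nat) : n.+2%:R^-1 < 1 :> R by rewrite invf_lt1// ltr1n.
have n12 (n : nat) : 1 < n.+2%:R :> R by rewrite ltr1n.
have FU : `]0, +oo[%classic = \bigcup_n F n.
  apply/seteqP; split => t /=; rewrite /F /= in_itv/= ?andbT; last first.
    by move=> [n _] /=; rewrite in_itv/= => /andP[h _]; exact: lt_le_trans h.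
  move=> t0; exists (maxn (Num.truncn t^-1) (Num.truncn t)) => //=.
  rewrite in_itv/=; apply/andP; split.
    rewrite -[leRHS]invrK lef_pV2 ?posrE ?invr_gt0//.
    apply: (le_trans (ltW (truncnS_gt _))); rewrite ler_nat.
    by rewrite -addn1 -(addn1 _.+1) leq_add2r ltnW// ltnS leq_maxl.
  apply: (le_trans (ltW (truncnS_gt _))); rewrite ler_nat.
  by rewrite ltnW// !ltnS leq_maxr.
have mg (D : set R) : D `<=` `]0, +oo[ -> measurable D -> measurable_fun D (EFin \o g).
  by move=> D0 mD; apply/measurable_EFinP; exact: measurable_powR_div.
apply/integrableP; split; first exact: mg.
pose D0 : set R := `]0, +oo[%classic.
have -> : (\int[mu]_(x in D0) `|(EFin \o g) x| =
    \int[mu]_(x in D0) (EFin \o g) x)%E.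
  apply: eq_integral => t; rewrite inE /D0/= in_itv/= andbT => t0.
  by rewrite ger0_norm ?g0.
rewrite /D0 FU.
pose C := c^-1 / (1 - al) + al^-1.
have sub1 (a b : R) (ba bb : bool) : 0 < a -> [set` Interval (BSide ba a) (BSide bb b)] `<=` `]0%R, +oo[.
  by move=> a0 t /=; rewrite !itv_boundlr bnd_simp/= andbT => /andP[h _]; case: ba h; rewrite bnd_simp; [exact: lt_le_trans|exact: lt_trans].
have pos1 (a b t : R) (ba bb : bool) : 0 < a -> t \in Interval (BSide ba a) (BSide bb b) -> 0 < t.
  by move=> a0 /(sub1 _ _ _ _ a0); rewrite /= in_itv/= andbT.
pose k := c^-1; pose q := - al - 1.
have bnd (x y : R) : 0 < x -> x < 1 -> 1 < y ->
    (\int[mu]_(t in `[x, y]) (EFin \o g) t <= C%:E)%E.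
  move=> x0 x1 y1.
  have -> : `[x, y]%classic = (`[x, 1] `|` `]1, y])%classic :> set R.
    by rewrite (@itv_bndbnd_setU _ _ _ (BRight 1) _)// bnd_simp ltW.
  rewrite ge0_integral_setU//=.
  - rewrite EFinD; apply: leeD.
    + apply: (@le_trans _ _ (\int[mu]_(t in `[x, 1%R]) (k%:E * (t `^ (- al))%:E)))%E.
        apply: ge0_le_integral => //=.
        * move=> t; rewrite in_itv/= => /andP[h _]; rewrite lee_fin g0//.
          exact: lt_le_trans h.
        * by apply: mg => //; exact: sub1.
        * apply/measurable_EFinP; apply: measurable_funM => //.
          exact: (measurable_funS _ _ (@measurable_powR R (- al))).
        move=> t; rewrite in_itv/= => /andP[h _]; have t0 := lt_le_trans x0 h.
        rewrite lee_fin /g mulrC ler_wpM2r ?powR_ge0// lef_pV2 ?posrE ?addr_gt0//.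
        by rewrite lerDr ltW.
      rewrite ge0_integralZl_EFin//; last 3 first.
      * by move=> t _; rewrite lee_fin powR_ge0.
      * apply/measurable_EFinP.
        exact: (measurable_funS _ _ (@measurable_powR R (- al))).
      * by rewrite invr_ge0 ltW.
      rewrite integral_powR_itv//; last by rewrite addrC subr_eq0 gt_eqF.
      rewrite lee_fin; apply: ler_wpM2l; first by rewrite invr_ge0 ltW.
      rewrite powR1 (addrC (- al)) -[leRHS]mul1r ler_wpM2r//.
        by rewrite invr_ge0 subr_ge0 ltW.
      by rewrite gerBl powR_ge0.
    + rewrite integral_itv_obnd_cbnd; last by apply: mg => //; exact: sub1.
      apply: (@le_trans _ _ (\int[mu]_(t in `[1%R, y]) (t `^ q)%:E))%E.
        apply: ge0_le_integral => //=.
        * move=> t; rewrite in_itv/= => /andP[h _]; rewrite lee_fin g0//.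
          exact: lt_le_trans h.
        * by apply: mg => //; exact: sub1.
        * apply/measurable_EFinP.
          exact: (measurable_funS _ _ (@measurable_powR R _)).
        move=> t; rewrite in_itv/= => /andP[h _]; have t0 : 0 < t by exact: lt_le_trans h.
        rewrite lee_fin /g /q powRB; last by rewrite (gt_eqF t0) implybT.
        rewrite powRr1 ?(ltW t0)// ler_wpM2l ?powR_ge0// lef_pV2 ?posrE ?addr_gt0//.
        by rewrite lerDl ltW.
      rewrite /q integral_powR_itv// ?subrK ?oppr_eq0 ?gt_eqF// lee_fin powR1.
      rewrite invrN mulrN -mulNr opprB -[leRHS]mul1r ler_wpM2r ?invr_ge0 ?(ltW al0)//.
      by rewrite gerBl powR_ge0.
  - by apply: mg; [move=> t []; exact: sub1|exact: measurableU].
  - by move=> t /= th; rewrite lee_fin g0//; case: th; exact: pos1.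
  - apply/disj_setPLR => t /=; rewrite !in_itv/= => /andP[_ h] /=.
    by rewrite ltNge h.
apply: (@le_lt_trans _ _ C%:E); last exact: ltry.
apply: (cvge_to_le (ge0_nondecreasing_set_cvg_integral _ _ _ _)).
- apply/nondecreasing_seqP => n; rewrite subsetEset /F; apply: subset_itv.
    by rewrite bnd_simp lef_pV2 ?posrE// ler_nat.
  by rewrite bnd_simp ler_nat.
- by move=> i; rewrite /F.
- by move=> i; apply: mg => [t|]; [exact: sub1|rewrite /F].
- move=> i t; rewrite /F /= in_itv/= => /andP[h _]; rewrite lee_fin g0//.
  exact: lt_le_trans h.
- by near=> n; apply: bnd.
Unshelve. all: by end_near. Qed.

End power_integral.

(** * Coercivity of the fractional powers *)

Section fractional_power.
Context {R : realType} {H : completeNormedModType R[i]}.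
Variable dot : {dot H for Num.conj}.
Hypothesis norm_dot : forall x : H, `|x| ^+ 2 = dot x x.
Local Notation ip := (rdot dot).
Variables (A : uop H) (c : R).
Hypothesis A_sa : self_adjoint dot A.
Hypothesis c_gt0 : 0 < c.
Hypothesis A_pos : forall x, dom A x -> c%:C * `|x| ^+ 2 <= dot (app A x) x.
Local Notation mu := (@lebesgue_measure R).
Local Notation RT t := (resolvent A t).

Let A_lin : linear_op A. Proof. by case: A_sa. Qed.
Let A_dense : densely_defined A. Proof. by case: A_sa. Qed.

Lemma ip_pos x : dom A x -> c * nm x ^+ 2 <= ip (app A x) x.
Proof.
move=> /A_pos; rewrite nmE -rmorphXn -rmorphM lecE => /andP[_].
by rewrite /= /rdot.
Qed.

Lemma shift_lower t y : 0 <= t -> dom A y ->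
  (t + c) * nm y <= nm (t%:C *: y + app A y).
Proof.
move=> t0 Ay; have [->|y0] := eqVneq y 0; first by rewrite nm0 mulr0 nm_ge0.
have yp := nm_gt0 y0; rewrite -(ler_pM2r yp).
have := ip_le norm_dot (t%:C *: y + app A y) y; rewrite ipDl ipZl -(nm2 norm_dot).
have := ip_pos Ay; lra.
Qed.

Lemma A_seq_closed (u : nat -> H) y z : (forall n, dom A (u n)) ->
  (forall e : R, 0 < e -> exists N, forall n, (N <= n)%N -> nm (u n - y) < e) ->
  (forall e : R, 0 < e -> exists N, forall n, (N <= n)%N -> nm (app A (u n) - z) < e) ->
  dom A y /\ app A y = z.
Proof.
have [_ _ [dA eA]] := A_sa => uA uy uz.
have [] := @adjoint_closed R H dot norm_dot A u y z A_lin A_dense.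
- by move=> n; rewrite -dA.
- exact: uy.
- move=> e /uz[N hN]; exists N => n Nn; rewrite -eA//; exact: hN.
by rewrite -dA => Ay; rewrite -eA.
Qed.

(** The range of [t + A] is closed by the lower bound [shift_lower], and a vector
    orthogonal to it is in the kernel of the self-adjoint [t + A]. *)
Lemma resolventP t x : 0 <= t ->
  dom A (RT t x) /\ t%:C *: RT t x + app A (RT t x) = x.
Proof.
move=> t0; set M := [set x | exists y, dom A y /\ t%:C *: y + app A y = x].
suff /(xgetPex 0) : M x by [].
have tc : 0 < t + c by rewrite ltr_wpDl.
apply: (subspace_full norm_dot (M := M)).
- exists 0; have [A0 e] := linZ 0 A_lin A_lin.1.
  by move: A0 e; rewrite !scale0r scaler0 add0r => ? ->.
- move=> r _ _ [y [Ay <-]] [z [Az <-]]; exists (r%:C *: y + z).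
  have [Ayz ->] := A_lin.2 r%:C y z Ay Az; split=> //.
  by rewrite !scalerDr !scalerA (mulrC t%:C) addrACA.
- move=> u l uM ul; have /choice[y yP] := uM.
  have [y0 y0P] : exists l, forall e : R, 0 < e -> exists N, forall n, (N <= n)%N ->
      nm (y n - l) < e.
    apply: nm_complete => e e0; have d0 : 0 < e * (t + c) / 2 by rewrite divr_gt0// mulr_gt0.
    have [N hN] := ul _ d0.
    exists N => n m Nn Nm; rewrite -(ltr_pM2l tc).
    have [yn en] := yP n; have [ym em] := yP m.
    have [Ad ed] := linB A_lin yn ym.
    apply: (le_lt_trans (shift_lower t0 Ad)).
    have -> : t%:C *: (y n - y m) + app A (y n - y m) = u n - u m.
      by rewrite ed scalerBr addrACA -opprD en em.
    have := nmD (u n - l) (l - u m); rewrite addrA subrK (nmC l).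
    by have := hN _ Nn; have := hN _ Nm; lra.
  have [Ay0 ey0] : dom A y0 /\ app A y0 = l - t%:C *: y0.
    apply: (A_seq_closed _ y0P); first by move=> n; case: (yP n).
    move=> e e0; have e2 : 0 < e / 2 by lra.
    have d0 : 0 < e / (2 * (t + 1)) by rewrite divr_gt0// mulr_gt0//; lra.
    have [N1 h1] := ul _ e2; have [N2 h2] := y0P _ d0.
    exists (maxn N1 N2) => n; rewrite geq_max => /andP[/h1 n1 /h2 n2].
    have [_ en] := yP n.
    have -> : app A (y n) - (l - t%:C *: y0) = (u n - l) - t%:C *: (y n - y0).
      by rewrite -en scalerBr !opprB [RHS]addrC !addrA subrK (addrC (app _ _)).
    have := nmB (u n - l) (t%:C *: (y n - y0)); rewrite nmZr (ger0_norm t0).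
    move: n2; rewrite ltr_pdivlMr; last by lra.
    have := nm_ge0 (y n - y0); nra.
  by exists y0; split=> //; rewrite ey0 addrC subrK.
- move=> y yM.
  have [Ay ey] : dom A y /\ app A y = (- t)%:C *: y.
    have [_ _ [dA eA]] := A_sa.
    suff [] : dom (adjoint dot A) y /\ app (adjoint dot A) y = (- t)%:C *: y.
      by rewrite -dA => Ay; rewrite -eA.
    apply: adjoint_char => // x' Ax'; rewrite ipZr.
    have := yM (t%:C *: x' + app A x'); rewrite ipDl ipZl => h.
    have : t * ip x' y + ip (app A x') y = 0 by apply: h; exists x'.
    lra.
  have := ip_pos Ay; rewrite ey ipZl -(nm2 norm_dot) => h.
  apply/nm_eq0/eqP; rewrite -sqrf_eq0 eq_le sqr_ge0 andbT.
  have : 0 <= nm y ^+ 2 by exact: sqr_ge0.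
  rewrite -(@pmulr_rle0 _ (t + c))//; lra.
Qed.

Lemma resolvent_le t x : 0 <= t -> nm (RT t x) <= nm x / (t + c).
Proof.
move=> t0; have [Ay e] := resolventP x t0.
rewrite ler_pdivlMr ?ltr_wpDl// mulrC -{2}e; exact: shift_lower.
Qed.

Lemma resolvent_lip t s x : 0 <= t -> 0 <= s ->
  nm (RT t x - RT s x) <= `|t - s| * (nm x / c ^+ 2).
Proof.
move=> t0 s0; have [At et] := resolventP x t0; have [As es] := resolventP x s0.
have [Ad ed] := linB A_lin At As; have := shift_lower t0 Ad.
have -> : t%:C *: (RT t x - RT s x) + app A (RT t x - RT s x) = (s - t)%:C *: RT s x.
  rewrite ed scalerBr addrACA et -opprD -{1}es opprD addrACA subrr addr0.
  by rewrite -scalerBl -rmorphB.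
rewrite nmZr distrC => h; have := resolvent_le x s0.
have cs : nm x / (s + c) <= nm x / c.
  by rewrite ler_wpM2l ?nm_ge0// lef_pV2 ?posrE ?ltr_wpDl// lerDr.
move=> /le_trans/(_ cs) => h2.
have h3 : c * nm (RT t x - RT s x) <= `|t - s| * (nm x / c).
  apply: (le_trans _ (le_trans h _)); first by rewrite ler_wpM2r ?nm_ge0// lerDr.
  by rewrite ler_wpM2l.
rewrite -(ler_pM2l c_gt0); apply: (le_trans h3).
by rewrite le_eqVlt; apply/orP; left; apply/eqP; field; rewrite gt_eqF.
Qed.

Lemma resolvent_measurable x y (al : R) :
  measurable_fun (`]0, +oo[%classic : set R) (fun t => t `^ (- al) * ip (RT t x) y).
Proof.
apply: measurable_funM.
  exact: (measurable_funS _ _ (@measurable_powR R _)).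
apply: open_continuous_measurable_fun; first exact: interval_open.
move=> t; rewrite inE/= in_itv/= andbT => t0.
pose L := nm x / c ^+ 2 * nm y.
have L0 : 0 <= L by rewrite mulr_ge0 ?nm_ge0// divr_ge0 ?nm_ge0// sqr_ge0.
apply/cvgrPdist_lt => e e0.
have d0 : 0 < e / (L + 1) by rewrite divr_gt0// ltr_wpDl.
have /cvgrPdist_lt/(_ _ d0) hid : x @[x --> t] --> t by exact: cvg_id.
near=> s.
have s0 : 0 < s by near: s; exact: lt_nbhsr.
rewrite -ipBl; apply: (le_lt_trans (ip_abs norm_dot _ _)).
apply: (@le_lt_trans _ _ (`|t - s| * L)).
  by rewrite /L mulrA ler_wpM2r ?nm_ge0// resolvent_lip// ltW.
have : `|t - s| < e / (L + 1).
  by near: s; exact: hid.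
rewrite ltr_pdivlMr ?ltr_wpDl//; have := normr_ge0 (t - s); nra.
Unshelve. all: by end_near. Qed.

Lemma resolvent_integrable x y (al : R) : 0 < al -> al < 1 ->
  mu.-integrable `]0, +oo[ (EFin \o (fun t => t `^ (- al) * ip (RT t x) y)).
Proof.
move=> al0 al1.
pose K : R := nm x * nm y.
have mD : measurable (`]0, +oo[%classic : set (measurableTypeR R)) by [].
have I := integrableZl mD K (integrable_power_kernel al0 al1 c_gt0).
apply: (le_integrable mD _ _ I).
  by apply/measurable_EFinP; exact: resolvent_measurable.
move=> t; rewrite /= in_itv/= andbT => t0; rewrite lee_fin.
rewrite [leRHS]ger0_norm; last first.
  by rewrite mulr_ge0 ?mulr_ge0 ?nm_ge0 ?powR_ge0 ?invr_ge0// ltW// addr_gt0.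
rewrite normrM ger0_norm ?powR_ge0// mulrCA ler_wpM2l ?powR_ge0//.
apply: (le_trans (ip_abs norm_dot _ _)); rewrite /K mulrAC ler_wpM2r ?nm_ge0//.
by apply: resolvent_le; exact: ltW.
Qed.

(** For [w = A^-al x] the number [(w, x)] is the integral of
    [t^-al (RT t x, x)], which controls [(t + c) |RT t x|^2]; a Young inequality
    under the integral then compares it with [|w|^2]. *)
Lemma neg_power_coercive (al : R) : 0 < al -> al < 1 ->
  exists2 k : R, 0 < k & forall x w,
    (forall y, dot w y = (sin (pi * al) / pi)%:C *
      cintegral `]0, +oo[ (fun t => (t `^ (- al))%:C * dot (RT t x) y)) ->
    k * nm w ^+ 2 <= ip x w.
Proof.
move=> al0 al1; set s := sin (pi * al) / pi.
have s0 : 0 < s.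
  apply: divr_gt0; last exact: pi_gt0.
  apply: sin_gt0_pi; rewrite mulr_gt0 ?pi_gt0//=.
  by rewrite gtr_pMr ?pi_gt0.
pose D : set R := `]0, +oo[%classic.
pose J := (\int[mu]_(t in D) (t `^ (- al) / (t + c)))%R.
have J0 : 0 <= J.
  apply: Rintegral_ge0 => t; rewrite /D/= in_itv/= andbT => t0.
  by rewrite divr_ge0 ?powR_ge0// ltW// addr_gt0.
pose l := s * J + 1.
have l0 : 0 < l by rewrite ltr_wpDl// mulr_ge0// ltW.
exists l^-1; first by rewrite invr_gt0.
move=> x w wP.
have ipw y : ip w y = s * (\int[mu]_(t in D) (t `^ (- al) * ip (RT t x) y))%R.
  rewrite /rdot wP ReZ; congr (_ * _).
  by apply: eq_Rintegral => t _; rewrite ReZ.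
have I1 := resolvent_integrable x w al0 al1.
have I2 := resolvent_integrable x x al0 al1.
have I3 := integrable_power_kernel al0 al1 c_gt0.
have mD : measurable (D : set (measurableTypeR R)) by exact: measurable_itv.
pose b := nm w ^+ 2 / (2 * l).
have Z2 : (\int[mu]_(t in D) (l / 2 * (t `^ (- al) * ip (RT t x) x)))%R =
    l / 2 * (\int[mu]_(t in D) (t `^ (- al) * ip (RT t x) x))%R.
  exact: RintegralZl.
have Z3 : (\int[mu]_(t in D) (b * (t `^ (- al) / (t + c))))%R = b * J.
  exact: RintegralZl.
have I2' : mu.-integrable D (EFin \o (fun t => l / 2 * (t `^ (- al) * ip (RT t x) x))).
  by apply: (eq_integrable mD _ _ _ (integrableZl mD (l / 2) I2)) => t _; rewrite /= EFinM.
have I3' : mu.-integrable D (EFin \o (fun t => b * (t `^ (- al) / (t + c)))).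
  by apply: (eq_integrable mD _ _ _ (integrableZl mD b I3)) => t _; rewrite /= EFinM.
have key : (\int[mu]_(t in D) (t `^ (- al) * ip (RT t x) w))%R <=
    l / 2 * (\int[mu]_(t in D) (t `^ (- al) * ip (RT t x) x))%R + b * J.
  rewrite -Z2 -Z3 -RintegralD//; apply: le_Rintegral => //.
    by apply: (eq_integrable mD _ _ _ (integrableD mD I2' I3')) => t _; rewrite /= EFinD.
  move=> t; rewrite /D/= in_itv/= andbT => t0.
  rewrite mulrCA [b * _]mulrCA -mulrDr ler_wpM2l ?powR_ge0//.
  have tc : 0 < t + c by rewrite addr_gt0.
  have [At et] := resolventP x (ltW t0).
  have h : (t + c) * nm (RT t x) ^+ 2 <= ip (RT t x) x.
    have -> : ip (RT t x) x = ip (RT t x) (t%:C *: RT t x + app A (RT t x)).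
      by rewrite et.
    rewrite ipDr ipZr -(nm2 norm_dot) mulrDl lerD2l ipC.
    exact: ip_pos.
  have := ip_young norm_dot (RT t x) w (mulr_gt0 l0 tc).
  have -> : nm w ^+ 2 / (2 * (l * (t + c))) = b / (t + c).
    by rewrite /b; field; rewrite !gt_eqF.
  have : l / 2 * ((t + c) * nm (RT t x) ^+ 2) <= l / 2 * ip (RT t x) x.
    by rewrite ler_wpM2l// divr_ge0// ltW.
  lra.
have e1 := ipw w; have e2 := ipw x.
have : nm w ^+ 2 <= l / 2 * ip w x + s * (b * J).
  rewrite (nm2 norm_dot) e1 e2.
  by rewrite [leRHS](_ : _ = s * (l / 2 * (\int[mu]_(t in D) (t `^ (- al) * ip (RT t x) x))%R + b * J));
    [rewrite ler_wpM2l// ltW|ring].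
have -> : s * (b * J) = nm w ^+ 2 / 2 * (s * J / l) by rewrite /b; field; rewrite gt_eqF.
have sJ : s * J / l <= 1 by rewrite ler_pdivrMr// mul1r /l lerDl.
have : nm w ^+ 2 / 2 * (s * J / l) <= nm w ^+ 2 / 2 * 1.
  by rewrite ler_wpM2l// divr_ge0// sqr_ge0.
rewrite ipC => h1 h2; rewrite mulrC ler_pdivrMr// [leRHS]mulrC; lra.
Qed.

(** For [0 < al < 1] a vector of the domain of [A^al] is some [A^-al x], whose
    image is [x]; the lower bound is then the one of the negative power. *)
Lemma frac_power_coercive (al : R) : 0 <= al <= 1 ->
  exists2 k : R, 0 < k & forall x, dom (frac_power dot A al) x ->
    k * nm x ^+ 2 <= ip (app (frac_power dot A al) x) x.
Proof.
move=> /andP[al0 al1]; rewrite /frac_power.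
case: eqP => [_|/eqP a0].
  by exists 1 => // x _ /=; rewrite mul1r (nm2 norm_dot).
case: eqP => [_|/eqP a1]; first by exists c => // x; exact: ip_pos.
have [k k0 kP] := @neg_power_coercive al ltac:(by rewrite lt_def a0) ltac:(by rewrite lt_def eq_sym a1).
exists k => // w [x _ xw] /=.
have [w0|w0] := eqVneq w 0; first by rewrite w0 nm0 ip0r expr0n mulr0.
have xP := xgetPex (0 : H) (ex_intro (fun x => neg_power dot A al x = w) x xw).
set x' := xget _ _ in xP *.
apply: kP => y; move: xP; rewrite /= /neg_power.
(* [w] is non-zero, hence it is not the default value of the choice *)
case: xgetP => [w' _ h e|_ e]; last by rewrite -e eqxx in w0.
by rewrite -e; exact: h.
Qed.

End fractional_power.

(** * Complete seminormed spaces *)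

Section seminormed_space.
Context {R : realType} {X : lmodType R[i]}.
Ltac vec := lmod (R[i] : comPzRingType) (X : Type).

(** [K] with the seminorm [p] is complete; it is a Banach space once vectors at
    distance [0] are identified, which is never done explicitly. *)
Record banach (K : set X) (p : X -> R) : Prop := {
  bn_0 : K 0 ;
  bn_lin : forall (k : R[i]) x y, K x -> K y -> K (k *: x + y) ;
  bn_ge0 : forall x, 0 <= p x ;
  bn_D : forall x y, K x -> K y -> p (x + y) <= p x + p y ;
  bn_Z : forall (k : R[i]) x, K x -> p (k *: x) = complex.Re `|k| * p x ;
  bn_complete : forall u : nat -> X, (forall n, K (u n)) ->
    (forall e : R, 0 < e -> exists N, forall n m, (N <= n)%N -> (N <= m)%N ->
       p (u n - u m) <= e) ->
    exists2 l, K l & forall e : R, 0 < e -> exists N, forall n, (N <= n)%N ->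
       p (u n - l) <= e }.

Variables (K : set X) (p : X -> R).
Hypothesis KP : banach K p.

Lemma KD x y : K x -> K y -> K (x + y).
Proof. by move=> Kx Ky; rewrite -[x]scale1r; exact: (bn_lin KP). Qed.
Lemma KZ k x : K x -> K (k *: x).
Proof. by move=> Kx; rewrite -[_ *: _]addr0; apply: (bn_lin KP) => //; exact: (bn_0 KP). Qed.
Lemma KN x : K x -> K (- x).
Proof. by move=> Kx; rewrite -scaleN1r; exact: KZ. Qed.
Lemma KB x y : K x -> K y -> K (x - y).
Proof. by move=> Kx Ky; apply: KD => //; exact: KN. Qed.
Lemma pZr (r : R) x : K x -> p (r%:C *: x) = `|r| * p x.
Proof. by move=> Kx; rewrite (bn_Z KP)// Re_norm_real. Qed.
Lemma p0 : p 0 = 0.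
Proof. by rewrite -(scale0r 0) (bn_Z KP) ?normr0 ?mul0r//; exact: (bn_0 KP). Qed.
Lemma pN x : K x -> p (- x) = p x.
Proof. by move=> Kx; rewrite -scaleN1r (bn_Z KP)// normrN1 mul1r. Qed.
Lemma pBC x y : K x -> K y -> p (x - y) = p (y - x).
Proof. by move=> Kx Ky; rewrite -opprB pN//; exact: KB. Qed.
Lemma pBD x y : K x -> K y -> p (x - y) <= p x + p y.
Proof. by move=> Kx Ky; rewrite -[p y]pN//; apply: (bn_D KP) => //; exact: KN. Qed.
Lemma ptri y x z : K x -> K y -> K z -> p (x - z) <= p (x - y) + p (y - z).
Proof.
by move=> Kx Ky Kz; rewrite -{1}(subrK y x) -addrA; apply: (bn_D KP); exact: KB.
Qed.
Lemma p_le_tri x y : K x -> K y -> p x <= p (x - y) + p y.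
Proof. by move=> Kx Ky; rewrite -{1}(subrK y x); apply: (bn_D KP) => //; exact: KB. Qed.

Lemma K_sum (I : Type) (r : seq I) (F : I -> X) :
  (forall i, K (F i)) -> K (\sum_(i <- r) F i).
Proof. by move=> KF; elim/big_rec: _ => [|i x _]; [exact: (bn_0 KP)|exact: KD]. Qed.

Lemma p_sum (F : nat -> X) (c : R) i j : (i <= j)%N ->
  (forall k, K (F k)) -> (forall k, (i <= k < j)%N -> p (F k) <= c) ->
  p (\sum_(i <= k < j) F k) <= (j - i)%:R * c.
Proof.
move=> ij KF; elim: j ij => [|j IH] ij Fc.
  by rewrite big_geq ?p0 ?sub0n ?mul0r//.
move: ij; rewrite leq_eqVlt => /predU1P[ij|].
  by rewrite ij big_geq ?p0 ?subnn ?mul0r.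
rewrite ltnS => ij; rewrite big_nat_recr//= subSn//.
apply: (le_trans (bn_D KP _ _)) => //; first exact: K_sum.
rewrite -natr1 mulrDl mul1r lerD//; last by apply: Fc; rewrite ij /=.
by apply: IH => // k /andP[ik kj]; apply: Fc; rewrite ik ltnS ltnW.
Qed.

(** Increments over a partition add up; this replaces the mean value
    inequality. *)
Lemma partition_bound (g : R -> X) (t c : R) (M : nat) : (0 < M)%N -> 0 <= t ->
  (forall s, 0 <= s -> K (g s)) ->
  (forall s s', 0 <= s -> s <= s' -> s' <= t -> s' - s <= t / M%:R ->
     p (g s' - g s) <= c) ->
  p (g t - g 0) <= M%:R * c.
Proof.
move=> M0 t0 Kg h; have Mp : 0 < M%:R :> R by rewrite ltr0n.
pose s k : R := t * k%:R / M%:R.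
have s0 k : 0 <= s k by rewrite divr_ge0 ?mulr_ge0.
have -> : g t - g 0 = \sum_(0 <= k < M) (g (s k.+1) - g (s k)).
  by rewrite telescope_sumr// /s mulr0 mul0r -mulrA divff ?mulr1// gt_eqF.
rewrite -[X in X%:R]subn0; apply: p_sum => // [k|k /andP[_ kM]].
  by apply: KB; exact: Kg.
apply: h => //.
- by rewrite /s ler_wpM2r ?invr_ge0 ?(ltW Mp)// ler_wpM2l// ler_nat.
- by rewrite /s ler_pdivrMr// ler_wpM2l// ler_nat.
- by rewrite /s -mulrBl -mulrBr -natrB// subSnn mulr1.
Qed.

Lemma pick_partition (t d : R) : 0 <= t -> 0 < d ->
  exists2 M : nat, (0 < M)%N & t / M%:R < d.
Proof.
move=> t0 d0; exists (Num.truncn (t / d)).+1 => //.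
rewrite ltr_pdivrMr ?ltr0n// mulrC -ltr_pdivrMr//; exact: truncnS_gt.
Qed.

Lemma small_increments (g : R -> X) (T : R) :
  (forall s, 0 <= s -> K (g s)) ->
  (forall e, 0 < e -> exists2 d : R, 0 < d & forall s t, 0 <= s -> s <= t -> t <= T ->
     t - s < d -> p (g t - g s) <= e * (t - s)) ->
  forall t, 0 <= t -> t <= T -> p (g t - g 0) = 0.
Proof.
move=> Kg h t t0 tT; apply/eqP; rewrite eq_le (bn_ge0 KP) andbT.
apply/ler_addgt0Pr => e e0; rewrite add0r.
have e1 : 0 < e / (t + 1) by rewrite divr_gt0// ltr_wpDl.
have [d d0 hd] := h _ e1; have [M M0 Md] := pick_partition t0 d0.
have Mp : 0 < M%:R :> R by rewrite ltr0n.
apply: (le_trans (@partition_bound g t (e / (t + 1) * (t / M%:R)) M M0 t0 Kg _)).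
  move=> s s' s0 ss' s't sM; apply: le_trans (hd s s' s0 ss' _ _) _.
  - exact: le_trans tT.
  - exact: le_lt_trans Md.
  - by rewrite ler_wpM2l// ltW.
have -> : M%:R * (e / (t + 1) * (t / M%:R)) = e * (t / (t + 1)).
  by field; rewrite !gt_eqF// ltr_wpDl.
by rewrite ler_piMr ?(ltW e0)// ler_pdivrMr ?ltr_wpDl// mul1r lerDl.
Qed.

Section antiderivative.
Variable f : R -> X.
Hypothesis Kf : forall t, 0 <= t -> K (f t).
Hypothesis f_unif : forall T e : R, 0 < e -> exists2 d, 0 < d &
  forall s t, 0 <= s -> s <= t -> t <= T -> t - s < d -> p (f t - f s) <= e.

Let step (d t : R) : X := d%:C *: \sum_(0 <= k < Num.truncn (t / d)) f (k%:R * d).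

Let K_step d t : 0 < d -> K (step d t).
Proof.
move=> d0; apply: KZ; apply: K_sum => k; apply: Kf.
by rewrite mulr_ge0// ltW.
Qed.

Let f_bounded (T : R) : exists2 B, 0 <= B & forall t, 0 <= t -> t <= T -> p (f t) <= B.
Proof.
have [d d0 hd] := f_unif T ltr01.
have [T0|T0] := leP 0 T; last first.
  by exists 0 => // t t0 /(le_trans t0); rewrite leNgt T0.
have [M M0 Md] := pick_partition T0 d0.
have Mp : 0 < M%:R :> R by rewrite ltr0n.
exists (M%:R * 1 + p (f 0)).
  by rewrite addr_ge0 ?(bn_ge0 KP)// mulr1 ltW.
move=> t t0 tT; apply: le_trans (p_le_tri (Kf t0) (Kf (lexx 0))) _.
rewrite lerD2r; apply: partition_bound => // s s' s0 ss' s't sM.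
apply: hd => //; first exact: le_trans tT.
apply: le_lt_trans Md; apply: (le_trans sM).
by rewrite ler_wpM2r// invr_ge0 ltW.
Qed.

Let step_incr (T e : R) : 0 < e -> exists2 d0, 0 < d0 & exists C : R, 0 <= C /\
  forall d s t, 0 < d -> d < d0 -> 0 <= s -> s <= t -> t <= T -> t - s < d0 ->
    p (step d t - step d s - (t - s)%:C *: f s) <= e * (t - s) + C * d.
Proof.
move=> e0; have [d1 d10 hd] := f_unif T e0.
have [B B0 hB] := f_bounded T.
exists d1 => //; exists (e + B); split; first by rewrite addr_ge0// ltW.
move=> d s t dp dd s0 st tT ts.
have t0 := le_trans s0 st.
set i := Num.truncn (s / d); set j := Num.truncn (t / d).
have ij : (i <= j)%N by apply: le_truncn; rewrite ler_wpM2r// invr_ge0 ltW.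
have /andP[i1 i2] : i%:R * d <= s < i.+1%:R * d.
  rewrite -ler_pdivlMr// -ltr_pdivrMr//; apply: truncn_itv.
  by rewrite divr_ge0// ltW.
have /andP[j1 j2] : j%:R * d <= t < j.+1%:R * d.
  rewrite -ler_pdivlMr// -ltr_pdivrMr//; apply: truncn_itv.
  by rewrite divr_ge0// ltW.
have Kfs := Kf s0.
have Kk k : K (f (k%:R * d)) by apply: Kf; rewrite mulr_ge0// ltW.
pose Sg := \sum_(i <= k < j) (f (k%:R * d) - f s).
have KSg : K Sg by apply: K_sum => k; exact: KB.
have eS : step d t - step d s - (t - s)%:C *: f s =
    d%:C *: Sg + ((j - i)%:R * d - (t - s))%:C *: f s.
  rewrite /step -scalerBr -/i -/j (@big_cat_nat _ _ _ i 0 j)//= addrAC subrr add0r.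
  rewrite /Sg sumrB big_const_nat iter_addr_0 -[f s *+ _]scaler_nat.
  rewrite -[(j - i)%:R : R[i]](rmorph_nat (real_complex R)).
  by move: (\sum_(_ <= _ < _) _) ((j - i)%:R : R) => v q; vec.
have ijr : (j - i)%:R = j%:R - i%:R :> R by rewrite natrB.
have cnt1 : (j - i)%:R * d <= t - s + d.
  by rewrite ijr; move: i2 j1; rewrite -natr1; lra.
have cnt2 : t - s - d <= (j - i)%:R * d.
  by rewrite ijr; move: i1 j2; rewrite -natr1; lra.
rewrite eS; apply: le_trans (bn_D KP (KZ _ KSg) (KZ _ Kfs)) _.
rewrite !pZr// (ger0_norm (ltW dp)).
have pS : p Sg <= (j - i)%:R * e.
  apply: p_sum => // [k|k /andP[ik kj]]; first exact: KB.
  have kt : k%:R * d <= t.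
    apply: le_trans j1; rewrite ler_wpM2r ?(ltW dp)// ler_nat; exact: ltnW.
  have [sk|ks] := leP s (k%:R * d).
    apply: hd => //; first exact: le_trans tT.
    apply: le_lt_trans ts; lra.
  rewrite pBC//; apply: hd => //; [by rewrite mulr_ge0// ltW|exact: ltW|exact: le_trans tT|].
  have : i%:R * d <= k%:R * d by rewrite ler_wpM2r ?(ltW dp)// ler_nat.
  by move: i2; rewrite -natr1; lra.
have pf : p (f s) <= B by apply: hB => //; exact: le_trans tT.
have : d * p Sg <= e * (t - s + d).
  apply: (@le_trans _ _ (e * ((j - i)%:R * d))); last by rewrite ler_wpM2l// ltW.
  by rewrite [leRHS](_ : _ = d * ((j - i)%:R * e)); [rewrite ler_wpM2l// ltW|ring].
have : `|(j - i)%:R * d - (t - s)| * p (f s) <= d * B.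
  apply: ler_pM => //; first exact: (bn_ge0 KP).
  by rewrite ler_norml; apply/andP; split; lra.
lra.
Qed.

(** Left Riemann step sums converge to an antiderivative. *)
Lemma antiderivative_exists : exists Y : R -> X,
  [/\ forall t, 0 <= t -> K (Y t), p (Y 0) = 0 &
    forall T e : R, 0 < e -> exists2 d, 0 < d &
      forall s t, 0 <= s -> s <= t -> t <= T -> t - s < d ->
        p (Y t - Y s - (t - s)%:C *: f s) <= e * (t - s)].
Proof.
pose dn (n : nat) : R := n.+1%:R^-1.
have dn0 n : 0 < dn n by rewrite /dn invr_gt0.
have dn_small (e : R) : 0 < e -> exists N, forall n, (N <= n)%N -> dn n < e.
  move=> e0; have [N _ hN] := near_infty_natSinv_lt (PosNum e0).
  by exists N => n Nn; exact: hN.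
have cauchy t : 0 <= t -> forall e : R, 0 < e -> exists N, forall n m,
    (N <= n)%N -> (N <= m)%N -> p (step (dn n) t - step (dn m) t) <= e.
  move=> t0 e e0; have e1 : 0 < e / (4 * (t + 1)).
    by rewrite divr_gt0// mulr_gt0// ltr_wpDl.
  have [d0 d00 [C [C0 hC]]] := step_incr t e1.
  have [M M0 Md] := pick_partition t0 d00.
  have Mp : 0 < M%:R :> R by rewrite ltr0n.
  have e2 : 0 < e / (4 * M%:R * (C + 1)) by rewrite divr_gt0// !mulr_gt0// ltr_wpDl.
  have [N1 h1] := dn_small _ e2; have [N2 h2] := dn_small _ d00.
  exists (maxn N1 N2) => n m; rewrite !geq_max => /andP[n1 n2] /andP[m1 m2].
  pose g s := step (dn n) s - step (dn m) s.
  have Kg s : K (g s) by apply: KB; exact: K_step.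
  have g00 : g 0 = 0.
    by rewrite /g /step !mul0r truncn0 !big_geq// !scaler0 subrr.
  have : p (g t - g 0) <= M%:R * (2 * (e / (4 * (t + 1))) * (t / M%:R) + C * (dn n + dn m)).
    apply: partition_bound => // s s' s0 ss' s't sM.
    have sd : s' - s < d0 by exact: le_lt_trans Md.
    have -> : g s' - g s = (step (dn n) s' - step (dn n) s - (s' - s)%:C *: f s) -
       (step (dn m) s' - step (dn m) s - (s' - s)%:C *: f s).
      by rewrite /g; vec.
    have Kfs := Kf s0.
    apply: le_trans (pBD _ _) _; [by repeat apply: KB; try exact: K_step; exact: KZ|
      by repeat apply: KB; try exact: K_step; exact: KZ|].
    have a1 := hC (dn n) s s' (dn0 n) (h2 _ n2) s0 ss' s't sd.
    have a2 := hC (dn m) s s' (dn0 m) (h2 _ m2) s0 ss' s't sd.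
    have a3 : e / (4 * (t + 1)) * (s' - s) <= e / (4 * (t + 1)) * (t / M%:R).
      by rewrite ler_wpM2l// ltW.
    lra.
  rewrite g00 subr0 => /le_trans; apply.
  have -> : M%:R * (2 * (e / (4 * (t + 1))) * (t / M%:R) + C * (dn n + dn m)) =
     e / 2 * (t / (t + 1)) + M%:R * C * (dn n + dn m).
    by field; rewrite !gt_eqF// ltr_wpDl.
  have b1 : t / (t + 1) <= 1 by rewrite ler_pdivrMr ?ltr_wpDl// mul1r lerDl.
  have b2 : e / 2 * (t / (t + 1)) <= e / 2 * 1 by rewrite ler_wpM2l// divr_ge0// ltW.
  have b3 k : dn k < e / (4 * M%:R * (C + 1)) -> M%:R * C * dn k <= e / 4.
    rewrite ltr_pdivlMr ?mulr_gt0 ?ltr_wpDl// => h.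
    have : 0 <= M%:R * dn k by rewrite mulr_ge0// ltW.
    lra.
  have := b3 _ (h1 _ n1); have := b3 _ (h1 _ m1).
  rewrite (mulrDr (M%:R * C)); lra.
have lims t : exists l, 0 <= t -> K l /\ forall e : R, 0 < e -> exists N, forall n,
    (N <= n)%N -> p (step (dn n) t - l) <= e.
  have [t0|t0] := leP 0 t; last by exists 0.
  have [l Kl hl] := bn_complete KP (fun n => K_step t (dn0 n)) (cauchy t t0).
  by exists l => _; split.
have [Y YP] := choice lims; exists Y; split.
- by move=> t /YP[].
- have [K0 h0] := YP 0 (lexx 0); apply/eqP; rewrite eq_le (bn_ge0 KP) andbT.
  apply/ler_addgt0Pr => e e0; rewrite add0r; have [N /(_ N (leqnn N))] := h0 _ e0.
  by rewrite /step !mul0r truncn0 big_geq// scaler0 sub0r pN.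
- move=> T e e0; have [d0 d00 [C [C0 hC]]] := step_incr T e0.
  exists d0 => // s t s0 st tT ts; apply/ler_addgt0Pr => e' e'0.
  have t0 := le_trans s0 st.
  have [Ks hs] := YP s s0; have [Kt ht] := YP t t0.
  have e4 : 0 < e' / 4 by rewrite divr_gt0.
  have e5 : 0 < e' / (4 * (C + 1)) by rewrite divr_gt0// mulr_gt0// ltr_wpDl.
  have [N1 h1] := hs _ e4; have [N2 h2] := ht _ e4.
  have [N3 h3] := dn_small _ e5; have [N4 h4] := dn_small _ d00.
  pose n := maxn (maxn N1 N2) (maxn N3 N4).
  have := leqnn n; rewrite {1}/n !geq_max => /andP[/andP[n1 n2] /andP[n3 n4]].
  have Kfs := Kf s0; have Kst r := K_step r (dn0 n).
  have -> : Y t - Y s - (t - s)%:C *: f s =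
    (step (dn n) t - step (dn n) s - (t - s)%:C *: f s) -
    ((step (dn n) t - Y t) - (step (dn n) s - Y s)).
    by vec.
  apply: le_trans (pBD _ _) _; [by apply: KB; [exact: KB|exact: KZ]|by apply: KB; exact: KB|].
  have := pBD (KB (Kst t) Kt) (KB (Kst s) Ks).
  have := hC (dn n) s t (dn0 n) (h4 _ n4) s0 st tT ts.
  have := h1 _ n1; have := h2 _ n2; have := h3 _ n3.
  rewrite ltr_pdivlMr ?mulr_gt0 ?ltr_wpDl//; have := dn0 n; lra.
Qed.

End antiderivative.

End seminormed_space.

(** * Strongly continuous semigroups *)

Section semigroup_theory.
Context {R : realType} {X : lmodType R[i]}.
Ltac vec := lmod (R[i] : comPzRingType) (X : Type).
Variables (K : set X) (p : X -> R).
Hypothesis KP : banach K p.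
Variable S : R -> X -> X.
Hypothesis SP : C0_semigroup K p S.

Let KS t x : 0 <= t -> K x -> K (S t x).
Proof. exact: (sg_stable SP). Qed.

Lemma le0_p x : p x <= 0 -> p x = 0.
Proof. by move=> h; apply/eqP; rewrite eq_le h (bn_ge0 KP). Qed.

Lemma p_eq_tri x y : K x -> K y -> p (x - y) = 0 -> p x = p y.
Proof.
move=> Kx Ky h; apply/eqP; rewrite eq_le.
have := p_le_tri KP Kx Ky; have := p_le_tri KP Ky Kx.
by rewrite (pBC KP Ky Kx) h !add0r => -> ->.
Qed.

Lemma SD t x y : 0 <= t -> K x -> K y -> p (S t (x + y) - (S t x + S t y)) = 0.
Proof.
move=> t0 Kx Ky; have := sg_linear SP 1 t0 Kx Ky; by rewrite !scale1r.
Qed.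

Lemma SB t x y : 0 <= t -> K x -> K y -> p (S t (x - y) - (S t x - S t y)) = 0.
Proof.
move=> t0 Kx Ky; have := sg_linear SP (-1) t0 Ky Kx.
by rewrite !scaleN1r (addrC (- y)) (addrC (- S t y)).
Qed.

Lemma SB_norm t x y : 0 <= t -> K x -> K y -> p (S t x - S t y) = p (S t (x - y)).
Proof.
move=> t0 Kx Ky; apply: p_eq_tri.
- exact: (KB KP (KS t0 Kx) (KS t0 Ky)).
- by apply: KS => //; exact: (KB KP).
rewrite (pBC KP); [exact: SB|by apply: (KB KP); exact: KS|apply: KS => //; exact: (KB KP)].
Qed.

Let K00 : K 0 := bn_0 KP.

Lemma S0_p t : 0 <= t -> p (S t 0) = 0.
Proof.
move=> t0; have := SD t0 K00 K00; rewrite addr0.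
have -> : S t 0 - (S t 0 + S t 0) = - S t 0 by vec.
by rewrite (pN KP)//; exact: KS.
Qed.

Lemma SZ t k x : 0 <= t -> K x -> p (S t (k *: x) - k *: S t x) = 0.
Proof.
move=> t0 Kx; apply: le0_p; have := sg_linear SP k t0 Kx K00; rewrite addr0 => h.
have K1 := KS t0 Kx; have K2 := KS t0 K00.
have -> : S t (k *: x) - k *: S t x = (S t (k *: x) - (k *: S t x + S t 0)) + S t 0 by vec.
apply: le_trans (bn_D KP _ K2) _; last by rewrite h S0_p// addr0.
by apply: (KB KP); [apply: KS => //; exact: (KZ KP)|apply: (KD KP) => //; exact: (KZ KP)].
Qed.

Lemma SZ_norm t (r : R) x : 0 <= t -> K x -> p (S t (r%:C *: x)) = `|r| * p (S t x).
Proof.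
move=> t0 Kx; rewrite -(pZr KP r (KS t0 Kx)); apply: p_eq_tri; last exact: SZ.
  by apply: KS => //; exact: (KZ KP).
by apply: (KZ KP); exact: KS.
Qed.

(* real valued, unlike [op_norm], for the computations of the gliding hump *)
Let N t : R := sup [set p (S t x) | x in [set x | K x /\ p x <= 1]].

Let N_has_sup t : 0 <= t -> has_sup [set p (S t x) | x in [set x | K x /\ p x <= 1]].
Proof.
move=> t0; split; first by exists (p (S t 0)); exists 0 => //; split; rewrite ?(p0 KP).
have := sg_bounded SP t0; rewrite /op_norm; set E := ereal_sup _ => Efin.
have E0 : (0 <= E)%E.
  apply: (@le_trans _ _ (p (S t 0))%:E); first by rewrite lee_fin (bn_ge0 KP).
  by apply: ereal_sup_ubound; exists 0 => //; split; rewrite ?(p0 KP).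
exists (fine E) => _ [x [Kx x1] <-].
rewrite -lee_fin fineK; last by rewrite ge0_fin_numE.
by apply: ereal_sup_ubound; exists x.
Qed.

Let N_ge0 t : 0 <= t -> 0 <= N t.
Proof.
move=> t0; apply: le_trans (bn_ge0 KP (S t 0)) _.
apply: ub_le_sup; first by case: (N_has_sup t0).
by exists 0 => //; split; rewrite ?(p0 KP).
Qed.

Let N_bound t x : 0 <= t -> K x -> p (S t x) <= N t * p x.
Proof.
move=> t0 Kx; apply/ler_addgt0Pr => e e0.
have N0 := N_ge0 t0.
have d0 : 0 < e / (N t + 1) by rewrite divr_gt0// ltr_wpDl.
pose q := p x + e / (N t + 1).
have q0 : 0 < q by rewrite /q ltr_wpDl// (bn_ge0 KP).
have h : p (S t (q^-1%:C *: x)) <= N t.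
  apply: ub_le_sup; first by case: (N_has_sup t0).
  exists (q^-1%:C *: x) => //; split; first exact: (KZ KP).
  by rewrite (pZr KP)// gtr0_norm ?invr_gt0// mulrC ler_pdivrMr// mul1r lerDl ltW.
move: h; rewrite SZ_norm// gtr0_norm ?invr_gt0// mulrC ler_pdivrMr// => /le_trans; apply.
rewrite mulrDr lerD2l mulrCA ler_piMr ?(ltW e0)//.
by rewrite ler_pdivrMr ?ltr_wpDl// mul1r lerDl.
Qed.

Let N_near t r : 0 <= t -> 0 < r -> 0 < N t ->
  exists x, [/\ K x, p x <= r & 3 / 4 * N t * r <= p (S t x)].
Proof.
move=> t0 r0 Np; have d0 : 0 < N t / 4 by rewrite divr_gt0.
have [_ [x [Kx x1] <-]] := sup_adherent d0 (N_has_sup t0).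
rewrite -/(N t) => h; exists (r%:C *: x); split; first exact: (KZ KP).
  by rewrite (pZr KP)// gtr0_norm// ler_piMr// ltW.
by rewrite SZ_norm// gtr0_norm// mulrC ler_wpM2l ?(ltW r0)//; lra.
Qed.

Lemma continuous_at0 x e : K x -> 0 < e ->
  exists2 d, 0 < d & forall t, 0 <= t -> t < d -> p (S t x - x) <= e.
Proof.
move=> Kx e0; have /cvgrPdist_lt/(_ _ e0) := sg_continuous SP Kx.
rewrite /at_right near_withinE => -[d /= d0 hd]; exists d => // t.
rewrite le_eqVlt => /predU1P[<- _|t0 td]; first by rewrite (sg_0 SP)// ltW.
have := hd t; rewrite /ball_ /= sub0r normrN gtr0_norm// => /(_ td t0).
by rewrite sub0r normrN ger0_norm ?(bn_ge0 KP)// => /ltW.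
Qed.

(** The gliding hump: were the norms of [S (t n)] growing like [4 ^ n] along
    [t n --> 0], adding or subtracting successive vectors of norm [3 ^- n] that
    [S (t n)] nearly magnifies fully would build one vector whose orbit is
    unbounded near time [0]. *)
Lemma bounded_near0 : exists d M : R, [/\ 0 < d, 0 <= M &
  forall t x, 0 <= t -> t < d -> K x -> p (S t x) <= M * p x].
Proof.
apply: contrapT => nb.
have tP (n : nat) : exists t : R, [/\ 0 <= t, t < n.+1%:R^-1 & 4 ^+ n < N t].
  apply: contrapT => nt; apply: nb; exists n.+1%:R^-1, (4 ^+ n).
  split; rewrite ?invr_gt0 ?exprn_ge0// => t x t0 tn Kx.
  apply: (le_trans (N_bound t0 Kx)); rewrite ler_wpM2r ?(bn_ge0 KP)//.
  by rewrite leNgt; apply/negP => h; apply: nt; exists t.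
have [t tE] := choice tP.
have t0 n : 0 <= t n by case: (tE n).
have N4 n : 4 ^+ n < N (t n) by case: (tE n).
have Npos n : 0 < N (t n) by apply: le_lt_trans (N4 n); rewrite exprn_ge0.
have r0 n : 0 < (3^-1) ^+ n :> R by rewrite exprn_gt0.
have [r rP] := choice (fun n => N_near (t0 n) (r0 n) (Npos n)).
have Kr n : K (r n) by case: (rP n).
pose nxt n x := if p (S (t n) (r n)) <= p (S (t n) (x + r n)) then x + r n else x - r n.
pose fix xs n := if n is n'.+1 then nxt n' (xs n') else 0.
have Kxs n : K (xs n).
  elim: n => [|n IH] //=; rewrite /nxt; case: ifP => _; [exact: (KD KP)|exact: (KB KP)].
have xs_step n : p (xs n.+1 - xs n) <= (3^-1) ^+ n.
  have [_ h _] := rP n; rewrite /= /nxt; case: ifP => _; last first.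
    by rewrite addrC addrA addNr add0r (pN KP).
  by rewrite addrC addrA addNr add0r.
(* one of [x + r] and [x - r] is sent at least as far as [r] *)
have xs_big n : p (S (t n) (r n)) <= p (S (t n) (xs n.+1)).
  rewrite /= /nxt; case: ifPn => //; rewrite -ltNge => h.
  have Ka := KD KP (Kxs n) (Kr n); have Kb := KB KP (Kxs n) (Kr n).
  have e : p (S (t n) (xs n + r n) - S (t n) (xs n - r n)) = 2 * p (S (t n) (r n)).
    rewrite SB_norm//; have -> : xs n + r n - (xs n - r n) = (2 : R)%:C *: r n.
      have -> : (2 : R)%:C = 2 :> R[i] by rewrite rmorph_nat.
      by move: (xs n) (r n) => u v; vec.
    by rewrite SZ_norm// ger0_norm.
  have := pBD KP (KS (t0 n) Ka) (KS (t0 n) Kb); rewrite e; lra.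
have tail n j : p (xs (n + j)%N - xs n) <= 3 / 2 * (3^-1) ^+ n * (1 - (3^-1) ^+ j).
  elim: j => [|j IH]; first by rewrite addn0 subrr (p0 KP) expr0 subrr mulr0.
  apply: le_trans (ptri KP (Kxs _) (Kxs (n + j)%N) (Kxs _)) _.
  rewrite addnS; have := xs_step (n + j)%N; rewrite exprD.
  set a := (3^-1) ^+ n in IH *; rewrite exprS; set b := (3^-1) ^+ j in IH *.
  by move: IH; set P1 := p _; set P2 := p _; lra.
have tail2 n m : (n <= m)%N -> p (xs m - xs n) <= 3 / 2 * (3^-1) ^+ n.
  move=> nm; rewrite -(subnKC nm); apply: le_trans (tail _ _) _.
  have q0 : 0 <= (3^-1) ^+ n :> R by rewrite exprn_ge0.
  have q1 : 0 <= (3^-1) ^+ (m - n) :> R by rewrite exprn_ge0.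
  by apply: ler_piMr; [apply: mulr_ge0 => //; lra|lra].
have pow_small (e : R) : 0 < e -> exists n, (3^-1) ^+ n < e.
  move=> e0; have [n _ hn] := @near_infty_natSinv_lt R (PosNum e0).
  exists n.+1; apply: le_lt_trans (hn n (leqnn n)).
  rewrite exprVn lef_pV2 ?posrE ?exprn_gt0// -natrX ler_nat.
  by apply: ltnW; exact: ltn_expl.
have [x Kx xlim] : exists2 l, K l & forall e : R, 0 < e -> exists N, forall n, (N <= n)%N ->
    p (xs n - l) <= e.
  apply: (bn_complete KP Kxs) => e e0.
  have e3 : 0 < e / 3 by rewrite divr_gt0.
  have [N0 hN] := pow_small _ e3.
  exists N0 => n m n1 m1; apply: le_trans (ptri KP (Kxs _) (Kxs N0) (Kxs _)) _.
  have := tail2 _ _ n1; have := tail2 _ _ m1; rewrite (pBC KP (Kxs m) (Kxs N0)).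
  by move: hN; set q := _ ^+ _; lra.
have xdist n : p (x - xs n.+1) <= 2^-1 * (3^-1) ^+ n.
  apply/ler_addgt0Pr => e e0; have [N1 h1] := xlim _ e0.
  set m := maxn N1 n.+1.
  apply: le_trans (ptri KP Kx (Kxs m) (Kxs _)) _.
  rewrite (pBC KP Kx (Kxs _)); have := h1 m (leq_maxl _ _).
  have := tail2 _ _ (leq_maxr N1 n.+1); rewrite -/m exprS; lra.
have lower n : 4^-1 * (4 / 3) ^+ n <= p (S (t n) x).
  have [_ _ h] := rP n; have hb := xs_big n.
  have := p_le_tri KP (KS (t0 n) (Kxs n.+1)) (KS (t0 n) Kx).
  rewrite SB_norm//; have := N_bound (t0 n) (KB KP (Kxs n.+1) Kx).
  rewrite (pBC KP (Kxs _) Kx) => h2 h3.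
  have h4 : N (t n) * p (x - xs n.+1) <= N (t n) * (2^-1 * (3^-1) ^+ n).
    by rewrite ler_wpM2l ?xdist// ltW.
  have h5 : 4 ^+ n * (3^-1) ^+ n <= N (t n) * (3^-1) ^+ n.
    by rewrite ler_wpM2r ?exprn_ge0// ltW.
  rewrite exprMn; move: h h2 h3 h4 h5; set q := (3^-1) ^+ n; lra.
have [d d0 hd] := continuous_at0 Kx ltr01.
have [n1 _ hn1] := near_infty_natSinv_lt (PosNum d0).
have grow (n : nat) : 1 + n%:R / 3 <= (4 / 3) ^+ n :> R.
  elim: n => [|n IH]; first by rewrite mul0r addr0 expr0.
  have : 0 <= n%:R :> R by [].
  by rewrite exprS -natr1; move: IH; set q := _ ^+ _; lra.
pose n := maxn n1 (Num.truncn (12 * (1 + p x))).+1.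
have [_ tn _] := tE n.
have := hd (t n) (t0 n) (lt_trans tn (hn1 n (leq_maxl _ _))).
have := p_le_tri KP (KS (t0 n) Kx) Kx; have := lower n; have := grow n.
have : 12 * (1 + p x) < n%:R.
  by apply: lt_le_trans (truncnS_gt _) _; rewrite ler_nat leq_maxr.
lra.
Qed.

Lemma bounded_on (T : R) : exists2 M : R, 0 < M &
  forall t x, 0 <= t -> t <= T -> K x -> p (S t x) <= M * p x.
Proof.
have [d [M0 [d0 M00 hM]]] := bounded_near0.
pose M := M0 + 1.
have M1 : 1 <= M by rewrite /M lerDr.
have Mp : 0 < M by exact: lt_le_trans M1.
have {}hM t x : 0 <= t -> t < d -> K x -> p (S t x) <= M * p x.
  move=> t0 td Kx; apply: le_trans (hM _ _ t0 td Kx) _.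
  by rewrite ler_wpM2r ?(bn_ge0 KP)// lerDl.
pose h := d / 2; have h0 : 0 < h by rewrite divr_gt0.
have hd : h < d by rewrite /h; lra.
have step n : forall t x, 0 <= t -> t <= n%:R * h -> K x -> p (S t x) <= M ^+ n.+1 * p x.
  elim: n => [|n IH] t x t0 tn Kx.
    by rewrite expr1; apply: hM => //; move: tn; rewrite mul0r; lra.
  have [th|th] := leP t h.
    apply: le_trans (hM _ _ t0 (le_lt_trans th hd) Kx) _.
    rewrite ler_wpM2r ?(bn_ge0 KP)// exprS ler_peMr ?(ltW Mp)//.
    exact: exprn_ege1.
  have th0 : 0 <= t - h by rewrite subr_ge0 ltW.
  have := sg_add SP th0 (ltW h0) Kx; rewrite subrK => e.
  rewrite (p_eq_tri (KS t0 Kx) (KS th0 (KS (ltW h0) Kx)) e).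
  apply: le_trans (IH _ _ th0 _ (KS (ltW h0) Kx)) _.
    by move: tn; rewrite -natr1; lra.
  rewrite [M ^+ n.+2]exprSr -mulrA ler_wpM2l ?exprn_ge0 ?(ltW Mp)//.
  by apply: hM => //; exact: ltW.
exists (M ^+ (Num.truncn (T / h)).+2); first by rewrite exprn_gt0.
move=> t x t0 tT Kx; apply: step => //.
by apply: (le_trans tT); rewrite -ler_pdivrMr// ltW// truncnS_gt.
Qed.

Lemma S_uniformly_continuous x (T e : R) : K x -> 0 < e ->
  exists2 d, 0 < d & forall s t, 0 <= s -> s <= t -> t <= T -> t - s < d ->
    p (S t x - S s x) <= e.
Proof.
move=> Kx e0; have [M M0 hM] := bounded_on T.
have [d d0 hd] := continuous_at0 Kx (divr_gt0 e0 M0).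
exists d => // s t s0 st tT ts.
have ts0 : 0 <= t - s by rewrite subr_ge0.
have t0 := le_trans s0 st.
have K1 := KS ts0 Kx; have K2 := KS s0 Kx.
have e1 : p (S t x - S s (S (t - s) x)) = 0.
  by have := sg_add SP s0 ts0 Kx; rewrite subrKC.
apply: le_trans (ptri KP (KS t0 Kx) (KS s0 K1) K2) _.
rewrite e1 add0r SB_norm//.
apply: le_trans (hM _ _ s0 (le_trans st tT) (KB KP K1 Kx)) _.
by rewrite mulrC -ler_pdivlMr//; exact: hd.
Qed.

Lemma orbit_antiderivative x : K x -> exists Y : R -> X,
  [/\ forall t, 0 <= t -> K (Y t), p (Y 0) = 0 &
    forall T e : R, 0 < e -> exists2 d, 0 < d &
      forall s t, 0 <= s -> s <= t -> t <= T -> t - s < d ->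
        p (Y t - Y s - (t - s)%:C *: S s x) <= e * (t - s)].
Proof.
move=> Kx; apply: (antiderivative_exists KP) => [t t0|T e e0]; first exact: KS.
exact: S_uniformly_continuous.
Qed.

Lemma right_derivativeP x y : K x -> K y -> right_derivative p S x y <->
  forall e : R, 0 < e -> exists2 d, 0 < d & forall h, 0 < h -> h < d ->
    p (S h x - x - h%:C *: y) <= e * h.
Proof.
move=> Kx Ky.
have eqh h : 0 < h -> p (S h x - x - h%:C *: y) = h * p ((h^-1)%:C *: (S h x - x) - y).
  move=> h0; have hC : h%:C != 0 :> R[i] by rewrite (inj_eq (@complexI _)) gt_eqF.
  have -> : S h x - x - h%:C *: y = h%:C *: ((h^-1)%:C *: (S h x - x) - y).
    by rewrite scalerBr scalerA -rmorphM divff ?scale1r// gt_eqF.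
  rewrite (pZr KP) ?gtr0_norm//; apply: (KB KP) => //; apply: (KZ KP).
  by apply: (KB KP) => //; apply: KS => //; exact: ltW.
split=> [/cvgrPdist_lt h e e0|h].
  have := h e e0; rewrite /at_right near_withinE => -[d /= d0 hd].
  exists d => // k k0 kd; rewrite eqh// mulrC ler_wpM2r ?(ltW k0)//.
  have := hd k; rewrite /ball_ /= sub0r normrN gtr0_norm// => /(_ kd k0).
  by rewrite sub0r normrN ger0_norm ?(bn_ge0 KP)// => /ltW.
apply/cvgrPdist_le => e e0; have [d d0 hd] := h e e0.
rewrite /at_right near_withinE; exists d => //= k; rewrite /ball_ /= sub0r normrN => kd k0.
rewrite sub0r normrN ger0_norm ?(bn_ge0 KP)//.
move: kd; rewrite gtr0_norm// => kd; have := hd k k0 kd.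
by rewrite eqh// mulrC ler_pM2r.
Qed.

(** Applying the semigroup to an integral of the orbit translates the interval of
    integration; this is what puts [Y h] in the domain of the generator. *)
Lemma S_antiderivative x Y h k : K x -> 0 <= h -> 0 <= k ->
  (forall t, 0 <= t -> K (Y t)) -> p (Y 0) = 0 ->
  (forall T e : R, 0 < e -> exists2 d, 0 < d &
      forall s t, 0 <= s -> s <= t -> t <= T -> t - s < d ->
        p (Y t - Y s - (t - s)%:C *: S s x) <= e * (t - s)) ->
  p (S k (Y h) - (Y (h + k) - Y k)) = 0.
Proof.
move=> Kx h0 k0 KY Y0 hY.
pose g t := S k (Y t) - (Y (t + k) - Y k).
have Kg s : 0 <= s -> K (g s).
  move=> s0; apply: (KB KP); first exact: KS (KY _ s0).
  by apply: (KB KP); apply: KY => //; exact: addr_ge0.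
have g0 : p (g 0) = 0.
  rewrite /g add0r subrr subr0; apply: le0_p.
  by apply: le_trans (N_bound k0 (KY _ (lexx 0))) _; rewrite Y0 mulr0.
suff : p (g h - g 0) = 0.
  by move=> e; rewrite -/(g h) (p_eq_tri (Kg _ h0) (Kg _ (lexx 0)) e).
apply: (small_increments KP (T := h)) => // e e0.
have M0 := N_ge0 k0.
have e1 : 0 < e / (N k + 1) by rewrite divr_gt0// ltr_wpDl.
have [d d0 hd] := hY (h + k) _ e1.
exists d => // s t s0 st th ts.
have t0 := le_trans s0 st.
have sk0 : 0 <= s + k by exact: addr_ge0.
have tk0 : 0 <= t + k by exact: addr_ge0.
have Ks := KY _ s0; have Kt := KY _ t0; have Ksk := KY _ sk0; have Ktk := KY _ tk0.
have KSs := KS s0 Kx; have KSsk := KS sk0 Kx.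
set c := (t - s)%:C : R[i].
set D := Y t - Y s - c *: S s x.
have KDs : K D by apply: (KB KP); [exact: (KB KP)|exact: (KZ KP)].
(* each of the first four groups below is null by additivity of [S] *)
have -> : g t - g s = (S k (Y t) - S k (Y s) - S k (Y t - Y s))
    + (S k (Y t - Y s) - (S k D + S k (c *: S s x)))
    + (S k (c *: S s x) - c *: S k (S s x))
    + (c *: (S k (S s x) - S (k + s) x)) + S k D
    - (Y (t + k) - Y (s + k) - c *: S (s + k) x).
  rewrite /g (addrC k s).
  by move: (S k (Y t)) (S k (Y s)) (S k (Y t - Y s)) (S k D) (S k (c *: S s x))
    (S k (S s x)) (Y (t + k)) (Y (s + k)) (Y k) (S (s + k) x) => *; vec.
have z1 : p (S k (Y t) - S k (Y s) - S k (Y t - Y s)) = 0.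
  rewrite (pBC KP); [exact: SB|by apply: (KB KP); exact: KS|apply: KS => //; exact: (KB KP)].
have z2 : p (S k (Y t - Y s) - (S k D + S k (c *: S s x))) = 0.
  have := SD k0 KDs (KZ KP c KSs); suff -> : D + c *: S s x = Y t - Y s by [].
  by rewrite /D subrK.
have z3 : p (S k (c *: S s x) - c *: S k (S s x)) = 0 by exact: SZ.
have z4 : p (c *: (S k (S s x) - S (k + s) x)) = 0.
  have ks0 : 0 <= k + s by exact: addr_ge0.
  have Kks := KS k0 KSs; have Kks' := KS ks0 Kx.
  rewrite (pZr KP); last exact: (KB KP).
  by rewrite (pBC KP)// (sg_add SP)// mulr0.
have z5 : p (S k D) <= N k * (e / (N k + 1) * (t - s)).
  apply: le_trans (N_bound k0 KDs) _; rewrite ler_wpM2l//.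
  by apply: hd => //; apply: (le_trans th); rewrite lerDl.
have z6 : p (Y (t + k) - Y (s + k) - c *: S (s + k) x) <= e / (N k + 1) * (t - s).
  have -> : c = (t + k - (s + k))%:C by rewrite /c; congr (_%:C); ring.
  have -> : t - s = t + k - (s + k) by ring.
  by apply: hd => //; rewrite ?lerD2r//; lra.
have KSk y : K y -> K (S k y) by exact: KS.
have K1 : K (S k (Y t) - S k (Y s) - S k (Y t - Y s)).
  by repeat apply: (KB KP); try exact: KSk; apply: KSk; exact: (KB KP).
have K2 : K (S k (Y t - Y s) - (S k D + S k (c *: S s x))).
  apply: (KB KP); first by apply: KSk; exact: (KB KP).
  by apply: (KD KP); apply: KSk => //; exact: (KZ KP).
have K3 : K (S k (c *: S s x) - c *: S k (S s x)).
  by apply: (KB KP); [apply: KSk; exact: (KZ KP)|apply: (KZ KP); exact: KSk].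
have K4 : K (c *: (S k (S s x) - S (k + s) x)).
  apply: (KZ KP); apply: (KB KP); [exact: KSk|apply: KS => //; exact: addr_ge0].
have K5 := KSk _ KDs.
have K6 : K (Y (t + k) - Y (s + k) - c *: S (s + k) x).
  by apply: (KB KP); [exact: (KB KP)|exact: (KZ KP)].
have K12 := KD KP K1 K2; have K123 := KD KP K12 K3; have K1234 := KD KP K123 K4.
have K15 := KD KP K1234 K5.
apply: le_trans (pBD KP K15 K6) _.
have := bn_D KP K1234 K5; have := bn_D KP K123 K4; have := bn_D KP K12 K3.
have := bn_D KP K1 K2; rewrite z1 z2 z3 z4.
have : N k * (e / (N k + 1) * (t - s)) + e / (N k + 1) * (t - s) = e * (t - s).
  by field; rewrite gt_eqF// ltr_wpDl.
lra.
Qed.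

Lemma antiderivative_right_derivative x Y h : K x -> 0 <= h ->
  (forall t, 0 <= t -> K (Y t)) -> p (Y 0) = 0 ->
  (forall T e : R, 0 < e -> exists2 d, 0 < d &
      forall s t, 0 <= s -> s <= t -> t <= T -> t - s < d ->
        p (Y t - Y s - (t - s)%:C *: S s x) <= e * (t - s)) ->
  right_derivative p S (Y h) (S h x - x).
Proof.
move=> Kx h0 KY Y0 hY.
have KSh := KS h0 Kx; have KYh := KY _ h0; have KY0 := KY _ (lexx 0).
apply/right_derivativeP => //; first exact: (KB KP).
move=> e e0; have e2 : 0 < e / 2 by rewrite divr_gt0.
have [d d0 hd] := hY (h + 1) _ e2.
exists (Order.min d 1); first by rewrite lt_min d0 ltr01.
move=> k k0; rewrite lt_min => /andP[kd k1].
have hk0 : 0 <= h + k by rewrite addr_ge0// ltW.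
have z := S_antiderivative Kx h0 (ltW k0) KY Y0 hY.
have a1 : p (Y (h + k) - Y h - (h + k - h)%:C *: S h x) <= e / 2 * (h + k - h).
  by apply: hd => //; lra.
have a2 : p (Y k - Y 0 - (k - 0)%:C *: S 0 x) <= e / 2 * (k - 0).
  by apply: hd; lra.
have ek : h + k - h = k by ring.
rewrite ek in a1; rewrite subr0 in a2.
have K0x := KS (lexx 0) Kx; have KYk := KY _ (ltW k0); have KYhk := KY _ hk0.
have KSk := KS (ltW k0) KYh.
have -> : S k (Y h) - Y h - k%:C *: (S h x - x) =
    (S k (Y h) - (Y (h + k) - Y k)) + (Y (h + k) - Y h - k%:C *: S h x)
    - (Y k - Y 0 - k%:C *: S 0 x) - (k%:C *: (S 0 x - x) + Y 0).
  by move: (S k (Y h)) (Y h) (Y (h + k)) (Y k) (Y 0) (S h x) (S 0 x) => *; vec.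
have K1 : K (S k (Y h) - (Y (h + k) - Y k)) by apply: (KB KP) => //; exact: (KB KP).
have K2 : K (Y (h + k) - Y h - k%:C *: S h x).
  by apply: (KB KP); [exact: (KB KP)|exact: (KZ KP)].
have K3 : K (Y k - Y 0 - k%:C *: S 0 x).
  by apply: (KB KP); [exact: (KB KP)|exact: (KZ KP)].
have K40 : K (k%:C *: (S 0 x - x)) by apply: (KZ KP); exact: (KB KP).
have K4 := KD KP K40 KY0.
have K12 := KD KP K1 K2; have K123 := KB KP K12 K3.
apply: le_trans (pBD KP K123 K4) _.
have := pBD KP K12 K3; have := bn_D KP K1 K2; rewrite z.
have := bn_D KP K40 KY0.
rewrite (pZr KP); last exact: (KB KP).
rewrite (sg_0 SP)// mulr0 Y0; lra.
Qed.

Variable T : uop X.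
Hypothesis TP : infinitesimal_generator K p S T.

(** The averages [Y h / h] of the orbit lie in the domain and tend to [x]. *)
Lemma generator_dense x (e : R) : K x -> 0 < e -> exists2 y, dom T y & p (x - y) <= e.
Proof.
move=> Kx e0; have [Y [KY Y0 hY]] := orbit_antiderivative Kx.
have [d d0 hd] := hY 1 _ e0.
pose h := Order.min (d / 2) 1.
have h0 : 0 < h by rewrite lt_min divr_gt0// ltr01.
have hd' : h < d by rewrite gt_min; apply/orP; left; lra.
have h1 : h <= 1 by rewrite ge_min lexx orbT.
have KYh := KY _ (ltW h0); have KSh := KS (ltW h0) Kx.
have D := antiderivative_right_derivative Kx (ltW h0) KY Y0 hY.
have KSx : K (S h x - x) by exact: (KB KP).
exists ((h^-1)%:C *: Y h).
  apply/TP.1; split; first exact: (KZ KP).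
  exists ((h^-1)%:C *: (S h x - x)); first exact: (KZ KP).
  apply/right_derivativeP; [exact: (KZ KP)|exact: (KZ KP)|] => e' e'0.
  have e1 : 0 < e' * h by exact: mulr_gt0.
  have [d1 d10 hd1] := (right_derivativeP KYh KSx).1 D _ e1.
  exists d1 => // k k0 kd; have KSk := KS (ltW k0) KYh.
  have -> : S k ((h^-1)%:C *: Y h) - (h^-1)%:C *: Y h - k%:C *: ((h^-1)%:C *: (S h x - x)) =
     (S k ((h^-1)%:C *: Y h) - (h^-1)%:C *: S k (Y h)) +
     (h^-1)%:C *: (S k (Y h) - Y h - k%:C *: (S h x - x)).
    by move: (S h x) (S k (Y h)) (S k ((h^-1)%:C *: Y h)) (Y h) => *; vec.
  have K1 : K (S k (Y h) - Y h - k%:C *: (S h x - x)).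
    by apply: (KB KP); [exact: (KB KP)|exact: (KZ KP)].
  apply: le_trans (bn_D KP _ (KZ KP _ K1)) _.
    apply: (KB KP); last exact: (KZ KP).
    by apply: KS; [exact: ltW|exact: (KZ KP)].
  rewrite SZ ?(ltW k0)// add0r (pZr KP)// gtr0_norm ?invr_gt0//.
  by rewrite mulrC ler_pdivrMr// mulrAC; exact: hd1.
have a : p (Y h - Y 0 - (h - 0)%:C *: S 0 x) <= e * (h - 0) by apply: hd; rewrite ?subr0 ?(ltW h0).
rewrite !subr0 in a.
have K0x := KS (lexx 0) Kx; have KY0 := KY _ (lexx 0).
have -> : x - (h^-1)%:C *: Y h = - ((h^-1)%:C *: (Y h - Y 0 - h%:C *: S 0 x)) - ((h^-1)%:C *: Y 0 + (S 0 x - x)).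
  have hh : (h^-1)%:C *: (h%:C *: S 0 x) = S 0 x.
    by rewrite scalerA -rmorphM mulVf ?scale1r// gt_eqF.
  by rewrite 2!scalerBr hh; move: (Y h) (Y 0) (S 0 x) => *; vec.
have K1 : K (Y h - Y 0 - h%:C *: S 0 x).
  by apply: (KB KP); [exact: (KB KP)|exact: (KZ KP)].
have K2 : K (S 0 x - x) by exact: (KB KP).
apply: le_trans (pBD KP (KN KP (KZ KP _ K1)) (KD KP (KZ KP _ KY0) K2)) _.
rewrite (pN KP) ?(pZr KP)//; last exact: (KZ KP).
have := bn_D KP (KZ KP (h^-1)%:C KY0) K2.
rewrite (pZr KP)// Y0 mulr0 (sg_0 SP)//.
have : `|h^-1| * p (Y h - Y 0 - h%:C *: S 0 x) <= e.
  by rewrite gtr0_norm ?invr_gt0// mulrC ler_pdivrMr.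
lra.
Qed.

Lemma dom_K x : dom T x -> K x. Proof. by move/TP.1 => []. Qed.
Lemma app_K x : dom T x -> K (app T x). Proof. by move/TP.2 => []. Qed.

Lemma generator_right_derivative x (e : R) : dom T x -> 0 < e ->
  exists2 d, 0 < d & forall h, 0 < h -> h < d ->
    p (S h x - x - h%:C *: app T x) <= e * h.
Proof.
move=> Tx; have [KT h] := TP.2 _ Tx.
exact: (right_derivativeP (dom_K Tx) KT).1 h e.
Qed.

Lemma S_increment x t h M : K x -> K (app T x) -> 0 <= t -> 0 <= h ->
  (forall y, K y -> p (S t y) <= M * p y) ->
  p (S (t + h) x - S t x - h%:C *: S t (app T x)) <= M * p (S h x - x - h%:C *: app T x).
Proof.
move=> Kx KT t0 h0 hM.
have th0 : 0 <= t + h by exact: addr_ge0.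
have KSh := KS h0 Kx; have KSx := KS t0 Kx; have KST := KS t0 KT.
set D := S h x - x - h%:C *: app T x.
have K1 : K (S h x - x) by exact: (KB KP).
have KDD : K D by apply: (KB KP) => //; exact: (KZ KP).
have KSt y : K y -> K (S t y) by exact: KS.
have -> : S (t + h) x - S t x - h%:C *: S t (app T x) =
   (S (t + h) x - S t (S h x)) + (S t (S h x) - S t x - S t (S h x - x))
   + (S t (S h x - x) - (S t D + S t (h%:C *: app T x)))
   + (S t (h%:C *: app T x) - h%:C *: S t (app T x)) + S t D.
  by move: (S (t + h) x) (S t (S h x)) (S t (S h x - x)) (S t D) (S t (h%:C *: _)) (S t (app T x)) (S t x) => *; vec.
have z1 : p (S (t + h) x - S t (S h x)) = 0 by exact: (sg_add SP).
have z2 : p (S t (S h x) - S t x - S t (S h x - x)) = 0.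
  rewrite (pBC KP); [exact: SB|by apply: (KB KP); exact: KSt|exact: KSt].
have z3 : p (S t (S h x - x) - (S t D + S t (h%:C *: app T x))) = 0.
  have := SD t0 KDD (KZ KP h%:C KT); suff -> : D + h%:C *: app T x = S h x - x by [].
  by rewrite /D subrK.
have z4 : p (S t (h%:C *: app T x) - h%:C *: S t (app T x)) = 0 by exact: SZ.
have L1 : K (S (t + h) x - S t (S h x)) by apply: (KB KP); [exact: KS|exact: KSt].
have L2 : K (S t (S h x) - S t x - S t (S h x - x)).
  by apply: (KB KP); [apply: (KB KP); exact: KSt|exact: KSt].
have L3 : K (S t (S h x - x) - (S t D + S t (h%:C *: app T x))).
  apply: (KB KP); first exact: KSt.
  by apply: (KD KP); apply: KSt => //; exact: (KZ KP).
have L4 : K (S t (h%:C *: app T x) - h%:C *: S t (app T x)).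
  by apply: (KB KP); [apply: KSt; exact: (KZ KP)|exact: (KZ KP)].
have L12 := KD KP L1 L2; have L123 := KD KP L12 L3; have L1234 := KD KP L123 L4.
apply: le_trans (bn_D KP L1234 (KSt _ KDD)) _.
have := bn_D KP L123 L4; have := bn_D KP L12 L3; have := bn_D KP L1 L2.
have := hM _ KDD; rewrite z1 z2 z3 z4; lra.
Qed.

(** [S s] is bounded uniformly for [s] in a bounded interval, hence the increments
    of the orbit at time [s] inherit the rate of those at time [0]. *)
Lemma orbit_derivative x (b e : R) : dom T x -> 0 < e ->
  exists2 d, 0 < d & forall s t, 0 <= s -> s <= t -> t <= b -> t - s < d ->
    p (S t x - S s x - (t - s)%:C *: S s (app T x)) <= e * (t - s).
Proof.
move=> Tx e0; have Kx := dom_K Tx; have KT := app_K Tx.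
have [M M0 hM] := bounded_on b.
have [d d0 hd] := generator_right_derivative Tx (divr_gt0 e0 M0).
exists d => // s t s0 st tb ts.
have ts0 : 0 <= t - s by rewrite subr_ge0.
have := @S_increment x s (t - s) M Kx KT s0 ts0 (fun y Ky => hM s y s0 (le_trans st tb) Ky).
rewrite subrKC => /le_trans; apply.
move: ts0; rewrite le_eqVlt => /predU1P[<-|ts0].
  rewrite mulr0 scale0r subr0 (sg_0 SP)// mulr0//.
rewrite mulrC -ler_pdivlMr// mulrAC; exact: hd.
Qed.

Lemma orbit_right_derivative x t : dom T x -> 0 <= t ->
  right_derivative p S (S t x) (S t (app T x)).
Proof.
move=> Tx t0; have Kx := dom_K Tx; have KT := app_K Tx.
apply/right_derivativeP; [exact: KS|exact: KS|] => e e0.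
have [d d0 hd] := orbit_derivative (t + 1) Tx e0.
exists (Order.min d 1); first by rewrite lt_min d0 ltr01.
move=> h h0; rewrite lt_min => /andP[h1 h2].
have th0 : 0 <= t + h by rewrite addr_ge0// ltW.
have KSh := KS (ltW h0) (KS t0 Kx); have KSth := KS th0 Kx.
have KSt := KS t0 Kx; have KSTt := KS t0 KT.
have z : p (S (t + h) x - S h (S t x)) = 0 by rewrite (addrC t h); apply: (sg_add SP) => //; exact: ltW.
have -> : S h (S t x) - S t x - h%:C *: S t (app T x) =
  (S (t + h) x - S t x - h%:C *: S t (app T x)) - (S (t + h) x - S h (S t x)).
  by move: (S (t + h) x) (S h (S t x)) (S t x) (S t _) => *; vec.
have K1 : K (S (t + h) x - S t x - h%:C *: S t (app T x)).
  by apply: (KB KP); [exact: (KB KP)|exact: (KZ KP)].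
apply: le_trans (pBD KP K1 (KB KP KSth KSh)) _; rewrite z addr0.
have := hd t (t + h) t0; rewrite (addrC t h) addrK; apply; lra.
Qed.

Lemma orbit_dom x t : dom T x -> 0 <= t -> dom T (S t x).
Proof.
move=> Tx t0; apply/TP.1; split; first exact: KS (dom_K Tx).
exists (S t (app T x)); first exact: KS (app_K Tx).
exact: orbit_right_derivative.
Qed.

Lemma right_derivative_unique x y y' : K x -> K y -> K y' ->
  right_derivative p S x y -> right_derivative p S x y' -> p (y - y') = 0.
Proof.
move=> Kx Ky Ky' /(right_derivativeP Kx Ky) D /(right_derivativeP Kx Ky') D'.
apply: le0_p; apply/ler_addgt0Pr => e e0; rewrite add0r.
have e2 : 0 < e / 2 by rewrite divr_gt0.
have [d d0 hd] := D _ e2; have [d' d'0 hd'] := D' _ e2.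
pose h := Order.min d d' / 2.
have m0 : 0 < Order.min d d' by rewrite lt_min d0 d'0.
have h0 : 0 < h by rewrite divr_gt0.
have h1 : h < Order.min d d' by rewrite /h; lra.
move: (h1); rewrite lt_min => /andP[hd1 hd2].
have KSh := KS (ltW h0) Kx.
have K1 z : K z -> K (S h x - x - h%:C *: z).
  by move=> Kz; apply: (KB KP); [exact: (KB KP)|exact: (KZ KP)].
have : p (h%:C *: (y - y')) <= e * h.
  have -> : h%:C *: (y - y') = (S h x - x - h%:C *: y') - (S h x - x - h%:C *: y).
    by move: (S h x) => *; vec.
  apply: le_trans (pBD KP (K1 _ Ky') (K1 _ Ky)) _.
  have := hd h h0 hd1; have := hd' h h0 hd2; lra.
rewrite (pZr KP); last exact: (KB KP).
by rewrite gtr0_norm// mulrC ler_pM2r.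
Qed.

Lemma orbit_app x t : dom T x -> 0 <= t -> p (app T (S t x) - S t (app T x)) = 0.
Proof.
move=> Tx t0; have Kx := dom_K Tx; have KT := app_K Tx.
have [KTS D] := TP.2 _ (orbit_dom Tx t0).
apply: (right_derivative_unique (KS t0 Kx)) D _ => //; first exact: KS.
exact: orbit_right_derivative.
Qed.

End semigroup_theory.

(** * Null sets *)

Section null_sets.
Context {R : realType}.
Local Notation mu := (@lebesgue_measure R).
Local Notation RR := (measurableTypeR R).
Import HBNNSimple.

Definition ae (P : R -> Prop) : Prop := {ae mu, forall x, P x}.

Lemma aeS (P Q : R -> Prop) : (forall x, P x -> Q x) -> ae P -> ae Q.
Proof. by move=> PQ; apply: filterS; first exact: (ae_filter_ringOfSetsType mu). Qed.

Lemma aeI (P Q : R -> Prop) : ae P -> ae Q -> ae (fun x => P x /\ Q x).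
Proof. by apply: filterI; first exact: (ae_filter_ringOfSetsType mu). Qed.

Lemma ae_all (P : nat -> R -> Prop) : (forall n, ae (P n)) -> ae (fun x => forall n, P n x).
Proof. exact: ae_foralln. Qed.

Lemma ae_true (P : R -> Prop) : (forall x, P x) -> ae P.
Proof. by move=> h; apply: (aeS (P := fun=> True)) => //; exact: (@filterT _ _ (ae_filter_ringOfSetsType mu)). Qed.

(** The integral is a supremum over simple functions, which may be altered on a
    null set; no measurability is assumed, as norms of classes may lack it. *)
Lemma integral_null_ge0 (f g : R -> \bar R) :
  (forall x, (0 <= f x)%E) -> (forall x, (0 <= g x)%E) ->
  ae (fun x => f x = g x) -> (\int[mu]_x f x = \int[mu]_x g x)%E.
Proof.
wlog suff le : f g / (forall x, (0 <= f x)%E) -> (forall x, (0 <= g x)%E) ->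
    ae (fun x => f x = g x) -> (\int[mu]_x f x <= \int[mu]_x g x)%E.
  move=> f0 g0 fg; apply/eqP; rewrite eq_le !le//.
  by apply: (aeS _ fg) => x ->.
move=> f0 g0 [N [mN N0 sN]]; rewrite !ge0_integralTE//.
have fg x : ~ N x -> f x = g x by move=> Nx; apply: contrapT => /sN.
apply: ge_ereal_sup => _ [h hf <-].
have mNC := measurableC mN.
pose h' := mul_nnsfun h (indic_nnsfun R mNC).
have h'E x : ~ N x -> h' x = h x.
  by move=> Nx; rewrite /h' /= mindicE mem_set// mulr1.
apply: ereal_sup_ubound; exists h'.
  move=> x; have [Nx|Nx] := pselect (N x); last by rewrite h'E// -fg.
  by rewrite /h' /= mindicE memNset ?mulr0//; exact/not_notP.
rewrite -!integralT_nnsfun; apply: ge0_ae_eq_integral.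
- exact: measurableT.
- by apply/measurable_EFinP; exact: measurable_funPT.
- by apply/measurable_EFinP; exact: measurable_funPT.
- by move=> x _; rewrite lee_fin.
- by move=> x _; rewrite lee_fin.
- by exists N; split=> // x h1; apply: contrapT => Nx; apply: h1 => _; congr EFin; rewrite -h'E.
Qed.

Lemma integral_null (D : set R) (f g : R -> \bar R) :
  ae (fun x => D x -> f x = g x) ->
  (\int[mu]_(x in D) f x = \int[mu]_(x in D) g x)%E.
Proof.
have eq (f' g' : R -> \bar R) : (forall x, (0 <= f' x)%E) -> (forall x, (0 <= g' x)%E) ->
   ae (fun x => D x -> f' x = g' x) ->
   (\int[mu]_(x in D) f' x = \int[mu]_(x in D) g' x)%E.
  move=> f0 g0 fg; rewrite integral_mkcond [RHS]integral_mkcond.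
  apply: integral_null_ge0 => [x|x|].
  - by apply: erestrict_ge0 => // y _; exact: f0.
  - by apply: erestrict_ge0 => // y _; exact: g0.
  - by apply: (aeS _ fg) => x {}fg; rewrite /patch; case: ifPn => //; rewrite inE.
move=> fg; rewrite integralE [RHS]integralE; congr (_ - _)%E; apply: eq => //.
- by apply: (aeS _ fg) => x {}fg Dx; rewrite !funeposE fg.
- by apply: (aeS _ fg) => x {}fg Dx; rewrite !funenegE fg.
Qed.

Lemma Rintegral_null (D : set R) (f g : R -> R) :
  ae (fun x => D x -> f x = g x) ->
  \int[mu]_(x in D) f x = \int[mu]_(x in D) g x.
Proof.
move=> fg; rewrite /Rintegral; congr fine; apply: integral_null.
by apply: (aeS _ fg) => x {}fg Dx; rewrite fg.
Qed.

Definition I01 : set R := `]0, 1[%classic.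

Lemma mI01 : measurable (I01 : set RR). Proof. exact: measurable_itv. Qed.

Local Hint Resolve mI01 : core.

Lemma I01_measure : mu I01 = 1%E.
Proof. by rewrite /I01 lebesgue_measure_itv/= lte_fin ltr01 oppr0 adde0. Qed.

Lemma integrable_cst01 (k : R) : mu.-integrable I01 (EFin \o (fun=> k)).
Proof.
apply/integrableP; split; first exact: measurable_cst.
rewrite (@integral_cst _ _ _ mu _ mI01 `|k|%:E).
by rewrite [X in (_ * X)%E](_ : _ = 1%E) ?mule1 ?ltry//; exact: I01_measure.
Qed.

(** The series of the weighted functions has a finite integral, hence a finite
    value almost everywhere. *)
Lemma summable_pointwise (f : nat -> R -> R) :
  (forall n, measurable_fun (I01 : set RR) (f n)) -> (forall n x, 0 <= f n x) ->
  (forall n, (\int[mu]_(x in I01) (f n x)%:E <= ((4^-1) ^+ n)%:E)%E) ->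
  ae (fun x => I01 x -> exists C : R, forall n, f n x <= C * (2^-1) ^+ n).
Proof.
move=> mf f0 If.
pose g n x := ((2 ^+ n * f n x)%:E : \bar R).
have g0 n x : (0 <= g n x)%E by rewrite lee_fin mulr_ge0// exprn_ge0.
have mg n : measurable_fun (I01 : set RR) (g n).
  by apply/measurable_EFinP; apply: measurable_funM => //; exact: mf.
have Ig n : (\int[mu]_(x in I01) g n x <= ((2^-1) ^+ n)%:E)%E.
  have -> : (\int[mu]_(x in I01) g n x = (2 ^+ n : R)%:E * \int[mu]_(x in I01) (f n x)%:E)%E.
    rewrite /g; under eq_integral do rewrite EFinM.
    apply: (ge0_integralZl_EFin mu mI01).
    - by move=> x _; rewrite lee_fin.
    - by apply/measurable_EFinP; exact: mf.
    - by rewrite exprn_ge0.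
  have n0 : (0 <= (2 ^+ n : R)%:E)%E by rewrite lee_fin exprn_ge0.
  apply: le_trans (lee_wpmul2l n0 (If n)) _.
  by rewrite -EFinM lee_fin -exprMn (_ : 2 * 4^-1 = 2^-1) //; field.
have Is : (\int[mu]_(x in I01) (\sum_(0 <= n <oo) g n x) <= 2%:E)%E.
  rewrite (integral_nneseries mu mI01 mg (fun n x _ => g0 n x)).
  apply: lime_le; first by apply: is_cvg_nneseries => n _ _; apply: integral_ge0.
  apply: nearW => n; apply: le_trans (lee_sum _ (fun i _ => Ig i)) _.
  rewrite sumEFin lee_fin.
  have -> : \sum_(0 <= i < n) (2^-1) ^+ i = 2 - 2 * (2^-1) ^+ n :> R.
    elim: n => [|n IH]; first by rewrite big_geq// expr0; ring.
    by rewrite big_nat_recr//= IH exprS; field.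
  by rewrite gerBl mulr_ge0// exprn_ge0.
have ms : measurable_fun (I01 : set RR) (fun x => (\sum_(0 <= n <oo) g n x)%E).
  by apply: ge0_emeasurable_sum => // n x _ _ _.
have s0 x : (0 <= \sum_(0 <= n <oo) g n x)%E by apply: nneseries_ge0.
have int_s : mu.-integrable I01 (fun x => (\sum_(0 <= n <oo) g n x)%E).
  apply/integrableP; split => //.
  under eq_integral do rewrite gee0_abs//.
  exact: le_lt_trans Is (ltry _).
apply: (aeS _ (integrable_ae mI01 int_s)) => x fs /fs {}fs.
exists (fine (\sum_(0 <= n <oo) g n x)%E) => n.
have : (g n x <= \sum_(0 <= n <oo) g n x)%E.
  have := @nneseries_lim_ge R (fun n => g n x) xpredT 0%N n.+1 (fun i _ _ => g0 i x).
  apply: le_trans; rewrite big_nat_recr//=; apply: leeDr.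
  by apply: sume_ge0.
rewrite -(fineK fs) lee_fin => h.
have e : (2 : R) ^+ n * (2^-1) ^+ n = 1 by rewrite -exprMn divff// expr1n.
have q0 : 0 <= (2^-1 : R) ^+ n by rewrite exprn_ge0.
have := ler_wpM2r q0 h; rewrite mulrAC e mul1r; apply.
Qed.

End null_sets.

(** * Square integrable vector functions *)

Section strong_measurability.
Context {R : realType} {H : completeNormedModType R[i]}.
Variable dot : {dot H for Num.conj}.
Hypothesis norm_dot : forall x : H, `|x| ^+ 2 = dot x x.
Local Notation ip := (rdot dot).
Local Notation mu := (@lebesgue_measure R).
Local Notation RR := (measurableTypeR R).
Implicit Types z w : R -> H.

(** Strong measurability in the strict sense: a limit of simple maps at every
    point, with no exceptional set, so that compositions are Borel. *)
Definition smeas z := exists2 s : nat -> R -> H, forall n, simple_map (s n) &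
  forall x, s n x @[n --> \oo] --> z x.

Lemma simple_map2 (F : H -> H -> H) s s' : simple_map s -> simple_map s' ->
  simple_map (fun x => F (s x) (s' x)).
Proof.
move=> [fs ms] [fs' ms']; split.
  apply: (@sub_finite_set _ _ [set F a b | a in range s & b in range s']).
    by move=> _ [x _ <-]; exists (s x); [exists x|exists (s' x); [exists x|]].
  exact: finite_image2.
move=> y; rewrite (_ : _ @^-1` _ = \bigcup_(p in [set p | (range s `*` range s') p /\ F p.1 p.2 = y])
    (s @^-1` [set p.1] `&` s' @^-1` [set p.2])).
  apply: fin_bigcup_measurable; last by move=> p _; apply: measurableI.
  apply: (@sub_finite_set _ _ (range s `*` range s')); first by move=> p [].
  exact: finite_setX.
apply/seteqP; split => x /=.
  by move=> <-; exists (s x, s' x) => //=; split=> //; split; [exists x|exists x].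
by move=> [[a b] /= [_ <-]] [-> ->].
Qed.

Lemma simple_map_measurable (phi : H -> R) s : simple_map s ->
  measurable_fun (setT : set RR) (phi \o s).
Proof.
move=> [fs ms] _ Y mY; rewrite setTI.
rewrite (_ : _ @^-1` _ = \bigcup_(a in [set a | range s a /\ Y (phi a)]) (s @^-1` [set a])).
  apply: fin_bigcup_measurable => [|a _]; last exact: ms.
  by apply: sub_finite_set fs => a [].
apply/seteqP; split => x /=; first by move=> Yx; exists (s x) => //; split=> //; exists x.
by move=> [a [_ Ya] /= ->].
Qed.

Lemma smeas_measurable (phi : H -> R) z :
  (forall (u : nat -> H) l, u n @[n --> \oo] --> l ->
     phi (u n) @[n --> \oo] --> phi l) ->
  smeas z -> measurable_fun (setT : set RR) (phi \o z).
Proof.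
move=> cphi [s hs sz]; apply: (@measurable_fun_cvg _ _ _ _ (fun n => phi \o s n)).
  by move=> m; exact: simple_map_measurable.
by move=> x _; exact: cphi.
Qed.

Lemma nm_cvg (u : nat -> H) l : u n @[n --> \oo] --> l -> nm (u n) @[n --> \oo] --> nm l.
Proof.
move=> /cvg_nmP h; apply/cvgrPdist_lt => e e0; have [N hN] := h _ e0.
exists N => // n /= /hN; apply: le_lt_trans.
rewrite ler_norml; apply/andP; split.
  by rewrite lerNl opprB lerBlDr; have := nmD (u n - l) l; rewrite subrK.
by rewrite lerBlDr nmC; have := nmD (l - u n) (u n); rewrite subrK.
Qed.

Lemma ip_cvg (u : nat -> H) l y : u n @[n --> \oo] --> l ->
  ip (u n) y @[n --> \oo] --> ip l y.
Proof.
move=> /cvg_nmP h; apply/cvgrPdist_lt => e e0.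
have [N hN] := ip_lim0 norm_dot y h e0.
by exists N => // n /= /hN; rewrite ![ip _ y]ipC distrC.
Qed.

Lemma smeas_lin (k : R[i]) z w : smeas z -> smeas w -> smeas (fun x => k *: z x + w x).
Proof.
move=> [s hs sz] [s' hs' sw]; exists (fun n x => k *: s n x + s' n x).
  by move=> n; exact: (simple_map2 (fun a b => k *: a + b)).
by move=> x; apply: cvgD; [apply: cvgZ; [exact: cvg_cst|exact: sz]|exact: sw].
Qed.

Lemma smeas_nm z : smeas z -> measurable_fun (setT : set RR) (fun x => nm (z x)).
Proof. by apply: smeas_measurable => u l; exact: nm_cvg. Qed.

Lemma smeas_ip z y : smeas z -> measurable_fun (setT : set RR) (fun x => ip (z x) y).
Proof. by apply: (@smeas_measurable (fun a => ip a y)) => u l; exact: ip_cvg. Qed.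

Lemma simple_map0 : simple_map (fun=> 0 : H).
Proof.
split; first by apply: (@sub_finite_set _ _ [set 0]) => // _ [x _ <-].
by move=> y; rewrite preimage_cst; case: ifP => _; [exact: measurableT|exact: measurable0].
Qed.

Lemma simple_map_restrict (D : set RR) (s : R -> H) : measurable D -> simple_map s ->
  simple_map (patch (fun=> 0) D s).
Proof.
move=> mD [fs ms]; split.
  apply: (@sub_finite_set _ _ (range s `|` [set 0])).
    move=> _ [x _ <-]; rewrite /patch; case: ifP => _; last by right.
    by left; exists x.
  by rewrite finite_setU.
move=> y; have -> : patch (fun=> 0) D s @^-1` [set y] =
   (D `&` s @^-1` [set y]) `|` (~` D `&` (fun=> 0 : H) @^-1` [set y]).
  apply/seteqP; split => x /=; rewrite /patch.
    by case: ifPn; rewrite ?notin_setE ?inE; [left|right].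
  by move=> [[Dx <-]|[nDx <-]]; [rewrite mem_set|rewrite memNset].
apply: measurableU; apply: measurableI => //; first exact: measurableC.
by case: simple_map0 => _; exact.
Qed.

Lemma strongly_measurable_rep z : strongly_measurable I01 z ->
  exists2 z', smeas z' & ae (fun x => I01 x -> z' x = z x).
Proof.
move=> [s hs [N [mN N0 sN]]].
pose D : set RR := I01 `\` N.
have mD : measurable D by apply: measurableD => //; exact: mI01.
exists (patch (fun=> 0) D z).
  exists (fun n => patch (fun=> 0) D (s n)); first by move=> n; exact: simple_map_restrict.
  move=> x; rewrite /patch; case: ifPn => [|_]; last exact: cvg_cst.
  rewrite inE => -[Ix Nx].
  have : I01 x -> s n x @[n --> \oo] --> z x by apply: contrapT => /sN.
  exact.
exists N; split=> // x /= h; apply: contrapT => Nx; apply: h => Ix.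
by rewrite /patch mem_set.
Qed.

Lemma smeas_strongly z z' : smeas z' -> ae (fun x => I01 x -> z' x = z x) ->
  strongly_measurable I01 z.
Proof.
move=> [s hs sz] h; exists s => //; apply: (aeS _ h) => x e Ix.
by rewrite -e.
Qed.

Definition sq z : R -> R := fun x => nm (z x) ^+ 2.
Definition q2 z : R := \int[mu]_(x in I01) sq z x.

Lemma sq_ge0 z x : 0 <= sq z x. Proof. exact: sqr_ge0. Qed.
Lemma q2_ge0 z : 0 <= q2 z.
Proof. by apply: Rintegral_ge0 => x _; exact: sq_ge0. Qed.

Lemma q2_ae z w : ae (fun x => I01 x -> z x = w x) -> q2 z = q2 w.
Proof. by move=> h; apply: Rintegral_null; apply: (aeS _ h) => x e Ix; rewrite /sq e. Qed.

Lemma smeas_sq z : smeas z -> measurable_fun (I01 : set RR) (sq z).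
Proof.
move=> mz; apply: (@measurable_funS _ _ _ _ (setT : set RR)) => //.
exact: (@measurable_funX _ _ _ _ _ 2 (smeas_nm mz)).
Qed.

Lemma sq_integrable z : smeas z ->
  (\int[mu]_(x in I01) (sq z x)%:E < +oo)%E -> mu.-integrable I01 (EFin \o sq z).
Proof.
move=> mz fz; apply/integrableP; split; first by apply/measurable_EFinP; exact: smeas_sq.
by under eq_integral do rewrite gee0_abs ?lee_fin ?sq_ge0//.
Qed.

Lemma integrable_sq z : mu.-integrable I01 (EFin \o sq z) ->
  (\int[mu]_(x in I01) (sq z x)%:E < +oo)%E.
Proof.
move=> /integrableP[_]; apply: le_lt_trans.
by under [leRHS]eq_integral do rewrite gee0_abs ?lee_fin ?sq_ge0//.
Qed.

(** Almost everywhere limits of simple maps may fail to be Borel on a null set,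
    where they are redefined. *)
Lemma L2_rep z : L2_01 z -> exists z',
  [/\ smeas z', mu.-integrable I01 (EFin \o sq z') & ae (fun x => I01 x -> z' x = z x)].
Proof.
move=> [/strongly_measurable_rep[z' mz' e] fz]; exists z'; split=> //.
apply: sq_integrable => //; rewrite (_ : (\int[mu]_(x in I01) _)%E = (\int[mu]_(x in I01) (sq z x)%:E)%E)//.
by apply: integral_null; apply: (aeS _ e) => x ex Ix; rewrite /sq ex.
Qed.

Lemma rep_L2 z z' : smeas z' -> mu.-integrable I01 (EFin \o sq z') ->
  ae (fun x => I01 x -> z' x = z x) -> L2_01 z.
Proof.
move=> mz' iz' e; split; first exact: smeas_strongly mz' e.
rewrite (_ : (\int[mu]_(x in _) _)%E = (\int[mu]_(x in I01) (sq z' x)%:E)%E).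
  exact: integrable_sq.
by apply: integral_null; apply: (aeS _ e) => x ex Ix; rewrite /sq ex.
Qed.

Lemma sq_young (s : R) z w x : 0 < s ->
  sq (fun x => z x + w x) x <= (1 + s) * sq z x + (1 + s^-1) * sq w x.
Proof.
move=> s0; rewrite /sq (nmD2 norm_dot).
have := ip_young norm_dot (z x) (w x) s0; rewrite invfM => h.
have e : nm (w x) ^+ 2 * (2^-1 * s^-1) * 2 = s^-1 * nm (w x) ^+ 2 by field; rewrite gt_eqF.
lra.
Qed.

Lemma sqZ (k : R[i]) z x : sq (fun x => k *: z x) x = complex.Re `|k| ^+ 2 * sq z x.
Proof. by rewrite /sq nmZ exprMn. Qed.

Lemma le_integrable01 (f g : R -> R) : measurable_fun (I01 : set RR) f ->
  (forall x, I01 x -> `|f x| <= g x) -> mu.-integrable I01 (EFin \o g) ->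
  mu.-integrable I01 (EFin \o f).
Proof.
move=> mf fg; apply: (le_integrable mI01); first exact/measurable_EFinP.
move=> x Ix; rewrite /= lee_fin (le_trans (fg _ Ix))// ler_norm//.
Qed.

Lemma integrable_lin01 (a b : R) (f g : R -> R) :
  mu.-integrable I01 (EFin \o f) -> mu.-integrable I01 (EFin \o g) ->
  mu.-integrable I01 (EFin \o (fun x => a * f x + b * g x)).
Proof.
move=> If Ig.
apply: (eq_integrable mI01 _ _ _ (integrableD mI01 (integrableZl mI01 a If) (integrableZl mI01 b Ig))).
by move=> x _; rewrite /= EFinD !EFinM.
Qed.

Lemma Rintegral_lin01 (a b : R) (f g : R -> R) :
  mu.-integrable I01 (EFin \o f) -> mu.-integrable I01 (EFin \o g) ->
  \int[mu]_(x in I01) (a * f x + b * g x) =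
  a * (\int[mu]_(x in I01) f x) + b * (\int[mu]_(x in I01) g x).
Proof.
move=> If Ig; have aux c h : mu.-integrable I01 (EFin \o h) ->
    mu.-integrable I01 (EFin \o (fun x => c * h x)).
  by move=> Ih; apply: (eq_integrable mI01 _ _ _ (integrableZl mI01 c Ih)) => x _; rewrite /= EFinM.
rewrite (RintegralD mI01 (aux _ _ If) (aux _ _ Ig)).
by rewrite (RintegralZl a mI01 If) (RintegralZl b mI01 Ig).
Qed.

Lemma rep_lin (k : R[i]) z' w' :
  smeas z' -> mu.-integrable I01 (EFin \o sq z') ->
  smeas w' -> mu.-integrable I01 (EFin \o sq w') ->
  smeas (fun x => k *: z' x + w' x) /\
  mu.-integrable I01 (EFin \o sq (fun x => k *: z' x + w' x)).
Proof.
move=> mz iz mw iw; have ml := smeas_lin k mz mw; split=> //.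
apply: (le_integrable01 (smeas_sq ml) _
  (integrable_lin01 (2 * complex.Re `|k| ^+ 2) 2 iz iw)).
move=> x _; rewrite ger0_norm ?sq_ge0//.
apply: le_trans (sq_young (fun x => k *: z' x) _ _ ltr01) _.
by rewrite invr1 sqZ; lra.
Qed.

Lemma L2_lin (k : R[i]) z w : L2_01 z -> L2_01 w -> L2_01 (fun x => k *: z x + w x).
Proof.
move=> /L2_rep[z' [mz iz ez]] /L2_rep[w' [mw iw ew]].
have [ml il] := rep_lin k mz iz mw iw.
apply: rep_L2 ml il _; apply: (aeS _ (aeI ez ew)) => x [e1 e2] Ix.
by rewrite e1// e2.
Qed.

Lemma q2_young (s : R) z w : 0 < s -> L2_01 z -> L2_01 w ->
  q2 (fun x => z x + w x) <= (1 + s) * q2 z + (1 + s^-1) * q2 w.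
Proof.
move=> s0 /L2_rep[z' [mz iz ez]] /L2_rep[w' [mw iw ew]].
have [_ il] := rep_lin 1 mz iz mw iw.
rewrite -(q2_ae ez) -(q2_ae ew) (@q2_ae _ (fun x => 1 *: z' x + w' x)); last first.
  by apply: (aeS _ (aeI ez ew)) => x [e1 e2] Ix; rewrite e1// e2// scale1r.
rewrite /q2 -Rintegral_lin01//; apply: (le_Rintegral mI01) => //.
  exact: integrable_lin01.
move=> x _; have := sq_young z' w' x s0; congr (_ <= _).
by rewrite /sq scale1r.
Qed.

Lemma q2Z (k : R[i]) z : L2_01 z -> q2 (fun x => k *: z x) = complex.Re `|k| ^+ 2 * q2 z.
Proof.
move=> /L2_rep[z' [mz iz ez]]; rewrite -(q2_ae ez) (@q2_ae _ (fun x => k *: z' x)).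
  rewrite /q2 -(RintegralZl _ mI01 iz); apply: eq_Rintegral => x _; exact: sqZ.
by apply: (aeS _ ez) => x e Ix; rewrite e.
Qed.

Lemma L2_0 : L2_01 (fun=> 0 : H).
Proof.
apply: (@rep_L2 _ (fun=> 0)); last exact: ae_true.
  by exists (fun _ _ => 0) => [n|x]; [exact: simple_map0|exact: cvg_cst].
rewrite (_ : _ \o _ = EFin \o (fun=> 0 : R)); first exact: integrable_cst01.
by apply/funext => x /=; rewrite /sq nm0 expr0n.
Qed.

End strong_measurability.

(** * Completeness of the space of square integrable functions *)

Section L2_completeness.
Context {R : realType} {H : completeNormedModType R[i]}.
Ltac vec := lmod (R[i] : comPzRingType) (H : Type).
Variable dot : {dot H for Num.conj}.
Hypothesis norm_dot : forall x : H, `|x| ^+ 2 = dot x x.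
Local Notation mu := (@lebesgue_measure R).
Local Notation RR := (measurableTypeR R).
Implicit Types z w : R -> H.

Lemma smeasB z w : smeas z -> smeas w -> smeas (fun x => z x - w x).
Proof.
move=> mz mw; have := smeas_lin (-1) mw mz.
by rewrite (_ : (fun _ => _) = (fun x => z x - w x))//; apply/funext => x; rewrite scaleN1r addrC.
Qed.

Lemma simple_smeas (s : R -> H) : simple_map s -> smeas s.
Proof. by move=> hs; exists (fun=> s) => // x; exact: cvg_cst. Qed.

Definition dist1 z w : R -> R := fun x => Num.min 1 (sq (fun x => z x - w x) x).

Lemma dist1_ge0 z w x : 0 <= dist1 z w x.
Proof. by rewrite /dist1 le_min ler01 sq_ge0. Qed.

Lemma dist1_measurable z w : smeas z -> smeas w -> measurable_fun (I01 : set RR) (dist1 z w).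
Proof.
move=> mz mw; apply: measurable_minr; first exact: measurable_cst.
exact: smeas_sq (smeasB mz mw).
Qed.

Lemma simple_approx z (e : R) : smeas z -> 0 < e ->
  exists2 s, simple_map s & (\int[mu]_(x in I01) (dist1 s z x)%:E <= e%:E)%E.
Proof.
move=> mz e0; have [s hs sz] := mz.
have d0 x : dist1 (s n) z x @[n --> \oo] --> (0 : R).
  apply/cvgrPdist_lt => e' e'0.
  have m0 : 0 < Num.min 1 e' by rewrite lt_min ltr01.
  have [N hN] := (cvg_nmP _ _).1 (sz x) _ m0.
  exists N => // n /= Nn; rewrite sub0r normrN ger0_norm ?dist1_ge0//.
  have := hN n Nn; rewrite lt_min => /andP[h1 h2].
  rewrite /dist1 /sq gt_min; apply/orP; right.
  apply: le_lt_trans h2; rewrite expr2 ler_piMr ?nm_ge0//; exact: ltW.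
have [|||||_ _ h] := @dominated_convergence _ _ R mu I01 mI01 (fun n x => (dist1 (s n) z x)%:E)
  (fun=> 0%E) (EFin \o (fun=> 1)).
- move=> n; apply/measurable_EFinP; apply: dist1_measurable => //; exact: simple_smeas.
- exact: measurable_cst.
- by apply: ae_true => x Ix; apply: cvg_EFin; [exact: nearW|exact: d0].
- exact: integrable_cst01.
- apply: ae_true => x n Ix; rewrite abse_EFin lee_fin ger0_norm ?dist1_ge0//.
  by rewrite /dist1 ge_min lexx.
rewrite integral0 in h.
have /fine_cvgP[_ /cvgrPdist_lt/(_ _ e0)[N _ hN]] := h.
exists (s N); first exact: hs.
have := hN N (leqnn N); rewrite /= sub0r normrN => hh.
have I : mu.-integrable I01 (EFin \o dist1 (s N) z).
  apply: le_integrable01 (integrable_cst01 1).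
    apply: dist1_measurable => //; exact: simple_smeas.
  by move=> x _; rewrite ger0_norm ?dist1_ge0// /dist1 ge_min lexx.
rewrite -(fineK (integrable_fin_num mI01 I)) lee_fin.
by apply: ltW; apply: le_lt_trans hh; exact: ler_norm.
Qed.

(** The simple approximations are chosen close to the functions up to sets of
    summable measure, so that they converge to the limit almost everywhere. *)
Lemma strongly_measurable_lim (w : nat -> R -> H) l : (forall n, smeas (w n)) ->
  ae (fun x => I01 x -> w n x @[n --> \oo] --> l x) -> strongly_measurable I01 l.
Proof.
move=> mw wl.
have e0 n : 0 < (4^-1) ^+ n :> R by rewrite exprn_gt0.
have ex n : exists s, simple_map s /\
    (\int[mu]_(x in I01) (dist1 s (w n) x)%:E <= ((4^-1) ^+ n)%:E)%E.
  by have [s hs h] := simple_approx (mw n) (e0 n); exists s.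
have [s sP] := choice ex.
exists s; first by move=> n; case: (sP n).
have := @summable_pointwise R (fun n => dist1 (s n) (w n)).
move=> /(_ (fun n => dist1_measurable (simple_smeas (sP n).1) (mw n))).
move=> /(_ (fun n x => dist1_ge0 _ _ x) (fun n => (sP n).2)) h.
apply: (aeS _ (aeI wl h)) => x [wx hx] Ix.
have [C hC] := hx Ix; have /cvg_nmP {}wx := wx Ix.
apply/cvg_nmP => e e'0.
have e2 : 0 < e / 2 by rewrite divr_gt0.
have [N1 hN1] := wx _ e2.
pose d := Num.min 1 ((e / 2) ^+ 2).
have d0 : 0 < d by rewrite lt_min ltr01 exprn_gt0.
have : (C * (2^-1) ^+ n) @[n --> \oo] --> C * 0.
  apply: cvgMr; apply: cvg_expr; rewrite ger0_norm// invf_lt1//; lra.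
rewrite mulr0 => /cvgrPdist_lt/(_ _ d0)[N2 _ hN2].
exists (maxn N1 N2) => n; rewrite geq_max => /andP[n1 n2].
have := hN2 n n2; rewrite /= sub0r normrN => /(le_lt_trans (ler_norm _)) h2.
have := le_lt_trans (hC n) h2.
rewrite /dist1 lt_min !gt_min ltxx /= => /andP[h3 h4].
have {}h3 : sq (fun x => s n x - w n x) x < 1 by exact: h3.
have {}h4 : sq (fun x => s n x - w n x) x < (e / 2) ^+ 2.
  move: h4 => /orP[h4|//]; exact: lt_trans h3 h4.
have h5 : nm (s n x - w n x) < e / 2 by apply: sqr_lt_inv => //; exact: nm_ge0.
have := nmD (s n x - w n x) (w n x - l x); rewrite addrA subrK.
have := hN1 n n1; lra.
Qed.

Lemma Rintegral_sq z : mu.-integrable I01 (EFin \o sq z) ->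
  (\int[mu]_(x in I01) (sq z x)%:E = (q2 z)%:E)%E.
Proof. by move=> iz; rewrite /q2 /Rintegral fineK //; exact: (integrable_fin_num mI01 iz). Qed.

Lemma q2_le_fatou (F : nat -> R -> R) (L : R -> R) (e : R) N :
  (forall n, measurable_fun (I01 : set RR) (F n)) -> (forall n x, 0 <= F n x) ->
  ae (fun x => I01 x -> F n x @[n --> \oo] --> L x) ->
  (forall n, (N <= n)%N -> (\int[mu]_(x in I01) (F n x)%:E <= e%:E)%E) ->
  (\int[mu]_(x in I01) (L x)%:E <= e%:E)%E.
Proof.
move=> mF F0 FL Fe.
have -> : (\int[mu]_(x in I01) (L x)%:E = \int[mu]_(x in I01) limn_einf (fun n => (F n x)%:E))%E.
  apply: integral_null; apply: (aeS _ FL) => x h Ix.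
  have : (F n x)%:E @[n --> \oo] --> (L x)%:E.
    by apply: cvg_EFin; [exact: nearW|exact: h].
  by move=> /cvg_limn_einf_sup[->].
apply: le_trans (fatou mu mI01 _ _) _.
- by move=> n; apply/measurable_EFinP; exact: mF.
- by move=> n x _; rewrite lee_fin.
rewrite limn_einf_lim; apply: lime_le; first exact: is_cvg_einfs.
exists N => // n /= Nn; apply: le_trans (Fe n Nn).
by apply: ereal_inf_lbound; exists n => //=.
Qed.

(** A subsequence with geometrically small increments converges almost everywhere,
    and Fatou's lemma bounds the distance to its limit. *)
Lemma L2_complete (u : nat -> R -> H) : (forall n, L2_01 (u n)) ->
  (forall e : R, 0 < e -> exists N, forall n m, (N <= n)%N -> (N <= m)%N ->
     q2 (fun x => u n x - u m x) <= e) ->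
  exists2 l, L2_01 l & forall e : R, 0 < e -> exists N, forall n, (N <= n)%N ->
     q2 (fun x => u n x - l x) <= e.
Proof.
move=> uL cu.
have [r rP] := choice (fun n => L2_rep (uL n)).
have mr n : smeas (r n) by case: (rP n).
have ir n : mu.-integrable I01 (EFin \o sq (r n)) by case: (rP n).
have q2r n m : q2 (fun x => r n x - r m x) = q2 (fun x => u n x - u m x).
  apply: q2_ae; have [_ _ a] := rP n; have [_ _ b] := rP m.
  by apply: (aeS _ (aeI a b)) => x [e1 e2] Ix; rewrite e1// e2.
have irB n m : mu.-integrable I01 (EFin \o sq (fun x => r n x - r m x)).
  have [_] := rep_lin norm_dot (-1) (mr m) (ir m) (mr n) (ir n).
  by apply: (eq_integrable mI01) => x _; rewrite /= /sq scaleN1r addrC.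
have e8 k : 0 < (8^-1) ^+ k :> R by rewrite exprn_gt0.
have [phi phiP] := choice (fun k => cu _ (e8 k)).
pose psi k := (\max_(i < k.+1) phi i + k)%N.
have psi_ge k : (phi k <= psi k)%N by apply: leq_trans (leq_addr _ _); exact: (leq_bigmax (@ord_max k)).
have psi_mono k : (psi k <= psi k.+1)%N.
  rewrite /psi leq_add//; apply/bigmax_leqP => i _.
  exact: (leq_bigmax (widen_ord (leqnSn k.+1) i)).
pose w k := r (psi k).
pose f k x := 2 ^+ k * sq (fun x => w k.+1 x - w k x) x.
have f_ge0 k x : 0 <= f k x by rewrite /f; apply: mulr_ge0; [rewrite exprn_ge0|exact: sq_ge0].
have mf k : measurable_fun (I01 : set RR) (f k).
  by rewrite /f; apply: measurable_funM => //; exact: smeas_sq (smeasB (mr _) (mr _)).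
have f_int k : (\int[mu]_(x in I01) (f k x)%:E <= ((4^-1) ^+ k)%:E)%E.
  have -> : (\int[mu]_(x in I01) (f k x)%:E =
      (2 ^+ k : R)%:E * \int[mu]_(x in I01) (sq (fun x => w k.+1 x - w k x) x)%:E)%E.
    rewrite /f; under eq_integral do rewrite EFinM.
    apply: (ge0_integralZl_EFin mu mI01).
    - by move=> x _; rewrite lee_fin sq_ge0.
    - by apply/measurable_EFinP; exact: smeas_sq (smeasB (mr _) (mr _)).
    - by rewrite exprn_ge0.
  rewrite Rintegral_sq; last exact: irB.
  rewrite -EFinM lee_fin q2r.
  apply: (@le_trans _ _ (2 ^+ k * (8^-1) ^+ k)); last first.
    by rewrite -exprMn (_ : 2 * 8^-1 = 4^-1) //; field.
  rewrite ler_wpM2l ?exprn_ge0//; apply: phiP => //.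
  exact: leq_trans (psi_mono k).
have hsum := summable_pointwise mf f_ge0 f_int.
have wcvg : ae (fun x => I01 x -> exists l : H, w n x @[n --> \oo] --> l).
  move: hsum; apply: aeS => x h Ix; have [C hC] := h Ix.
  pose D := `|C| + 1.
  have D0 : 0 < D by rewrite /D ltr_wpDl.
  have step k : nm (w k.+1 x - w k x) <= D * (2^-1) ^+ k.
    have q0 : 0 < (2^-1) ^+ k :> R by rewrite exprn_gt0.
    apply: sqr_le_inv; rewrite ?nm_ge0 ?mulr_gt0//.
    have := hC k; rewrite /f /sq; set a := nm _ => h1.
    have e : 2 ^+ k * (2^-1) ^+ k = 1 :> R by rewrite -exprMn divff// expr1n.
    have h2 : a ^+ 2 <= C * ((2^-1) ^+ k) ^+ 2.
      have := ler_wpM2r (ltW q0) h1; rewrite mulrAC e mul1r => /le_trans; apply.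
      by rewrite -mulrA -expr2.
    apply: (le_trans h2); rewrite exprMn ler_wpM2r ?sqr_ge0//.
    have := ler_norm C; rewrite /D; have := normr_ge0 C; set c := `|C|; nra.
  have tail n j : nm (w (n + j)%N x - w n x) <= 2 * D * (2^-1) ^+ n * (1 - (2^-1) ^+ j).
    elim: j => [|j IH]; first by rewrite addn0 subrr nm0 expr0 subrr mulr0.
    have := nmD (w (n + j).+1 x - w (n + j)%N x) (w (n + j)%N x - w n x).
    rewrite addrA subrK addnS; have := step (n + j)%N; rewrite exprD.
    move: IH; rewrite exprS; set a := (2^-1) ^+ n; set b := (2^-1) ^+ j.
    set p1 := nm _; set p2 := nm _; set p3 := nm _; lra.
  have [l hl] : exists l, forall e : R, 0 < e -> exists N, forall n, (N <= n)%N ->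
      nm (w n x - l) < e.
    apply: nm_complete => e e0.
    have : (2 * D * (2^-1) ^+ n) @[n --> \oo] --> 2 * D * 0.
      apply: cvgMr; apply: cvg_expr; rewrite ger0_norm// invf_lt1//; lra.
    have e2 : 0 < e / 2 by rewrite divr_gt0.
    rewrite mulr0 => /cvgrPdist_lt/(_ _ e2)[N _ hN].
    have := hN N (leqnn N); rewrite /= sub0r normrN => /(le_lt_trans (ler_norm _)) hN'.
    have key n : (N <= n)%N -> nm (w n x - w N x) < e / 2.
      move=> Nn; rewrite -(subnKC Nn); apply: le_lt_trans (tail _ _) _.
      apply: le_lt_trans hN'; apply: ler_piMr; first by rewrite !mulr_ge0 ?exprn_ge0// ltW.
      by rewrite gerBl exprn_ge0.
    exists N => n m /key n1 /key m1.
    have := nmD (w n x - w N x) (w N x - w m x); rewrite addrA subrK (nmC (w N x)); lra.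
  by exists l; apply/cvg_nmP.
have lP x : exists l : H, (exists l : H, w n x @[n --> \oo] --> l) -> w n x @[n --> \oo] --> l.
  have [[l hl]|n] := pselect (exists l : H, w n x @[n --> \oo] --> l); first by exists l.
  by exists 0.
have [l0 l0P] := choice lP.
have wl0 : ae (fun x => I01 x -> w n x @[n --> \oo] --> l0 x).
  by apply: (aeS _ wcvg) => x h Ix; exact: l0P (h Ix).
have [l ml ll0] := strongly_measurable_rep (strongly_measurable_lim (fun n => mr _) wl0).
have wl : ae (fun x => I01 x -> w n x @[n --> \oo] --> l x).
  by apply: (aeS _ (aeI wl0 ll0)) => x [h e] Ix; rewrite e//; exact: h.
have main (e : R) : 0 < e -> exists N, forall n, (N <= n)%N ->
    (\int[mu]_(x in I01) (sq (fun x => r n x - l x) x)%:E <= e%:E)%E.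
  move=> e0; have [N hN] := cu e e0; exists N => n Nn.
  apply: (@q2_le_fatou (fun k => sq (fun x => r n x - w k x)) _ e N).
  - by move=> k; exact: smeas_sq (smeasB (mr _) (mr _)).
  - by move=> k x; exact: sq_ge0.
  - apply: (aeS _ wl) => x h Ix; apply: cvgM; apply: nm_cvg;
    by apply: cvgB; [exact: cvg_cst|exact: h].
  - move=> k Nk; rewrite (Rintegral_sq (irB n (psi k))) lee_fin q2r.
    by apply: hN => //; apply: leq_trans Nk _; rewrite /psi leq_addl.
have il n e : (\int[mu]_(x in I01) (sq (fun x => r n x - l x) x)%:E <= e%:E)%E ->
    mu.-integrable I01 (EFin \o sq (fun x => r n x - l x)).
  by move=> h; apply: sq_integrable; [exact: smeasB|exact: le_lt_trans h (ltry _)].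
exists l.
  have [N hN] := main 1 ltr01; have iN := il _ _ (hN N (leqnn N)).
  apply: (@rep_L2 _ _ _ l) => //; last exact: ae_true.
  have [_] := rep_lin norm_dot (-1) (smeasB (mr N) ml) iN (mr N) (ir N).
  apply: (eq_integrable mI01) => x _ /=; congr ((nm _ ^+ 2)%:E).
  by move: (r N x) (l x) => *; vec.
move=> e e0; have [N hN] := main e e0; exists N => n Nn.
have := hN n Nn; rewrite (Rintegral_sq (il _ _ (hN n Nn))) lee_fin.
congr (_ <= _); apply: q2_ae; have [_ _ a] := rP n.
by apply: (aeS _ a) => x ex Ix; rewrite ex.
Qed.

End L2_completeness.

(** * Quadratic splines *)

Section splines.
Context {R : realType}.
Implicit Types r t h : R.

Lemma is_derive_quadratic (f : R -> R) (x d C : R) : 0 <= C ->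
  (forall h, `|f (x + h) - f x - h * d| <= C * h ^+ 2) -> is_derive x 1 f d.
Proof.
move=> C0 fh.
have lim : h^-1 *: (f (h *: (1 : R) + x) - f x) @[h --> (0 : R)^'] --> d.
  apply/cvgrPdist_lt => e e0.
  have e1 : 0 < e / (C + 1) by rewrite divr_gt0// ltr_wpDl.
  rewrite near_withinE; exists (e / (C + 1)) => //= h; rewrite /ball_ /= sub0r normrN => he h0.
  have hp : 0 < `|h| by rewrite normr_gt0.
  rewrite -(ltr_pM2l hp) -normrM [h%:A]mulr1.
  have -> : h * (d - h^-1 *: (f (h + x) - f x)) = - (f (x + h) - f x - h * d).
    by rewrite /GRing.scale /= (addrC h) mulrBr mulrA divff// mul1r; ring.
  rewrite normrN; apply: le_lt_trans (fh h) _.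
  rewrite -[h ^+ 2]real_normK ?num_real// expr2 mulrCA ltr_pM2l//.
  by move: he; rewrite ltr_pdivlMr ?ltr_wpDl//; have := normr_ge0 h; lra.
have dv : derivable f x 1 by apply/cvg_ex; exists d.
split=> //; rewrite /derive; apply: cvg_lim => //.
Qed.

Definition pos t : R := Num.max t 0.

Lemma posE t : pos t = if 0 <= t then t else 0.
Proof. by rewrite /pos; case: leP => // h; rewrite ?(max_idPl _)// max_r// ltW. Qed.

Lemma pos_lip t h : `|pos (t + h) - pos t| <= `|h|.
Proof.
rewrite !posE; case: (leP 0 (t + h)) => a; case: (leP 0 t) => b;
rewrite ?subr0 ?sub0r ?subrr ?normr0// ?normrN.
- by rewrite addrC addrA addNr add0r.
- by rewrite !ger0_norm//; lra.
- by rewrite (ger0_norm b) ler0_norm; lra.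
Qed.

Lemma pos2_taylor t h : `|pos (t + h) ^+ 2 - pos t ^+ 2 - h * (2 * pos t)| <= h ^+ 2.
Proof.
rewrite !posE; case: (leP 0 (t + h)) => a; case: (leP 0 t) => b; rewrite ler_norml;
  apply/andP; split; nra.
Qed.

(** A [C^1] step from [0] to [1] across [[-r, r]] and its derivative, a
    triangular kernel of mass one. *)
Definition st r t := (pos (t + r) ^+ 2 - 2 * pos t ^+ 2 + pos (t - r) ^+ 2) / (2 * r ^+ 2).
Definition hat r t := (pos (t + r) - 2 * pos t + pos (t - r)) / r ^+ 2.

Lemma st_taylor r t h : 0 < r ->
  `|st r (t + h) - st r t - h * hat r t| <= 2 / r ^+ 2 * h ^+ 2.
Proof.
move=> r0; have r20 : 0 < r ^+ 2 by rewrite exprn_gt0.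
have := pos2_taylor (t + r) h; have := pos2_taylor t h; have := pos2_taylor (t - r) h.
rewrite (_ : t - r + h = t + h - r); last by ring.
rewrite (_ : t + r + h = t + h + r); last by ring.
set A := (X in `|X| <= _); set B := (X in _ -> `|X| <= _ -> _); set C := (X in _ -> _ -> `|X| <= _ -> _).
move=> hA hB hC.
have -> : st r (t + h) - st r t - h * hat r t = (C - 2 * B + A) / (2 * r ^+ 2).
  by rewrite /st /hat /A /B /C; field; rewrite gt_eqF.
rewrite normrM normfV (ger0_norm (_ : 0 <= 2 * r ^+ 2)); last by rewrite mulr_ge0// ltW.
rewrite ler_pdivrMr ?mulr_gt0//.
have -> : 2 / r ^+ 2 * h ^+ 2 * (2 * r ^+ 2) = 4 * h ^+ 2 by field; rewrite gt_eqF.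
apply: le_trans (ler_normD _ _) _.
have := ler_normB C (2 * B); rewrite normrM (ger0_norm (_ : 0 <= 2 :> R))//; lra.
Qed.

Lemma st_derive r t : 0 < r -> is_derive t 1 (st r) (hat r t).
Proof.
move=> r0; apply: (@is_derive_quadratic _ _ _ (2 / r ^+ 2)) => [|h]; last exact: st_taylor.
by rewrite divr_ge0// sqr_ge0.
Qed.

Lemma hat_lip r t h : 0 < r -> `|hat r (t + h) - hat r t| <= 4 / r ^+ 2 * `|h|.
Proof.
move=> r0; have r20 : 0 < r ^+ 2 by rewrite exprn_gt0.
have := pos_lip (t + r) h; have := pos_lip t h; have := pos_lip (t - r) h.
rewrite (_ : t - r + h = t + h - r); last by ring.
rewrite (_ : t + r + h = t + h + r); last by ring.
set A := (X in `|X| <= _); set B := (X in _ -> `|X| <= _ -> _); set C := (X in _ -> _ -> `|X| <= _ -> _).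
move=> hA hB hC.
have -> : hat r (t + h) - hat r t = (C - 2 * B + A) / r ^+ 2.
  by rewrite /hat /A /B /C; field; rewrite gt_eqF.
rewrite normrM normfV (ger0_norm (ltW r20)) mulrAC ler_wpM2r ?invr_ge0 ?(ltW r20)//.
apply: le_trans (ler_normD _ _) _.
have := ler_normB C (2 * B); rewrite normrM (ger0_norm (_ : 0 <= 2 :> R))//; lra.
Qed.

Lemma lip_continuous (f : R -> R) C : 0 <= C ->
  (forall t h, `|f (t + h) - f t| <= C * `|h|) -> continuous f.
Proof.
move=> C0 fl t; apply/cvgrPdist_lt => e e0.
have e1 : 0 < e / (C + 1) by rewrite divr_gt0// ltr_wpDl.
near=> s; rewrite distrC; have -> : s = t + (s - t) by ring.
apply: le_lt_trans (fl _ _) _.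
have : `|s - t| < e / (C + 1).
  by rewrite distrC; near: s; apply: (@cvgr_dist_lt _ _ _ (nbhs t) _ id t) => //; exact: cvg_id.
by rewrite ltr_pdivlMr ?ltr_wpDl//; have := normr_ge0 (s - t); lra.
Unshelve. all: by end_near. Qed.

Lemma st_ge1 r t : 0 < r -> r <= t -> st r t = 1.
Proof.
move=> r0 rt; rewrite /st !posE !ifT; [field; by rewrite gt_eqF|lra..].
Qed.

Lemma st_le0 r t : 0 < r -> t <= - r -> st r t = 0.
Proof.
move=> r0 rt; have e s : s <= 0 -> pos s = 0 by move=> s0; rewrite /pos max_r.
by rewrite /st !e ?expr0n/= ?mulr0 ?subr0 ?addr0 ?mul0r//; lra.
Qed.

Lemma hat_ge0 r t : 0 < r -> 0 <= hat r t.
Proof.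
move=> r0; rewrite divr_ge0 ?sqr_ge0// !posE.
by case: (leP 0 (t + r)) => a; case: (leP 0 t) => b; case: (leP 0 (t - r)) => c; lra.
Qed.

Lemma hat_le r t : 0 < r -> hat r t <= r^-1.
Proof.
move=> r0; rewrite /hat ler_pdivrMr ?exprn_gt0// expr2 mulrA mulVf ?gt_eqF// mul1r !posE.
by case: (leP 0 (t + r)) => a; case: (leP 0 t) => b; case: (leP 0 (t - r)) => c; lra.
Qed.

Lemma hat_out r t : 0 < r -> r <= `|t| -> hat r t = 0.
Proof.
move=> r0; rewrite ler_normr /hat => /orP[h|h].
  rewrite !posE !ifT; [|lra..].
  by rewrite (_ : t + r - 2 * t + (t - r) = 0) ?mul0r//; ring.
have e s : s <= 0 -> pos s = 0 by move=> s0; rewrite /pos max_r.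
by rewrite !e ?mulr0 ?subr0 ?addr0 ?mul0r//; lra.
Qed.

Lemma st_mono r s t : 0 < r -> s <= t -> st r s <= st r t.
Proof.
move=> r0 st'; have := st_derive; move=> D.
apply: (@ger0_derive1_le_cc _ (st r) s t) => //.
- by move=> x _; have [] := D r x r0.
- by move=> x _; rewrite derive1E; have [_ ->] := D r x r0; exact: hat_ge0.
- apply: continuous_subspaceT => x.
  apply/differentiable_continuous/derivable1_diffP; by have [] := D r x r0.
- by rewrite in_itv/= lexx.
- by rewrite in_itv/= lexx andbT.
Qed.

Lemma st_01 r t : 0 < r -> 0 <= st r t <= 1.
Proof.
move=> r0; apply/andP; split.
  rewrite -(@st_le0 r (Num.min t (- r))) ?ge_min ?lexx ?orbT//.
  by apply: st_mono => //; rewrite ge_min lexx.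
rewrite -(@st_ge1 r (Num.max t r)) ?le_max ?lexx ?orbT//.
by apply: st_mono => //; rewrite le_max lexx.
Qed.

End splines.

(** * Pairings with scalar weights *)

Section pairing.
Context {R : realType} {H : completeNormedModType R[i]}.
Variable dot : {dot H for Num.conj}.
Hypothesis norm_dot : forall x : H, `|x| ^+ 2 = dot x x.
Local Notation ip := (rdot dot).
Local Notation mu := (@lebesgue_measure R).
Local Notation RR := (measurableTypeR R).
Implicit Types (z w g : R -> H) (phi psi : R -> R) (y : H).

(** Testing with scalar weights in fixed directions reduces weak derivatives to
    integrals of real functions. *)
Definition pairing phi z y : R := \int[mu]_(x in I01) (phi x * ip (z x) y).

Lemma pairing_ae phi z w y : ae (fun x => I01 x -> z x = w x) ->
  pairing phi z y = pairing phi w y.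
Proof. by move=> h; apply: Rintegral_null; apply: (aeS _ h) => x e Ix; rewrite e. Qed.

Lemma indic_integrable (a b : R) :
  mu.-integrable I01 (EFin \o (\1_(`[a, b]%classic) : R -> R)).
Proof.
apply: (le_integrable01 _ _ (integrable_cst01 1)).
  by apply: measurable_indic; exact: measurable_itv.
by move=> x _; rewrite indicE; case: (_ \in _); rewrite ?normr1 ?normr0.
Qed.

Lemma indic_Rintegral (a b : R) : a <= b ->
  \int[mu]_(x in I01) (\1_(`[a, b]%classic) x : R) <= b - a.
Proof.
move=> ab; rewrite -lee_fin /Rintegral fineK; last first.
  exact: (integrable_fin_num mI01 (indic_integrable a b)).
rewrite (integral_indic mu mI01); last exact: measurable_itv.
apply: (@le_trans _ _ (mu `[a, b]%classic)).
  apply: le_measure; rewrite ?inE; [|exact: measurable_itv|exact: subIsetl].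
  by apply: measurableI; [exact: measurable_itv|exact: mI01].
by rewrite lebesgue_measure_itv/= lte_fin; case: ltP => // ab'; rewrite lee_fin subr_ge0.
Qed.

Lemma pairing_pointwise phi z y (a b M l : R) x : 0 <= M -> 0 < l ->
  `|phi x| <= M * \1_(`[a, b]%classic) x ->
  `|phi x * ip (z x) y| <=
    M * nm y * l / 2 * sq z x + M * nm y / (2 * l) * \1_(`[a, b]%classic) x.
Proof.
move=> M0 l0 hphi; rewrite normrM; have := ip_abs norm_dot (z x) y.
have nz := nm_ge0 (z x); have ny := nm_ge0 y; have pa := normr_ge0 (phi x).
set i := `|ip _ _| => hi.
move: hphi; rewrite indicE; case: (_ \in _) => /=; rewrite ?mulr1 ?mulr0 => hphi.
  have h1 : `|phi x| * i <= M * (nm (z x) * nm y) by apply: ler_pM => //; exact: normr_ge0.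
  apply: le_trans h1 _; rewrite /sq.
  have -> : M * nm y * l / 2 * nm (z x) ^+ 2 + M * nm y / (2 * l) =
      M * nm y * (l / 2 * nm (z x) ^+ 2 + (2 * l)^-1) by field; rewrite gt_eqF.
  rewrite (mulrC (nm (z x))) mulrA ler_wpM2l ?mulr_ge0//.
  have e : (l / 2 * nm (z x) ^+ 2 + (2 * l)^-1) - nm (z x) = (l * nm (z x) - 1) ^+ 2 / (2 * l).
    by field; rewrite gt_eqF.
  by rewrite -subr_ge0 e divr_ge0 ?sqr_ge0// mulr_ge0// ltW.
have -> : `|phi x| = 0 by apply/eqP; rewrite eq_le hphi pa.
by rewrite mul0r ?mulr0 addr0 !mulr_ge0 ?sq_ge0// ltW.
Qed.

Lemma pairing_measurable phi z y : measurable_fun (I01 : set RR) phi -> smeas z ->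
  measurable_fun (I01 : set RR) (fun x => phi x * ip (z x) y).
Proof.
move=> mphi mz; apply: measurable_funM => //.
exact: (measurable_funS measurableT (@subsetT _ _) (smeas_ip norm_dot y mz)).
Qed.

Lemma pairing_integrable phi z y (M : R) : measurable_fun (I01 : set RR) phi ->
  (forall x, I01 x -> `|phi x| <= M) -> smeas z -> mu.-integrable I01 (EFin \o sq z) ->
  mu.-integrable I01 (EFin \o (fun x => phi x * ip (z x) y)).
Proof.
move=> mphi hphi mz iz.
pose M' := Num.max M 0.
apply: (le_integrable01 (pairing_measurable y mphi mz) _
  (integrable_lin01 (M' * nm y * 1 / 2) (M' * nm y / (2 * 1)) iz (indic_integrable 0 1))).
move=> x Ix; apply: pairing_pointwise; rewrite ?le_max ?lexx ?orbT//.
rewrite indicE mem_set ?mulr1.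
  by apply: le_trans (hphi x Ix) _; rewrite /M' le_max lexx.
by move: Ix; rewrite /I01 /= !in_itv/= => /andP[? ?]; rewrite !ltW.
Qed.

(** Young's inequality in integrated form; [b - a] is the length of an interval
    carrying the weight. *)
Lemma pairing_bound phi z y (a b M l : R) : measurable_fun (I01 : set RR) phi ->
  a <= b -> 0 <= M -> 0 < l ->
  (forall x, I01 x -> `|phi x| <= M * \1_(`[a, b]%classic) x) -> L2_01 z ->
  `|pairing phi z y| <= M * nm y * (l / 2 * q2 z + (b - a) / (2 * l)).
Proof.
move=> mphi ab M0 l0 hphi /L2_rep[z' [mz iz ez]].
rewrite -(pairing_ae phi y ez) -(q2_ae ez).
have Ip : mu.-integrable I01 (EFin \o (fun x => phi x * ip (z' x) y)).
  apply: (@pairing_integrable _ _ _ M) => // x Ix; apply: le_trans (hphi x Ix) _.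
  by rewrite indicE; case: (_ \in _); rewrite ?mulr1 ?mulr0.
apply: le_trans (le_normr_Rintegral mI01 Ip) _.
pose c1 := M * nm y * l / 2; pose c2 := M * nm y / (2 * l).
have Ib := integrable_lin01 c1 c2 iz (indic_integrable a b).
apply: (@le_trans _ _ (\int[mu]_(x in I01) (c1 * sq z' x + c2 * \1_(`[a, b]%classic) x))).
  apply: (le_Rintegral mI01) => //.
    exact: (integrable_norm Ip).
  move=> x Ix; apply: pairing_pointwise => //; exact: hphi.
rewrite Rintegral_lin01//; last exact: indic_integrable.
have c20 : 0 <= c2 by rewrite /c2 divr_ge0 ?mulr_ge0 ?nm_ge0// ltW.
have -> : M * nm y * (l / 2 * q2 z' + (b - a) / (2 * l)) = c1 * q2 z' + c2 * (b - a).
  by rewrite /c1 /c2; field; rewrite gt_eqF.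
rewrite lerD2l ler_wpM2l//; exact: indic_Rintegral.
Qed.

Lemma pairing_lin phi z w y (k : R) (M : R) : measurable_fun (I01 : set RR) phi ->
  (forall x, I01 x -> `|phi x| <= M) -> L2_01 z -> L2_01 w ->
  pairing phi (fun x => k%:C *: z x + w x) y = k * pairing phi z y + pairing phi w y.
Proof.
move=> mphi hphi /L2_rep[z' [mz iz ez]] /L2_rep[w' [mw iw ew]].
rewrite -(pairing_ae phi y ez) -(pairing_ae phi y ew).
rewrite (@pairing_ae _ _ (fun x => k%:C *: z' x + w' x)); last first.
  by apply: (aeS _ (aeI ez ew)) => x [e1 e2] Ix; rewrite e1// e2.
rewrite -[X in _ = _ + X]mul1r -Rintegral_lin01.
- apply: eq_Rintegral => x _; rewrite ipDl ipZl; ring.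
- exact: pairing_integrable hphi mz iz.
- exact: pairing_integrable hphi mw iw.
Qed.

Lemma pairing_weight_lin phi psi z y (a b M : R) :
  measurable_fun (I01 : set RR) phi -> measurable_fun (I01 : set RR) psi ->
  (forall x, I01 x -> `|phi x| <= M) -> (forall x, I01 x -> `|psi x| <= M) -> L2_01 z ->
  pairing (fun x => a * phi x + b * psi x) z y = a * pairing phi z y + b * pairing psi z y.
Proof.
move=> mphi mpsi hphi hpsi /L2_rep[z' [mz iz ez]].
rewrite -!(pairing_ae _ y ez) -Rintegral_lin01.
- apply: eq_Rintegral => x _; ring.
- exact: pairing_integrable hphi mz iz.
- exact: pairing_integrable hpsi mz iz.
Qed.

Lemma weak_pairing z g phi y : weak_derivative dot z g -> test_fun phi ->
  pairing (derive1 phi) z y = - pairing phi g y.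
Proof.
move=> zg /zg => /(_ y) /(congr1 (@complex.Re R)); rewrite ReN /= => h.
have re (f : R -> R) (v : R -> H) : pairing f v y =
    \int[mu]_(x in I01) complex.Re ((f x)%:C * dot (v x) y).
  by apply: eq_Rintegral => x _; rewrite ReZ.
by rewrite !re.
Qed.

End pairing.

(** * Averages at Lebesgue points *)

Section sobolev.
Context {R : realType} {H : completeNormedModType R[i]}.
Variable dot : {dot H for Num.conj}.
Hypothesis norm_dot : forall x : H, `|x| ^+ 2 = dot x x.
Local Notation ip := (rdot dot).
Local Notation mu := (@lebesgue_measure R).
Local Notation RR := (measurableTypeR R).
Local Notation J := (pairing dot).
Implicit Types (z w g : R -> H) (phi psi : R -> R) (y : H).

Lemma st_shift_derive (r c t : R) : 0 < r -> is_derive t 1 (fun t => st r (t - c)) (hat r (t - c)).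
Proof.
move=> r0; apply: (@is_derive_quadratic _ _ _ _ (2 / r ^+ 2)).
  by rewrite divr_ge0// sqr_ge0.
by move=> h; rewrite (addrAC t h); exact: st_taylor.
Qed.

Lemma hat_shift_continuous (r c : R) : 0 < r -> continuous (fun t => hat r (t - c)).
Proof.
move=> r0; apply: (@lip_continuous _ _ (4 / r ^+ 2)).
  by rewrite divr_ge0// sqr_ge0.
by move=> t h; rewrite (addrAC t h); exact: hat_lip.
Qed.

Lemma hat_shift_measurable (r c : R) : 0 < r ->
  measurable_fun (I01 : set RR) (fun t => hat r (t - c)).
Proof.
move=> r0; apply: (measurable_funS measurableT (@subsetT _ _)).
exact: continuous_measurable_fun (hat_shift_continuous r0).
Qed.

Lemma hat_bound (r t : R) : 0 < r -> `|hat r t| <= r^-1.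
Proof. by move=> r0; rewrite ger0_norm ?hat_ge0// hat_le. Qed.

(** The kernel is the derivative of a step of height one. *)
Lemma hat_mass (r c : R) : 0 < r -> 0 < c - r -> c + r < 1 ->
  \int[mu]_(t in I01) hat r (t - c) = 1.
Proof.
move=> r0 c0 c1.
have e : (\int[mu]_(t in `[0%R, 1%R]) (hat r (t - c))%:E = (st r (1 - c))%:E - (st r (0 - c))%:E)%E.
  have cst x : {for x, continuous (fun t => st r (t - c))}.
    by apply/differentiable_continuous/derivable1_diffP; have [] := st_shift_derive c x r0.
  apply: (@continuous_FTC2 _ _ (fun t => st r (t - c))) => //.
  - apply: continuous_subspaceT; exact: hat_shift_continuous.
  - split.
    + by move=> x _; have [] := st_shift_derive c x r0.
    + by apply: cvg_at_right_filter; exact: cst.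
    + by apply: cvg_at_left_filter; exact: cst.
  - by move=> x _; rewrite derive1E; have [_ ->] := st_shift_derive c x r0.
rewrite integral_itv_bndoo in e; last first.
  by apply/measurable_EFinP; exact: hat_shift_measurable.
transitivity (fine ((st r (1 - c))%:E - (st r (0 - c))%:E)%E); first by congr fine; exact: e.
by rewrite st_ge1 ?st_le0 ?sube0//; lra.
Qed.

(** On its support the triangular kernel is at most twice the uniform density, so
    its averages are controlled by those that define Lebesgue points. *)
Lemma mollify_lebesgue_pt z y x : smeas z -> mu.-integrable I01 (EFin \o sq z) -> I01 x ->
  lebesgue_pt (patch (fun=> 0) I01 (fun t => ip (z t) y)) x ->
  forall e : R, 0 < e -> exists2 d, 0 < d & forall r, 0 < r -> r < d ->
    `|J (fun t => hat r (t - x)) z y - ip (z x) y| <= e.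
Proof.
move=> mz iz Ix lx e e0; set f := patch _ _ _ in lx.
have fE t : I01 t -> f t = ip (z t) y by move=> It; rewrite /f /patch mem_set.
have e2 : 0 < e / 2 by rewrite divr_gt0.
have [x0 x1] : 0 < x /\ x < 1 by move: Ix; rewrite /I01/= in_itv/= => /andP[].
have [d1 d10 hd1] : exists2 d, 0 < d & forall r, 0 < r -> r < d -> (davg f x r < (e / 2)%:E)%E.
  have /fine_cvgP[fn /cvgrPdist_lt/(_ _ e2) sm] := lx.
  have [d /= d0 hd] := filterI fn sm.
  exists d => // r r0 rd; have [|fr] := hd r _ r0.
    by rewrite /ball_/= sub0r normrN gtr0_norm.
  rewrite /= sub0r normrN => /(le_lt_trans (ler_norm _)) h.
  by rewrite -(fineK fr) lte_fin.
pose d := Num.min d1 (Num.min x (1 - x)).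
exists d; first by rewrite !lt_min d10 x0 subr_gt0.
move=> r r0; rewrite !lt_min => /and3P[rd1 rx rx1].
pose B : set R := `]x - r, x + r[%classic.
have BI t : B t -> I01 t by rewrite /B /I01 /= !in_itv/= => /andP[h1 h2]; apply/andP; split; lra.
have mB : measurable (B : set RR) by exact: measurable_itv.
have ballB : ball x r = B by rewrite /B ball_itv.
have muB : mu B = (2 * r)%:E.
  rewrite /B lebesgue_measure_itv/= lte_fin ifT; last lra.
  by rewrite -EFinB; congr EFin; ring.
have If : mu.-integrable I01 (EFin \o (fun t => hat r (t - x) * ip (z t) y)).
  apply: (pairing_integrable norm_dot y (M := r^-1)) => //; first exact: hat_shift_measurable.
  by move=> t _; exact: hat_bound.
have Ih : mu.-integrable I01 (EFin \o (fun t => hat r (t - x))).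
  apply: (le_integrable01 _ _ (integrable_cst01 r^-1)); first exact: hat_shift_measurable.
  by move=> t _; exact: hat_bound.
pose c := ip (z x) y.
pose G t := 1 * (hat r (t - x) * ip (z t) y) + (- c) * hat r (t - x).
have IG : mu.-integrable I01 (EFin \o G) by exact: integrable_lin01.
have eG : J (fun t => hat r (t - x)) z y - c = \int[mu]_(t in I01) G t.
  by rewrite Rintegral_lin01// hat_mass ?mul1r ?mulr1//; lra.
have GE t : G t = hat r (t - x) * (ip (z t) y - c) by rewrite /G; ring.
rewrite eG; apply: le_trans (le_normr_Rintegral mI01 IG) _.
rewrite -lee_fin /Rintegral fineK; last first.
  exact: (integrable_fin_num mI01 (integrable_norm IG)).
have -> : (\int[mu]_(t in I01) `|G t|%:E = \int[mu]_(t in B) `|G t|%:E)%E.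
  rewrite integral_mkcond [RHS]integral_mkcond; apply: eq_integral => t _.
  rewrite /patch; case: (boolP (t \in B)); rewrite ?notin_setE ?inE => Bt.
    by rewrite mem_set//; exact: BI.
  case: ifP => // _; rewrite GE hat_out ?mul0r ?normr0//.
  rewrite leNgt; apply/negP => h; apply: Bt; rewrite /B/= in_itv/=.
  by move: h; rewrite ltr_norml => /andP[h1 h2]; apply/andP; split; lra.
have mfB : measurable_fun (B : set RR) (fun t => ip (z t) y).
  exact: (measurable_funS measurableT (@subsetT _ _) (smeas_ip norm_dot y mz)).
have mD : measurable_fun (B : set RR) (fun t => `|ip (z t) y - c|).
  apply: (measurableT_comp (@normr_measurable R setT)).
  by apply: measurable_funB => //; exact: measurable_cst.
have := hd1 r r0 rd1; rewrite /davg /iavg ballB muB.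
have -> : (\int[mu]_(t in B) `|((center (f x) \o f) t)%:E| = \int[mu]_(t in B) `|ip (z t) y - c|%:E)%E.
  apply: eq_integral => t; rewrite inE => Bt.
  by rewrite abse_EFin /= !fE//; exact: BI.
rewrite inver gt_eqF ?mulr_gt0// => hav.
apply: (@le_trans _ _ (\int[mu]_(t in B) ((r^-1)%R%:E * `|ip (z t) y - c|%:E))%E).
  apply: (ge0_le_integral mu mB).
  - by move=> t _; rewrite lee_fin.
  - apply/measurable_EFinP; apply: (measurable_funS mI01 BI).
    apply: (measurableT_comp (@normr_measurable R setT)).
    by have /integrableP[/measurable_EFinP] := IG.
  - by apply/measurable_EFinP; apply: measurable_funM => //; exact: measurable_cst.
  - move=> t _; rewrite -EFinM lee_fin GE normrM ler_wpM2r// hat_bound//.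
rewrite (ge0_integralZl_EFin mu mB); last 3 first.
- by move=> t _; rewrite lee_fin.
- by apply/measurable_EFinP.
- by rewrite invr_ge0 ltW.
move: hav; set K := (\int[mu]_(t in B) _)%E.
have K0 : (0 <= K)%E by apply: integral_ge0 => t _; rewrite lee_fin.
move: K0; case: K => [k| |] //=.
- rewrite -!EFinM lte_fin !lee_fin => k0; rewrite mulrC ltr_pdivrMr ?mulr_gt0// => h.
  rewrite mulrC ler_pdivrMr//; lra.
- by move=> _; rewrite gt0_muley ?lte_fin ?invr_gt0 ?mulr_gt0//.
Qed.

End sobolev.

(** * Continuous representatives *)

Section continuous_representative.
Context {R : realType} {H : completeNormedModType R[i]}.
Ltac vec := lmod (R[i] : comPzRingType) (H : Type).
Variable dot : {dot H for Num.conj}.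
Hypothesis norm_dot : forall x : H, `|x| ^+ 2 = dot x x.
Local Notation ip := (rdot dot).
Local Notation mu := (@lebesgue_measure R).
Local Notation RR := (measurableTypeR R).
Local Notation J := (pairing dot).
Implicit Types (z w g : R -> H) (phi psi : R -> R) (y : H).

Lemma step_test_fun (x x' r : R) : 0 < r -> x <= x' -> 0 < x - r -> x' + r < 1 ->
  test_fun (fun t => st r (t - x) - st r (t - x')) /\
  derive1 (fun t => st r (t - x) - st r (t - x')) = (fun t => hat r (t - x) - hat r (t - x')).
Proof.
move=> r0 xx' h0 h1.
have D (t : R) : is_derive t 1 (fun t : R => st r (t - x) - st r (t - x')) (hat r (t - x) - hat r (t - x')).
  by have d1 := st_shift_derive x t r0; have d2 := st_shift_derive x' t r0; exact: is_deriveB.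
have e : derive1 (fun t => st r (t - x) - st r (t - x')) = (fun t => hat r (t - x) - hat r (t - x')).
  by apply/funext => t; rewrite derive1E; have [_ ->] := D t.
split=> //; split.
- by move=> t; have [] := D t.
- by rewrite e => t; apply: cvgB; exact: hat_shift_continuous.
- exists (x - r), (x' + r); split=> // t; rewrite negb_and -!ltNge => /orP[h|h].
    by rewrite !st_le0 ?subrr//; lra.
  by rewrite !st_ge1 ?subrr//; lra.
Qed.

(** For a weak derivative [g], testing with the difference of two steps bounds
    the increment of the triangular averages. *)
Lemma average_increment z g y (x x' r l : R) : L2_01 z -> L2_01 g -> weak_derivative dot z g ->
  0 < r -> x <= x' -> 0 < x - r -> x' + r < 1 -> 0 < l ->
  J (fun t => hat r (t - x)) z y - J (fun t => hat r (t - x')) z y <=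
  nm y * (l / 2 * q2 g + (x' - x + 2 * r) / (2 * l)).
Proof.
move=> Lz Lg zg r0 xx' h0 h1 l0.
have [tf e] := step_test_fun r0 xx' h0 h1.
have := weak_pairing y zg tf; rewrite e.
have -> : J (fun t => hat r (t - x) - hat r (t - x')) z y =
    1 * J (fun t => hat r (t - x)) z y + (-1) * J (fun t => hat r (t - x')) z y.
  rewrite -(pairing_weight_lin norm_dot y (M := r^-1) 1 (-1)) //;
    try (exact: hat_shift_measurable); try (by move=> t _; exact: hat_bound).
  by congr (pairing _ _ _ _); apply/funext => t; ring.
rewrite mul1r mulN1r => ->.
have mst : measurable_fun (I01 : set RR) (fun t => st r (t - x) - st r (t - x')).
  apply: (measurable_funS measurableT (@subsetT _ _)).
  apply: continuous_measurable_fun => t.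
  by apply/differentiable_continuous/derivable1_diffP; case: tf.
have := @pairing_bound R H dot norm_dot _ g y (x - r) (x' + r) 1 l mst.
have -> : x' + r - (x - r) = x' - x + 2 * r by ring.
rewrite mul1r => B; apply: le_trans (ler_norm _) _; rewrite normrN; apply: B => //; first lra.
move=> t _; rewrite mul1r.
have [a1 a2] := andP (st_01 (t - x) r0); have [b1 b2] := andP (st_01 (t - x') r0).
have m : st r (t - x') <= st r (t - x) by apply: st_mono => //; lra.
rewrite indicE; case: (boolP (t \in _)) => /=; rewrite ?notin_setE ?inE/= in_itv/=.
  by move=> _; rewrite ger0_norm; lra.
move=> /negP; rewrite negb_and -!ltNge => /orP[h|h].
  by rewrite !st_le0 ?subrr ?normr0//; lra.
by rewrite !st_ge1 ?subrr ?normr0//; lra.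
Qed.

(** A norm is determined by countably many directions, the differences of the
    values of the simple maps that approximate [z]: the corresponding sets of
    points that are not Lebesgue points have a null union. *)
Lemma weak_modulus z g : L2_01 z -> L2_01 g -> weak_derivative dot z g ->
  exists z' (G : R -> Prop), [/\ ae (fun x => I01 x -> z' x = z x), ae (fun x => I01 x -> G x) &
    forall x x', I01 x -> I01 x' -> G x -> G x' -> x <= x' -> forall l : R, 0 < l ->
      nm (z' x - z' x') <= l / 2 * q2 g + (x' - x) / (2 * l)].
Proof.
move=> Lz Lg zg; have [z' [mz iz ez]] := L2_rep Lz.
have Lz' : L2_01 z' by apply: (rep_L2 mz iz); exact: ae_true.
have [s hs sz] := mz.
have fin n : exists S : seq H, range (s n) = [set` S].
  by apply/finite_seqP; case: (hs n).
have [S SE] := choice fin.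
pose y n i j := nth 0 (S n) i - nth 0 (S n) j.
pose f v := patch (fun=> 0) I01 (fun t => ip (z' t) v).
exists z', (fun x => forall n i j, lebesgue_pt (f (y n i j)) x); split=> //.
  apply: (@aeS _ (fun x => forall n i j, lebesgue_pt (f (y n i j)) x)) => //.
  apply: ae_all => n; apply: ae_all => i; apply: ae_all => j.
  apply: lebesgue_differentiation.
  apply: integrable_locally_restrict; first exact: mI01.
  have := @pairing_integrable R H dot norm_dot (fun=> 1) z' (y n i j) 1.
  move=> /(_ (measurable_cst _) _ mz iz) h.
  apply: (eq_integrable mI01 _ _ _ (h _)) => [x _|x _]; first by rewrite /= mul1r.
  by rewrite normr1.
move=> x x' Ix Ix' Gx Gx' xx' l l0.
have [x0 x1] : 0 < x /\ x < 1 by move: Ix; rewrite /I01/= in_itv/= => /andP[].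
have [x'0 x'1] : 0 < x' /\ x' < 1 by move: Ix'; rewrite /I01/= in_itv/= => /andP[].
pose Bd : R := l / 2 * q2 g + (x' - x) / (2 * l).
have key n i j : ip (z' x - z' x') (y n i j) <= nm (y n i j) * Bd.
  set v := y n i j; apply/ler_addgt0Pr => e e0.
  have e3 : 0 < e / 3 by rewrite divr_gt0.
  have [d1 d10 hd1] := mollify_lebesgue_pt norm_dot mz iz Ix (Gx n i j) e3.
  have [d2 d20 hd2] := mollify_lebesgue_pt norm_dot mz iz Ix' (Gx' n i j) e3.
  pose e4 := e * l / (3 * (nm v + 1)).
  have v1 : 0 < nm v + 1 by rewrite ltr_wpDl// nm_ge0.
  have e40 : 0 < e4 by rewrite divr_gt0 ?mulr_gt0.
  pose d := Num.min (Num.min d1 d2) (Num.min e4 (Num.min x (1 - x'))).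
  have d0 : 0 < d by rewrite !lt_min d10 d20 e40 x0 subr_gt0.
  pose r := d / 2; have r0 : 0 < r by rewrite divr_gt0.
  have : r < d by rewrite /r; lra.
  rewrite !lt_min => /and3P[/andP[r1 r2] r3 /andP[r4 r5]].
  have A : J (fun t => hat r (t - x)) z v - J (fun t => hat r (t - x')) z v <=
      nm v * (l / 2 * q2 g + (x' - x + 2 * r) / (2 * l)).
    by apply: average_increment => //; lra.
  have h1 := hd1 r r0 r1; have h2 := hd2 r r0 r2.
  rewrite (pairing_ae dot _ v ez) in h1; rewrite (pairing_ae dot _ v ez) in h2.
  have h3 : nm v * (r / l) <= e / 3.
    rewrite mulrA ler_pdivrMr//; apply: (@le_trans _ _ ((nm v + 1) * r)).
      by rewrite ler_wpM2r ?ltW//; lra.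
    apply: (@le_trans _ _ ((nm v + 1) * e4)); first by rewrite ler_wpM2l ?ltW.
    by rewrite le_eqVlt; apply/orP; left; apply/eqP; rewrite /e4; field; rewrite gt_eqF.
  have eB : nm v * (l / 2 * q2 g + (x' - x + 2 * r) / (2 * l)) = nm v * Bd + nm v * (r / l).
    by rewrite /Bd; field; rewrite gt_eqF.
  rewrite ipBl; move: h1 h2; rewrite !ler_norml => /andP[h11 h12] /andP[h21 h22].
  by rewrite eB in A; lra.
pose d := z' x - z' x'; pose v n := s n x - s n x'.
have vd : v n @[n --> \oo] --> d by apply: cvgB; exact: sz.
have le n : ip (v n) d <= nm (v n) * Bd.
  have idx t : exists i, nth 0 (S n) i = s n t.
    have : range (s n) (s n t) by exists t.
    by rewrite SE => /= /(nthP 0)[i _ <-]; exists i.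
  have [i ei] := idx x; have [j ej] := idx x'.
  by have := key n i j; rewrite /y ei ej ipC.
have c1 : ip (v n) d @[n --> \oo] --> ip d d by exact: ip_cvg.
have c2 : nm (v n) * Bd @[n --> \oo] --> nm d * Bd.
  by apply: cvgM; [exact: nm_cvg|exact: cvg_cst].
have := ler_cvg_to c1 c2 (nearW _ le).
rewrite -nm2// -/d => le2.
have := nm_ge0 d; rewrite le_eqVlt => /orP[/eqP d0|d0].
  rewrite -d0; apply: addr_ge0.
    by apply: mulr_ge0 (q2_ge0 _); rewrite divr_ge0// ltW.
  by rewrite divr_ge0 ?subr_ge0// mulr_ge0// ltW.
by rewrite -(ler_pM2l d0) -expr2; exact: le2.
Qed.

(** Continuity on the closed unit interval, spelled out for use with vectors of a
    complex normed space and real tolerances. *)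
Definition cont01 z := forall t : R, 0 <= t <= 1 -> forall e : R, 0 < e ->
  exists2 d : R, 0 < d & forall s : R, 0 <= s <= 1 -> `|s - t| < d -> nm (z s - z t) < e.

Lemma within_cont01 z : {within `[0%R : R, 1%R : R], continuous z} <-> cont01 z.
Proof.
split.
  move=> /subspace_continuousP h t t01 e e0.
  have it : `[0, 1]%classic t by rewrite /= in_itv.
  have ec : 0 < e%:C :> R[i] by rewrite ltcR.
  have /cvgrPdist_lt/(_ _ ec) := h t it; rewrite near_withinE => -[d /= d0 hd].
  exists d => // s s01 st; have := hd s; rewrite /ball_ /= distrC => /(_ st).
  by rewrite in_itv/= => /(_ s01); rewrite nmE nmC ltcR.
move=> h; apply/subspace_continuousP => t; rewrite /= in_itv/= => t01.
apply/cvgrPdist_lt => e; rewrite ltcE/= => /andP[/eqP ie e0].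
have [d d0 hd] := h t t01 _ e0; rewrite near_withinE.
exists d => //= s; rewrite /ball_ /= distrC => st; rewrite in_itv/= => s01.
by rewrite nmE nmC ltcE /= ie eqxx hd.
Qed.

Lemma ae_dense (P : R -> Prop) : ae (fun x => I01 x -> P x) ->
  forall (t : R), 0 <= t <= 1 -> forall e : R, 0 < e -> exists x, [/\ I01 x, P x & `|x - t| < e].
Proof.
move=> [N [mN N0 sN]] t /andP[t0 t1] e e0; apply: contrapT => no.
pose a := Num.max 0 (t - e); pose b := Num.min 1 (t + e).
have [a0 at1] : 0 <= a /\ t - e <= a by rewrite /a !le_max !lexx orbT.
have [b1 bt] : b <= 1 /\ b <= t + e by rewrite /b !ge_min !lexx orbT.
have ab : a < b by rewrite /a /b lt_min !gt_max; apply/andP; split; lra.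
have sub : `]a, b[%classic `<=` N.
  move=> x; rewrite /= in_itv/= => /andP[ax xb]; apply: sN => /= h; apply: no; exists x.
  have Ix : I01 x by rewrite /I01/= in_itv/=; apply/andP; split; lra.
  by split=> //; [exact: h|rewrite ltr_norml; apply/andP; split; lra].
have : (mu `]a, b[%classic <= mu N)%E.
  by apply: le_measure; rewrite ?inE//; exact: measurable_itv.
by rewrite N0 lebesgue_measure_itv/= lte_fin ab -EFinB lee_fin subr_le0 leNgt ab.
Qed.

(** The range space is complete, hence the values at good points that tend to [t]
    have a limit; good points are dense. *)
Lemma cont01_extension z (G : R -> Prop) : ae (fun x => I01 x -> G x) ->
  (forall e : R, 0 < e -> exists2 d : R, 0 < d & forall x x', I01 x -> I01 x' -> G x -> G x' ->
     `|x - x'| < d -> nm (z x - z x') <= e) ->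
  exists zc, cont01 zc /\ forall x, I01 x -> G x -> zc x = z x.
Proof.
move=> aG uc; have dG := ae_dense aG.
have lim (t : R) : exists l : H, 0 <= t <= 1 -> forall e : R, 0 < e -> exists2 d : R, 0 < d &
    forall x, I01 x -> G x -> `|x - t| < d -> nm (l - z x) <= e.
  have [t01|] := boolP (0 <= t <= 1); last by exists 0.
  have seq (n : nat) : exists x, [/\ I01 x, G x & `|x - t| < n.+1%:R^-1].
    by apply: dG => //; rewrite invr_gt0.
  have [u hu] := choice seq.
  have small (d : R) : 0 < d -> exists N, forall n, (N <= n)%N -> `|u n - t| < d.
    move=> d0; exists (Num.truncn d^-1) => n Nn; have [_ _] := hu n; move/lt_trans; apply.
    rewrite invf_plt ?posrE//; apply: lt_le_trans (truncnS_gt _) _.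
    by rewrite ler_nat ltnS.
  have [l hl] : exists l, forall e : R, 0 < e -> exists N, forall n, (N <= n)%N -> nm (z (u n) - l) < e.
    apply: nm_complete => e e0; have e2 : 0 < e / 2 by rewrite divr_gt0.
    have [d d0 hd] := uc _ e2; have d2 : 0 < d / 2 by rewrite divr_gt0.
    have [N hN] := small _ d2; exists N => n m Nn Nm.
    have [I1 G1 _] := hu n; have [I2 G2 _] := hu m.
    apply: (@le_lt_trans _ _ (e / 2)); last lra.
    apply: hd => //; have := hN n Nn; have := hN m Nm.
    have := ler_distD t (u n) (u m); rewrite (distrC t); lra.
  exists l => _ e e0; have e2 : 0 < e / 2 by rewrite divr_gt0.
  have [d d0 hd] := uc _ e2; have d2 : 0 < d / 2 by rewrite divr_gt0.
  exists (d / 2) => // x Ix Gx xt.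
  have [N1 hN1] := small _ d2; have [N2 hN2] := hl _ e2.
  pose n := maxn N1 N2; have := hN1 n (leq_maxl _ _); have := hN2 n (leq_maxr _ _).
  have [I1 G1 _] := hu n; rewrite nmC => h1 h2.
  have h3 : nm (z (u n) - z x) <= e / 2.
    by apply: hd => //; have := ler_distD t (u n) x; rewrite (distrC t); lra.
  have -> : l - z x = (l - z (u n)) + (z (u n) - z x) by vec.
  by have := nmD (l - z (u n)) (z (u n) - z x); lra.
have [zc hzc] := choice lim.
exists zc; split=> [t t01 e e0|x Ix Gx]; last first.
  have x01 : 0 <= x <= 1 by move: Ix; rewrite /I01/= in_itv/= => /andP[? ?]; rewrite !ltW.
  apply/eqP; rewrite -subr_eq0; apply/eqP; apply: eq_of_nm_small => e e0.
  have [d d0 hd] := hzc x x01 _ e0; apply: hd => //.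
  by rewrite subrr normr0.
have e3 : 0 < e / 3 by rewrite divr_gt0.
have [d d0 hd] := hzc t t01 _ e3; exists (d / 2) => [|s s01 st]; first by rewrite divr_gt0.
have [d' d'0 hd'] := hzc s s01 _ e3.
have dd : 0 < Num.min (d / 2) d' by rewrite lt_min divr_gt0//.
have [x [Ix Gx]] := dG s s01 _ dd; rewrite lt_min => /andP[xd xd'].
have h1 := hd' x Ix Gx xd'.
have h2 : nm (z x - zc t) <= e / 3.
  by rewrite nmC; apply: hd => //; have := ler_distD s x t; lra.
have -> : zc s - zc t = (zc s - z x) + (z x - zc t) by vec.
by have := nmD (zc s - z x) (z x - zc t); lra.
Qed.

(** The weight [l] is still free in the modulus; taking it proportional to the
    tolerance makes [z] uniformly continuous on a set of full measure. *)
Lemma continuous_rep_exists z : H1_01 dot z ->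
  exists zc, cont01 zc /\ ae (fun x => I01 x -> zc x = z x).
Proof.
move=> [Lz [g [Lg zg]]].
have [z' [G [ez aG hG]]] := weak_modulus Lz Lg zg.
have [|zc [cz ezc]] := cont01_extension (z := z') aG.
  move=> e e0; have q0 := q2_ge0 g.
  have p0 : 0 < q2 g + 1 by rewrite ltr_wpDl.
  pose l := e / (q2 g + 1); have l0 : 0 < l by rewrite divr_gt0.
  have step x x' : I01 x -> I01 x' -> G x -> G x' -> x <= x' -> `|x - x'| < l * e ->
      nm (z' x - z' x') <= e.
    move=> Ix Ix' Gx Gx' xx'; rewrite ler0_norm ?subr_le0// opprB => h.
    apply: le_trans (hG _ _ Ix Ix' Gx Gx' xx' l l0) _.
    have h1 : l * q2 g <= e.
      by rewrite /l mulrAC ler_pdivrMr// ler_wpM2l ?ltW//; lra.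
    have h2 : (x' - x) / (2 * l) <= e / 2.
      rewrite ler_pdivrMr; last lra.
      have -> : e / 2 * (2 * l) = l * e by field.
      exact: ltW.
    have -> : l / 2 * q2 g = l * q2 g / 2 by field.
    by apply: (@le_trans _ _ (e / 2 + e / 2)); [rewrite lerD// ler_wpM2r// invr_ge0|lra].
  exists (l * e) => [|x x' Ix Ix' Gx Gx' h]; first by rewrite mulr_gt0.
  have [xx'|/ltW xx'] := leP x x'; first exact: step.
  by rewrite nmC; apply: step => //; rewrite distrC.
exists zc; split=> //; apply: (aeS _ (aeI ez aG)) => x [e1 g1] Ix.
by rewrite ezc ?e1//; exact: g1.
Qed.

Lemma continuous_rep_spec z : H1_01 dot z ->
  cont01 (continuous_rep z) /\ ae (fun x => I01 x -> continuous_rep z x = z x).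
Proof.
move=> /continuous_rep_exists[zc [czc ezc]].
have ii (x : R) : (0 < x < 1) = (x \in `]0, 1[) by rewrite in_itv.
have : [set zc : R -> H | {within `[0%R : R, 1%R : R], continuous zc} /\
    {ae lebesgue_measure, forall x : R, 0 < x < 1 -> zc x = z x}] zc.
  by split; [exact/within_cont01|apply: (aeS _ ezc) => x h; rewrite ii; exact: h].
move=> /(ex_intro _ zc)/(xgetPex (0 : R -> H)) [/within_cont01 c e].
by split=> //; apply: (aeS _ e) => x h Ix; apply: h; rewrite ii.
Qed.

Lemma wderiv_spec z : H1_01 dot z -> L2_01 (wderiv dot z) /\ weak_derivative dot z (wderiv dot z).
Proof. by move=> [_ [g hg]]; exact: (xgetPex (0 : R -> H) (ex_intro _ g hg)). Qed.

End continuous_representative.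

(** * The energy space *)

Section energy_space.
Context {R : realType} {H : completeNormedModType R[i]}.
Ltac vec := lmod (R[i] : comPzRingType) (H : Type).
Variables (dot : {dot H for Num.conj}) (B : uop H) (xi c1 : R).
Hypothesis norm_dot : forall x : H, `|x| ^+ 2 = dot x x.
Hypotheses (B_linear : linear_op B) (B_dense : densely_defined B).
Hypotheses (xi_gt0 : 0 < xi) (c1_gt0 : 0 < c1).
Hypothesis Bs_below : forall v, dom (adjoint dot B) v ->
  c1%:C * `|v| <= `|app (adjoint dot B) v|.
Local Notation ip := (rdot dot).
Local Notation Bs := (adjoint dot B).
Local Notation K := (energy_space dot B).
Local Notation p := (energy_norm dot B xi).
Implicit Types U V : state H.

Definition energy_sq U : R :=
  nm (app Bs U.1.1.1) ^+ 2 + nm U.1.1.2 ^+ 2 + nm U.1.2 ^+ 2 + xi * q2 U.2.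

Lemma energy_spaceP U : K U <-> dom Bs U.1.1.1 /\ L2_01 U.2.
Proof. by case: U => [[[u v] th] z]. Qed.

Lemma energy_sq_ge0 U : 0 <= energy_sq U.
Proof. by rewrite !addr_ge0 ?sqr_ge0 ?mulr_ge0 ?q2_ge0// ltW. Qed.

Lemma energy_normE U : p U = Num.sqrt (energy_sq U).
Proof.
case: U => [[[u v] th] z]; rewrite /energy_norm /energy_dot !ReD ReZ /energy_sq /=.
rewrite !(nm2 norm_dot); congr (Num.sqrt (_ + xi * _)).
by apply: eq_Rintegral => x _; rewrite /sq (nm2 norm_dot).
Qed.

Lemma energy_norm2 U : p U ^+ 2 = energy_sq U.
Proof. by rewrite energy_normE sqr_sqrtr ?energy_sq_ge0. Qed.

Lemma energy_norm_ge0 U : 0 <= p U.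
Proof. by rewrite energy_normE sqrtr_ge0. Qed.

Lemma energy_norm_bounds U :
  [/\ nm (app Bs U.1.1.1) <= p U, nm U.1.1.2 <= p U, nm U.1.2 <= p U &
      xi * q2 U.2 <= p U ^+ 2].
Proof.
have h (x : H) : nm x ^+ 2 <= p U ^+ 2 -> nm x <= p U.
  by rewrite ler_pXn2r// nnegrE ?nm_ge0 ?energy_norm_ge0.
have q0 : 0 <= xi * q2 U.2 by rewrite mulr_ge0 ?q2_ge0// ltW.
have a0 := sqr_ge0 (nm (app Bs U.1.1.1)).
have b0 := sqr_ge0 (nm U.1.1.2); have c0 := sqr_ge0 (nm U.1.2).
by split; try apply: h; rewrite energy_norm2 /energy_sq; lra.
Qed.

Lemma nm_le_Bs v : dom Bs v -> nm v <= nm (app Bs v) / c1.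
Proof.
move=> /Bs_below; rewrite !nmE -rCM lecR => h.
by rewrite ler_pdivlMr// mulrC.
Qed.

Lemma Bs_linear : linear_op Bs. Proof. exact: adjoint_linear. Qed.

Lemma nm_young (s : R) (x y : H) : 0 < s ->
  nm (x + y) ^+ 2 <= (1 + s) * nm x ^+ 2 + (1 + s^-1) * nm y ^+ 2.
Proof. by move=> s0; exact: (sq_young norm_dot (fun=> x) (fun=> y) 0 s0). Qed.

(** Young's inequality, optimized over its weight, is the triangle inequality of a
    Hilbert sum. *)
Lemma young_triangle (a b c : R) : 0 <= a -> 0 <= b -> 0 <= c ->
  (forall s : R, 0 < s -> c ^+ 2 <= (1 + s) * a ^+ 2 + (1 + s^-1) * b ^+ 2) -> c <= a + b.
Proof.
move=> a0 b0 c0 h; apply/ler_addgt0Pr => e e0.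
pose a' := a + e / 2; pose b' := b + e / 2.
have a'0 : 0 < a' by rewrite /a'; lra.
have b'0 : 0 < b' by rewrite /b'; lra.
have -> : a + b + e = a' + b' by rewrite /a' /b'; lra.
have s0 : 0 < b' / a' by rewrite divr_gt0.
apply: sqr_le_inv => //; first exact: addr_gt0.
apply: le_trans (h _ s0) _.
have -> : (a' + b') ^+ 2 = (1 + b' / a') * a' ^+ 2 + (1 + (b' / a')^-1) * b' ^+ 2.
  by field; rewrite !gt_eqF.
have aa : a ^+ 2 <= a' ^+ 2 by rewrite ler_pXn2r// ?nnegrE ?ltW// /a'; lra.
have bb : b ^+ 2 <= b' ^+ 2 by rewrite ler_pXn2r// ?nnegrE ?ltW// /b'; lra.
by apply: lerD; rewrite ler_pM2l// addr_gt0// ?invr_gt0.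
Qed.

Lemma energy_sq_young (s : R) U V : 0 < s -> K U -> K V ->
  energy_sq (U + V) <= (1 + s) * energy_sq U + (1 + s^-1) * energy_sq V.
Proof.
move=> s0 /energy_spaceP[Uu Uz] /energy_spaceP[Vu Vz]; rewrite /energy_sq.
have -> : (U + V).1.1.1 = U.1.1.1 + V.1.1.1 by [].
have -> : (U + V).1.1.2 = U.1.1.2 + V.1.1.2 by [].
have -> : (U + V).1.2 = U.1.2 + V.1.2 by [].
have -> : (U + V).2 = (fun x => U.2 x + V.2 x) by [].
rewrite (linD Bs_linear Uu Vu).2.
have h1 := nm_young (app Bs U.1.1.1) (app Bs V.1.1.1) s0.
have h2 := nm_young U.1.1.2 V.1.1.2 s0.
have h3 := nm_young U.1.2 V.1.2 s0.
have h4 := ler_wpM2l (ltW xi_gt0) (q2_young norm_dot s0 Uz Vz).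
lra.
Qed.

Lemma energy_normD U V : K U -> K V -> p (U + V) <= p U + p V.
Proof.
move=> KU KV; apply: young_triangle; rewrite ?energy_norm_ge0// => s s0.
by rewrite !energy_norm2; exact: energy_sq_young.
Qed.

Lemma energy_space_lin (k : R[i]) U V : K U -> K V -> K (k *: U + V).
Proof.
move=> /energy_spaceP[Uu Uz] /energy_spaceP[Vu Vz]; apply/energy_spaceP; split.
  by have [] := Bs_linear.2 k _ _ Uu Vu.
exact: L2_lin.
Qed.

Lemma energy_normZ (k : R[i]) U : K U -> p (k *: U) = complex.Re `|k| * p U.
Proof.
move=> /energy_spaceP[Uu Uz]; rewrite !energy_normE.
have k0 : 0 <= complex.Re `|k| by rewrite -ler0c RRe_real// ger0_real.
have -> : energy_sq (k *: U) = complex.Re `|k| ^+ 2 * energy_sq U.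
  rewrite /energy_sq.
  have -> : (k *: U).1.1.1 = k *: U.1.1.1 by [].
  have -> : (k *: U).1.1.2 = k *: U.1.1.2 by [].
  have -> : (k *: U).1.2 = k *: U.1.2 by [].
  have -> : (k *: U).2 = (fun x => k *: U.2 x) by [].
  by rewrite (linZ _ Bs_linear Uu).2 !nmZ q2Z// !exprMn; ring.
by rewrite sqrtrM ?sqr_ge0// sqrtr_sqr ger0_norm.
Qed.

Lemma energy_space0 : K 0.
Proof. by apply/energy_spaceP; split; [case: Bs_linear|exact: L2_0]. Qed.

Lemma energy_spaceB U V : K U -> K V ->
  K (U - V) /\ app Bs (U - V).1.1.1 = app Bs U.1.1.1 - app Bs V.1.1.1.
Proof.
move=> KU KV; split.
  by rewrite addrC -scaleN1r; exact: energy_space_lin.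
by move: KU KV => /energy_spaceP[Uu _] /energy_spaceP[Vu _]; rewrite (linB Bs_linear Uu Vu).2.
Qed.

(** Each component converges; the first one together with its image, and the
    adjoint is closed. *)
Lemma energy_complete (u : nat -> state H) : (forall n, K (u n)) ->
  (forall e : R, 0 < e -> exists N, forall n m, (N <= n)%N -> (N <= m)%N -> p (u n - u m) <= e) ->
  exists2 l, K l & forall e : R, 0 < e -> exists N, forall n, (N <= n)%N -> p (u n - l) <= e.
Proof.
move=> Ku cu.
have comp (f : state H -> H) (c : R) : 0 < c ->
    (forall n m, nm (f (u n) - f (u m)) <= c * p (u n - u m)) ->
    exists l, forall e : R, 0 < e -> exists N, forall n, (N <= n)%N -> nm (f (u n) - l) < e.
  move=> cp fu; apply: nm_complete => e e0.
  have e1 : 0 < e / (2 * c) by rewrite divr_gt0 ?mulr_gt0.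
  have [N hN] := cu _ e1; exists N => n m Nn Nm.
  apply: le_lt_trans (fu n m) _; apply: (@le_lt_trans _ _ (c * (e / (2 * c)))).
    by rewrite ler_pM2l// hN.
  by rewrite (_ : c * _ = e / 2); [lra|field; rewrite gt_eqF].
have [lX hX] : exists l, forall e : R, 0 < e -> exists N, forall n, (N <= n)%N ->
    nm (app Bs (u n).1.1.1 - l) < e.
  apply: (comp (fun U => app Bs U.1.1.1) 1) => // n m; rewrite mul1r.
  by rewrite -(energy_spaceB (Ku n) (Ku m)).2; case: (energy_norm_bounds (u n - u m)).
have [lu hu] : exists l, forall e : R, 0 < e -> exists N, forall n, (N <= n)%N ->
    nm ((u n).1.1.1 - l) < e.
  apply: (comp (fun U => U.1.1.1) c1^-1); rewrite ?invr_gt0// => n m.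
  have [KB _] := energy_spaceB (Ku n) (Ku m).
  have [+ _ _ _] := energy_norm_bounds (u n - u m).
  move: KB => /energy_spaceP[/nm_le_Bs h _] h'; rewrite mulrC.
  by apply: le_trans h _; rewrite ler_wpM2r// invr_ge0 ltW.
have [lv hv] : exists l, forall e : R, 0 < e -> exists N, forall n, (N <= n)%N ->
    nm ((u n).1.1.2 - l) < e.
  apply: (comp (fun U => U.1.1.2) 1) => // n m; rewrite mul1r.
  by case: (energy_norm_bounds (u n - u m)).
have [lt ht] : exists l, forall e : R, 0 < e -> exists N, forall n, (N <= n)%N ->
    nm ((u n).1.2 - l) < e.
  apply: (comp (fun U => U.1.2) 1) => // n m; rewrite mul1r.
  by case: (energy_norm_bounds (u n - u m)).
have [lz Lz hz] : exists2 l, L2_01 l & forall e : R, 0 < e -> exists N, forall n, (N <= n)%N ->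
    q2 (fun x => (u n).2 x - l x) <= e.
  apply: (L2_complete norm_dot) => [n|e e0]; first by have /energy_spaceP[] := Ku n.
  pose e1 := Num.sqrt (xi * e).
  have e10 : 0 < e1 by rewrite sqrtr_gt0 mulr_gt0.
  have [N hN] := cu _ e10; exists N => n m Nn Nm.
  have [_ _ _] := energy_norm_bounds (u n - u m).
  have : p (u n - u m) ^+ 2 <= e1 ^+ 2 by rewrite ler_pXn2r ?nnegrE ?energy_norm_ge0 ?(ltW e10)// hN.
  have -> : e1 ^+ 2 = xi * e by rewrite sqr_sqrtr// mulr_ge0// ltW.
  move=> h /le_trans/(_ h).
  by rewrite ler_pM2l.
have Bu n : dom Bs (u n).1.1.1 by have /energy_spaceP[] := Ku n.
have [dl al] := adjoint_closed norm_dot B_linear B_dense Bu hu hX.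
pose l : state H := (lu, lv, lt, lz).
have Kl : K l by [].
exists l => // e e0.
have e2 : 0 < e / 4 by rewrite divr_gt0.
have ez : 0 < e ^+ 2 / (4 * xi) by rewrite divr_gt0 ?exprn_gt0 ?mulr_gt0.
have [N1 h1] := hX _ e2; have [N2 h2] := hv _ e2; have [N3 h3] := ht _ e2.
have [N4 h4] := hz _ ez.
exists (maxn (maxn N1 N2) (maxn N3 N4)) => n; rewrite !geq_max.
move=> /andP[/andP[n1 n2] /andP[n3 n4]].
have sm (x : H) : nm x < e / 4 -> nm x ^+ 2 <= e ^+ 2 / 16.
  move=> h; have -> : e ^+ 2 / 16 = (e / 4) ^+ 2 by field.
  by rewrite ler_pXn2r ?nnegrE ?nm_ge0 ?(ltW e2) ?(ltW h).
apply: sqr_le_inv; rewrite ?energy_norm_ge0// energy_norm2 /energy_sq.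
rewrite (energy_spaceB (Ku n) Kl).2 [app Bs l.1.1.1]al.
have {}h1 := sm _ (h1 n n1); have {}h2 := sm _ (h2 n n2); have {}h3 := sm _ (h3 n n3).
have {}h4 : xi * q2 (u n - l).2 <= e ^+ 2 / 4.
  by have := ler_wpM2l (ltW xi_gt0) (h4 n n4); rewrite (_ : xi * (_ / _) = e ^+ 2 / 4)//; field; rewrite gt_eqF.
have -> : (u n - l).1.1.2 = (u n).1.1.2 - lv by [].
have -> : (u n - l).1.2 = (u n).1.2 - lt by [].
by have := sqr_ge0 e; lra.
Qed.

Lemma energy_banach : banach K p.
Proof.
split; [exact: energy_space0|exact: energy_space_lin|exact: energy_norm_ge0|
  exact: energy_normD|exact: energy_normZ|exact: energy_complete].
Qed.

End energy_space.

(** * Transport along characteristics *)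

Section real_increments.
Context {R : realType}.

(** Increments over a fine partition add up. *)
Lemma uniform_increments_le (f : R -> R) (b : R) : 0 <= b ->
  (forall e : R, 0 < e -> exists2 d : R, 0 < d & forall s t, 0 <= s -> s <= t -> t <= b ->
     t - s < d -> f t - f s <= e * (t - s)) -> f b <= f 0.
Proof.
move=> b0 h; apply/ler_addgt0Pr => e e0.
have e1 : 0 < e / (b + 1) by rewrite divr_gt0// ltr_wpDl.
have [d d0 hd] := h _ e1; have [M M0 Md] := pick_partition b0 d0.
have Mp : 0 < M%:R :> R by rewrite ltr0n.
have step (k : nat) : (k <= M)%N -> f (k%:R * (b / M%:R)) <= f 0 + e / (b + 1) * (k%:R * (b / M%:R)).
  elim: k => [|k IH] kM; first by rewrite mul0r mulr0 addr0.
  have q0 : 0 <= b / M%:R by rewrite divr_ge0// ltW.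
  have s0 : 0 <= k%:R * (b / M%:R) by rewrite mulr_ge0.
  have e2 : k.+1%:R * (b / M%:R) = k%:R * (b / M%:R) + b / M%:R by rewrite -[k.+1]addn1 natrD; ring.
  have tb : k.+1%:R * (b / M%:R) <= b.
    by rewrite mulrCA ler_piMr// ler_pdivrMr// mul1r ler_nat.
  have st' : k%:R * (b / M%:R) <= k.+1%:R * (b / M%:R) by rewrite e2 lerDl.
  have ts : k.+1%:R * (b / M%:R) - k%:R * (b / M%:R) = b / M%:R by rewrite e2 addrAC subrr add0r.
  have := hd _ _ s0 st' tb; rewrite ts => /(_ Md); have := IH (ltnW kM); rewrite e2.
  by rewrite (mulrDr (e / (b + 1))); lra.
have := step M (leqnn M); rewrite mulrCA divff ?gt_eqF// mulr1 => h1.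
apply: le_trans h1 _; rewrite lerD2l mulrAC ler_pdivrMr ?ltr_wpDl//.
by rewrite ler_pM2l//; lra.
Qed.

Lemma uniform_increments_cst (f : R -> R) (b : R) : 0 <= b ->
  (forall e : R, 0 < e -> exists2 d : R, 0 < d & forall s t, 0 <= s -> s <= t -> t <= b ->
     t - s < d -> `|f t - f s| <= e * (t - s)) -> f b = f 0.
Proof.
move=> b0 h; apply/eqP; rewrite eq_le; apply/andP; split.
  apply: uniform_increments_le => // e /h[d d0 hd]; exists d => // s t s0 st tb ts.
  exact: le_trans (ler_norm _) (hd s t s0 st tb ts).
rewrite -lerN2; apply: (@uniform_increments_le (fun t => - f t)) => // e /h[d d0 hd].
exists d => // s t s0 st tb ts; rewrite -opprD.
by apply: le_trans (ler_norm _) _; rewrite normrN; exact: hd.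
Qed.

End real_increments.

Section bumps.
Context {R : realType}.
Local Notation RR := (measurableTypeR R).
Implicit Types r x h t : R.

(** These test functions are translated by translating their two centers, and
    become kernels when the centers merge. *)
Definition bump r x x' t := st r (t - x) - st r (t - x').
Definition dbump r x x' t := hat r (t - x) - hat r (t - x').

Lemma bump_01 r x x' t : 0 < r -> x <= x' -> `|bump r x x' t| <= 1.
Proof.
move=> r0 xx'; rewrite /bump.
have [a1 a2] := andP (st_01 (t - x) r0); have [b1 b2] := andP (st_01 (t - x') r0).
have m : st r (t - x') <= st r (t - x) by apply: st_mono => //; lra.
by rewrite ger0_norm; lra.
Qed.

Lemma bump_measurable r x x' : 0 < r -> measurable_fun (I01 : set RR) (bump r x x').
Proof.
move=> r0; apply: (measurable_funS measurableT (@subsetT _ _)).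
apply: continuous_measurable_fun => t.
apply/differentiable_continuous/derivable1_diffP.
have d1 := st_shift_derive x t r0; have d2 := st_shift_derive x' t r0.
by have [] := is_deriveB d1 d2.
Qed.

Lemma dbump_measurable r x x' : 0 < r -> measurable_fun (I01 : set RR) (dbump r x x').
Proof. by move=> r0; apply: measurable_funB; exact: hat_shift_measurable. Qed.

Lemma dbump_le r x x' t : 0 < r -> `|dbump r x x' t| <= 2 / r.
Proof.
move=> r0; apply: le_trans (ler_normB _ _) _.
have := hat_bound (t - x) r0; have := hat_bound (t - x') r0.
move=> hb ha; rewrite (_ : 2 / r = r^-1 + r^-1); first exact: lerD.
by rewrite mulrDl !mul1r.
Qed.

Lemma bump_shift_taylor r x x' h t : 0 < r ->
  `|bump r (x + h) (x' + h) t - bump r x x' t + h * dbump r x x' t| <= 4 / r ^+ 2 * h ^+ 2.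
Proof.
move=> r0; have := st_taylor (t - x) (- h) r0; have := st_taylor (t - x') (- h) r0.
rewrite /bump /dbump !opprD !addrA sqrrN => h1 h2.
apply: le_trans (_ : _ <= 2 / r ^+ 2 * h ^+ 2 + 2 / r ^+ 2 * h ^+ 2) _; last first.
  by rewrite le_eqVlt; apply/orP; left; apply/eqP; field; rewrite gt_eqF.
apply: le_trans (lerD h1 h2); apply: le_trans (ler_normB _ _); rewrite -normrN.
by rewrite le_eqVlt; apply/orP; left; apply/eqP; congr `|_|; ring.
Qed.

Lemma bump_narrow r x h t : 0 < r ->
  `|bump r x (x + h) t - h * hat r (t - x)| <= 2 / r ^+ 2 * h ^+ 2.
Proof.
move=> r0; have := st_taylor (t - x) (- h) r0; rewrite sqrrN; apply: le_trans.
rewrite /bump opprD addrA -normrN.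
by rewrite le_eqVlt; apply/orP; left; apply/eqP; congr `|_|; ring.
Qed.

End bumps.

Section transport.
Context {R : realType} {H : completeNormedModType R[i]}.
Ltac vec := lmod (R[i] : comPzRingType) (H : Type).
Variable dot : {dot H for Num.conj}.
Hypothesis norm_dot : forall x : H, `|x| ^+ 2 = dot x x.
Local Notation ip := (rdot dot).
Local Notation mu := (@lebesgue_measure R).
Local Notation RR := (measurableTypeR R).
Local Notation J := (pairing dot).
Implicit Types (z w g : R -> H) (phi psi : R -> R) (y : H).

Lemma indic01 (t : R) : I01 t -> \1_(`[0%R, 1%R]%classic) t = 1 :> R.
Proof.
move=> It; rewrite indicE mem_set//.
by move: It; rewrite /I01 /= !in_itv/= => /andP[? ?]; rewrite !ltW.
Qed.

Lemma pairing_bound01 phi z y (M l : R) : measurable_fun (I01 : set RR) phi ->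
  0 <= M -> 0 < l -> (forall t, I01 t -> `|phi t| <= M) -> L2_01 z ->
  `|J phi z y| <= M * nm y * (l / 2 * q2 z + (2 * l)^-1).
Proof.
move=> mphi M0 l0 hphi Lz.
have := @pairing_bound R H dot norm_dot phi z y 0 1 M l mphi ler01 M0 l0.
rewrite subr0 mul1r; apply => // t It; rewrite indic01// mulr1; exact: hphi.
Qed.

(** Comparing the pairing of [z1] with a shifted bump to that of [z0] with the
    bump: the drift of the bump cancels the speed [- w] of the function. *)
Lemma pairing_step z0 z1 w y (r x x' h e Q : R) :
  L2_01 z0 -> L2_01 z1 -> L2_01 w -> weak_derivative dot z0 w ->
  0 < r -> x <= x' -> 0 < x - r -> x' + r < 1 -> 0 < h -> h <= 1 -> 0 < e ->
  q2 z0 <= Q -> q2 w <= Q -> q2 (fun t => h%:C *: w t + (z1 t - z0 t)) <= (e * h) ^+ 2 ->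
  `|J (bump r (x + h) (x' + h)) z1 y - J (bump r x x') z0 y| <=
    nm y * h * (e + h * ((2 / r + 8 / r ^+ 2) * ((Q + 1) / 2))).
Proof.
move=> L0 L1 Lw z0w r0 xx' xr x'r h0 h1 e0 Q0 Qw QD.
set f1 := bump r (x + h) _; set f0 := bump r x x'; pose d := dbump r x x'.
set D := fun t => _ in QD.
have Lm : L2_01 (fun t => z1 t - z0 t).
  by have := L2_lin norm_dot (-1) L0 L1; congr L2_01; apply/funext => t; vec.
have LD : L2_01 D by exact: L2_lin.
have mf1 : measurable_fun (I01 : set RR) f1 by exact: bump_measurable.
have mf0 : measurable_fun (I01 : set RR) f0 by exact: bump_measurable.
have md : measurable_fun (I01 : set RR) d by exact: dbump_measurable.
have b1 t : `|f1 t| <= 1 by apply: bump_01 => //; rewrite lerD2r.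
have b0 t : `|f0 t| <= 1 by exact: bump_01.
have [tf de] := step_test_fun r0 xx' xr x'r.
have wp := weak_pairing y z0w tf; rewrite de -/d in wp.
pose g1 t := 1 * f1 t + (-1) * f0 t.
have mg1 : measurable_fun (I01 : set RR) g1.
  by apply: measurable_funD; apply: measurable_funM => //; exact: measurable_cst.
have tay t : `|g1 t + h * d t| <= 4 / r ^+ 2 * h ^+ 2.
  by have := bump_shift_taylor x x' h t r0; rewrite /g1 mul1r mulN1r.
have r4 : 0 <= 4 / r ^+ 2 by rewrite divr_ge0// sqr_ge0.
pose c := 2 / r + 4 / r ^+ 2.
have c0 : 0 <= c by rewrite addr_ge0// divr_ge0// ltW.
have bg1 t : `|g1 t| <= h * c.
  have -> : g1 t = (g1 t + h * d t) - h * d t by rewrite addrK.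
  apply: le_trans (ler_normB _ _) _; rewrite normrM (gtr0_norm h0).
  have a1 : h * `|d t| <= h * (2 / r) by rewrite ler_wpM2l ?(ltW h0)//; exact: dbump_le.
  have a2 := tay t.
  have a3 : 4 / r ^+ 2 * h ^+ 2 <= h * (4 / r ^+ 2).
    by rewrite (mulrC h) ler_wpM2l// expr2 ler_piMr// ltW.
  by apply: le_trans (lerD (le_trans a2 a3) a1) _; rewrite /c mulrDr addrC.
have E1 : J f1 z1 y = - h * J f1 w y + (J f1 z0 y + J f1 D y).
  have hb t : I01 t -> `|f1 t| <= 1 by move=> _; exact: b1.
  have -> : z1 = fun t => (- h)%:C *: w t + ((1%:C : R[i]) *: z0 t + D t).
    by apply/funext => t; rewrite /D rmorphN /= scale1r; vec.
  rewrite (pairing_lin norm_dot _ _ mf1 hb)//; last exact: L2_lin.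
  by rewrite (pairing_lin norm_dot _ _ mf1 hb)// mul1r.
have E2 v : L2_01 v -> J g1 v y = J f1 v y - J f0 v y.
  move=> Lv; rewrite (pairing_weight_lin norm_dot y 1 (-1) (M := 1))//.
  by rewrite mul1r mulN1r.
have E3 : J (fun t => 1 * g1 t + h * d t) z0 y = J g1 z0 y + h * J d z0 y.
  rewrite (pairing_weight_lin norm_dot y 1 h (M := h * c + 2 / r))// ?mul1r//.
    by move=> t _; apply: le_trans (bg1 t) _; rewrite lerDl divr_ge0// ltW.
  by move=> t _; apply: le_trans (dbump_le _ _ _ r0) _; rewrite lerDr mulr_ge0// ltW.
have -> : J f1 z1 y - J f0 z0 y =
    J f1 D y - h * J g1 w y + J (fun t => 1 * g1 t + h * d t) z0 y.
  by rewrite E3 wp E1 !E2//; ring.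
have ny := nm_ge0 y.
have B1 : `|J f1 D y| <= nm y * h * e.
  have l0 : 0 < (e * h)^-1 by rewrite invr_gt0 mulr_gt0.
  have := pairing_bound01 y mf1 ler01 l0 (fun t _ => b1 t) LD.
  rewrite mul1r; move=> /le_trans; apply; rewrite -(mulrA (nm y)) ler_wpM2l//.
  have lq : (e * h)^-1 / 2 * q2 D <= (e * h)^-1 / 2 * (e * h) ^+ 2.
    by rewrite ler_wpM2l// divr_ge0// ltW.
  have e1 : (e * h)^-1 / 2 * (e * h) ^+ 2 = e * h / 2 by field; rewrite !gt_eqF.
  have e2 : (2 * (e * h)^-1)^-1 = e * h / 2 by field; rewrite !gt_eqF.
  by rewrite e1 in lq; rewrite e2 (mulrC h); lra.
have half v : L2_01 v -> q2 v <= Q -> 1 / 2 * q2 v + (2 * 1)^-1 <= (Q + 1) / 2.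
  by move=> _; lra.
have Q1 : 0 <= (Q + 1) / 2 by have := q2_ge0 w; lra.
have B2 : `|J g1 w y| <= h * c * nm y * ((Q + 1) / 2).
  have hc : 0 <= h * c by rewrite mulr_ge0// ltW.
  have := pairing_bound01 y mg1 hc ltr01 (fun t _ => bg1 t) Lw.
  by move=> /le_trans; apply; rewrite ler_wpM2l ?mulr_ge0 ?(ltW h0)//; exact: half.
have B3 : `|J (fun t => 1 * g1 t + h * d t) z0 y| <= 4 / r ^+ 2 * h ^+ 2 * nm y * ((Q + 1) / 2).
  have rh : 0 <= 4 / r ^+ 2 * h ^+ 2 by rewrite mulr_ge0// sqr_ge0.
  have m3 : measurable_fun (I01 : set RR) (fun t => 1 * g1 t + h * d t).
    by apply: measurable_funD; apply: measurable_funM => //; exact: measurable_cst.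
  have b3 t : I01 t -> `|1 * g1 t + h * d t| <= 4 / r ^+ 2 * h ^+ 2 by rewrite mul1r.
  have := pairing_bound01 y m3 rh ltr01 b3 L0.
  by move=> /le_trans; apply; rewrite ler_wpM2l ?(mulr_ge0 rh ny)//; exact: half.
apply: le_trans (ler_normD _ _) _.
apply: le_trans (lerD (ler_normB _ _) (lexx _)) _.
rewrite normrM (gtr0_norm h0).
have := ler_wpM2l (ltW h0) B2 => {}B2.
have -> : nm y * h * (e + h * ((2 / r + 8 / r ^+ 2) * ((Q + 1) / 2))) = nm y * h * e +
   h * (h * c * nm y * ((Q + 1) / 2)) + 4 / r ^+ 2 * h ^+ 2 * nm y * ((Q + 1) / 2).
  by rewrite /c; field; rewrite gt_eqF.
by apply: lerD => //; apply: lerD.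
Qed.

Variables (Z W : R -> R -> H) (b Q : R).
Hypothesis b_ge0 : 0 <= b.
Hypothesis ZL : forall s, 0 <= s <= b -> L2_01 (Z s).
Hypothesis WL : forall s, 0 <= s <= b -> L2_01 (W s).
Hypothesis ZW : forall s, 0 <= s <= b -> weak_derivative dot (Z s) (W s).
Hypothesis ZQ : forall s, 0 <= s <= b -> q2 (Z s) <= Q.
Hypothesis WQ : forall s, 0 <= s <= b -> q2 (W s) <= Q.
Hypothesis ZD : forall e : R, 0 < e -> exists2 d : R, 0 < d & forall s t, 0 <= s -> s <= t ->
  t <= b -> t - s < d ->
  q2 (fun x => (t - s)%:C *: W s x + (Z t x - Z s x)) <= (e * (t - s)) ^+ 2.

(** The pairing with a bump that moves at the speed of the transport has
    vanishing derivative. *)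
Lemma transport_bump y (r x x' : R) : 0 < r -> x <= x' -> 0 < x - r -> x' + b + r < 1 ->
  J (bump r (x + b) (x' + b)) (Z b) y = J (bump r x x') (Z 0) y.
Proof.
move=> r0 xx' xr x'r.
pose m s := J (bump r (x + s) (x' + s)) (Z s) y.
suff : m b = m 0 by rewrite /m !addr0.
apply: uniform_increments_cst => // e e0.
have ny := nm_ge0 y; have ny1 : 0 < nm y + 1 by rewrite ltr_wpDl.
pose c := (2 / r + 8 / r ^+ 2) * ((Q + 1) / 2).
have Q1 : 0 <= (Q + 1) / 2 by have := q2_ge0 (Z 0); have := ZQ (_ : 0 <= 0 <= b); rewrite lexx b_ge0 => /(_ isT); lra.
have c0 : 0 <= c by rewrite mulr_ge0// addr_ge0// divr_ge0// ?sqr_ge0// ltW.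
pose e1 := e / (2 * (nm y + 1)); have e10 : 0 < e1 by rewrite divr_gt0// mulr_gt0.
have [d d0 hd] := ZD e10.
exists (Num.min d (Num.min 1 (e1 / (c + 1)))).
  by rewrite !lt_min d0 ltr01 divr_gt0// ltr_wpDl.
move=> s t s0 st tb; rewrite !lt_min => /and3P[td t1 tc].
have [ts|ts|<-] := ltgtP s t; [|lra|by rewrite subrr normr0 subrr mulr0].
have h0 : 0 < t - s by rewrite subr_gt0.
have sb : 0 <= s <= b by rewrite s0 (le_trans st tb).
have tb' : 0 <= t <= b by rewrite (le_trans s0 st) tb.
have := @pairing_step (Z s) (Z t) (W s) y r (x + s) (x' + s) (t - s) e1 Q
  (ZL sb) (ZL tb') (WL sb) (ZW sb) r0.
have -> : x + s + (t - s) = x + t by ring.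
have -> : x' + s + (t - s) = x' + t by ring.
rewrite -/(m t) -/(m s) => P.
have {}P : `|m t - m s| <= nm y * (t - s) * (e1 + (t - s) * c).
  by apply: P => //; [lra|lra|lra|exact: ltW|exact: ZQ|exact: WQ|exact: hd].
apply: le_trans P _.
have h2 : (t - s) * c <= e1.
  apply: (@le_trans _ _ ((t - s) * (c + 1))); first by rewrite ler_wpM2l ?(ltW h0)//; lra.
  by rewrite -ler_pdivlMr ?ltW// ltr_wpDl.
have -> : e * (t - s) = (nm y + 1) * (t - s) * (e1 + e1).
  by rewrite /e1; field; rewrite gt_eqF.
apply: ler_pM.
- by rewrite mulr_ge0 ?(ltW h0).
- by rewrite addr_ge0 ?(ltW e10)// mulr_ge0// ltW.
- by rewrite ler_wpM2r ?(ltW h0)//; lra.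
- by rewrite lerD2l.
Qed.

(** Narrow bumps, divided by their width, tend to the triangular kernel. *)
Lemma transport_hat y (r x : R) : 0 < r -> 0 < x - r -> x + b + r < 1 ->
  J (fun t => hat r (t - (x + b))) (Z b) y = J (fun t => hat r (t - x)) (Z 0) y.
Proof.
move=> r0 xr x'r.
have b1 : 0 <= b <= b by apply/andP.
have b2 : 0 <= (0 : R) <= b by apply/andP.
pose C := 2 / r ^+ 2 * nm y * ((Q + 1) / 2).
have approx s h : 0 <= s <= b -> 0 < h ->
    `|J (bump r (x + s) (x + s + h)) (Z s) y - h * J (fun t => hat r (t - (x + s))) (Z s) y| <= C * h ^+ 2.
  move=> sb h0; pose g t := 1 * bump r (x + s) (x + s + h) t + (- h) * hat r (t - (x + s)).
  have mb : measurable_fun (I01 : set RR) (bump r (x + s) (x + s + h)) by exact: bump_measurable.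
  have mh : measurable_fun (I01 : set RR) (fun t => hat r (t - (x + s))) by exact: hat_shift_measurable.
  have mg : measurable_fun (I01 : set RR) g.
    by apply: measurable_funD; apply: measurable_funM => //; exact: measurable_cst.
  have -> : J (bump r (x + s) (x + s + h)) (Z s) y - h * J (fun t => hat r (t - (x + s))) (Z s) y = J g (Z s) y.
    rewrite (pairing_weight_lin norm_dot y 1 (- h) (M := 1 + r^-1))// ?mul1r ?mulNr//; last exact: ZL.
      move=> t _; apply: le_trans (bump_01 _ r0 _) _; first by rewrite lerDl ltW.
      by rewrite lerDl invr_ge0 ltW.
    by move=> t _; apply: le_trans (hat_bound _ r0) _; rewrite lerDr.
  have g1 t : I01 t -> `|g t| <= 2 / r ^+ 2 * h ^+ 2.
    by move=> _; rewrite /g mul1r mulNr; exact: bump_narrow.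
  have g0 : 0 <= 2 / r ^+ 2 * h ^+ 2 by rewrite mulr_ge0 ?sqr_ge0// divr_ge0 ?sqr_ge0.
  apply: le_trans (pairing_bound01 y mg g0 ltr01 g1 (ZL sb)) _.
  have -> : C * h ^+ 2 = 2 / r ^+ 2 * h ^+ 2 * nm y * ((Q + 1) / 2) by rewrite /C; ring.
  by rewrite ler_wpM2l ?(mulr_ge0 g0 (nm_ge0 y))//; have := ZQ sb; lra.
have C0 : 0 <= C.
  by have := approx 0 1 b2 ltr01; rewrite expr1n mulr1; exact: le_trans.
apply/eqP; rewrite -subr_eq0 -normr_le0; apply/ler_addgt0Pr => e e0; rewrite add0r.
pose h := Num.min (e / (2 * C + 1)) ((1 - (x + b + r)) / 2).
have C1 : 0 < 2 * C + 1 by rewrite ltr_wpDl// mulr_ge0.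
have h0 : 0 < h by rewrite lt_min !divr_gt0//; lra.
have [he hx] : h <= e / (2 * C + 1) /\ h <= (1 - (x + b + r)) / 2.
  by rewrite !ge_min !lexx orbT.
have := approx b h b1 h0; have := approx 0 h b2 h0.
have := @transport_bump y r x (x + h) r0; rewrite addr0.
have -> : x + h + b = x + b + h by ring.
move=> -> //; [|lra|lra].
set j := J (bump _ _ _) _ _; set p := J _ (Z 0) y; set q := J _ (Z b) y => ap aq.
have : h * `|q - p| <= h * (2 * C * h).
  rewrite -{1}(gtr0_norm h0) -normrM.
  have -> : h * (q - p) = (j - h * p) - (j - h * q) by ring.
  apply: le_trans (ler_normB _ _) _; apply: le_trans (lerD ap aq) _.
  by rewrite le_eqVlt; apply/orP; left; apply/eqP; ring.
rewrite ler_pM2l// => /le_trans; apply.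
apply: (@le_trans _ _ ((2 * C + 1) * h)); first by rewrite ler_wpM2r ?(ltW h0)//; lra.
by rewrite mulrC -ler_pdivlMr.
Qed.

(** The kernel has mass one and is carried by an interval where the continuous
    representative is close to its value at [x]. *)
Lemma mollify_cont01 z zc y (x : R) : L2_01 z -> cont01 zc ->
  ae (fun t => I01 t -> zc t = z t) -> 0 < x < 1 ->
  forall e : R, 0 < e -> exists2 d : R, 0 < d & forall r, 0 < r -> r < d ->
    `|J (fun t => hat r (t - x)) z y - ip (zc x) y| <= e.
Proof.
move=> /L2_rep[z' [mz iz ez]] cz ezc /andP[x0 x1] e e0.
have ny1 : 0 < nm y + 1 by rewrite ltr_wpDl// nm_ge0.
have x01 : 0 <= x <= 1 by rewrite !ltW.
have e1 : 0 < e / (nm y + 1) by rewrite divr_gt0.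
have [d d0 hd] := cz x x01 _ e1.
exists (Num.min d (Num.min x (1 - x))); first by rewrite !lt_min d0 x0 subr_gt0.
move=> r r0; rewrite !lt_min => /and3P[rd rx rx1].
rewrite -(pairing_ae dot _ y ez).
have If : mu.-integrable I01 (EFin \o (fun t => hat r (t - x) * ip (z' t) y)).
  apply: (pairing_integrable norm_dot y (M := r^-1)) => //; first exact: hat_shift_measurable.
  by move=> t _; exact: hat_bound.
have mh : measurable_fun (I01 : set RR) (fun t => hat r (t - x)) by exact: hat_shift_measurable.
have Ih : mu.-integrable I01 (EFin \o (fun t => hat r (t - x))).
  by apply: (le_integrable01 mh _ (integrable_cst01 r^-1)) => t _; exact: hat_bound.
pose c := ip (zc x) y.
pose G t := 1 * (hat r (t - x) * ip (z' t) y) + (- c) * hat r (t - x).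
have IG : mu.-integrable I01 (EFin \o G) by exact: integrable_lin01.
have eG : J (fun t => hat r (t - x)) z' y - c = \int[mu]_(t in I01) G t.
  by rewrite Rintegral_lin01// hat_mass ?mul1r ?mulr1//; lra.
rewrite -/c eG; apply: le_trans (le_normr_Rintegral mI01 IG) _.
pose E t := 0 * (0 : R) + e * hat r (t - x).
have IE : mu.-integrable I01 (EFin \o E) by apply: integrable_lin01 => //; exact: integrable_cst01.
have -> : \int[mu]_(t in I01) `|G t| = \int[mu]_(t in I01) Num.min `|G t| (E t).
  apply: Rintegral_null; apply: (aeS _ (aeI ez ezc)) => t [e2 e3] It.
  apply/esym/min_idPl; rewrite /G /E mul0r add0r.
  rewrite e2// -e3// mul1r.
  have -> : hat r (t - x) * ip (zc t) y + - c * hat r (t - x) = hat r (t - x) * (ip (zc t) y - c) by ring.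
  have hh := hat_ge0 (t - x) r0.
  rewrite normrM (ger0_norm hh) (mulrC e).
  have [tx|tx] := ltP `|t - x| r; last by rewrite hat_out ?mul0r.
  rewrite ler_wpM2l// /c -ipBl; apply: le_trans (ip_abs norm_dot _ _) _.
  have t01 : 0 <= t <= 1 by move: It; rewrite /I01/= in_itv/= => /andP[? ?]; rewrite !ltW.
  have := hd t t01 (lt_trans tx rd) => /ltW h.
  have := ler_wpM2r (nm_ge0 y) h => /le_trans; apply.
  by rewrite mulrAC ler_pdivrMr// ler_wpM2l ?(ltW e0)//; lra.
have mG : measurable_fun (I01 : set RR) (fun t => `|G t|).
  apply: (measurableT_comp (@normr_measurable R setT)).
  by have /integrableP[/measurable_EFinP] := IG.
have mE : measurable_fun (I01 : set RR) E by have /integrableP[/measurable_EFinP] := IE.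
have E0 t : 0 <= E t by rewrite /E mul0r add0r mulr_ge0 ?hat_ge0// ltW.
have IM : mu.-integrable I01 (EFin \o (fun t => Num.min `|G t| (E t))).
  apply: (le_integrable01 _ _ IE); first exact: measurable_minr.
  by move=> t _; rewrite ger0_norm ?ge_min ?lexx ?orbT// le_min normr_ge0 E0.
apply: (@le_trans _ _ (\int[mu]_(t in I01) E t)).
  by apply: (le_Rintegral mI01 IM IE) => t _; rewrite ge_min lexx orbT.
rewrite Rintegral_lin01//; last exact: integrable_cst01.
by rewrite mul0r add0r hat_mass ?mulr1//; lra.
Qed.

(** Both values are limits of the averages identified by [transport_hat], in every
    direction [y]; the difference itself is the direction to use. *)
Lemma transport_pointwise z0 z1 (x : R) : cont01 z0 -> cont01 z1 ->
  ae (fun t => I01 t -> z0 t = Z 0 t) -> ae (fun t => I01 t -> z1 t = Z b t) ->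
  0 < x -> x + b < 1 -> z1 (x + b) = z0 x.
Proof.
move=> c0 c1 e0 e1 x0 xb.
have b1 : 0 <= b <= b by apply/andP.
have b2 : 0 <= (0 : R) <= b by apply/andP.
have L1 := ZL b1; have L0 := ZL b2.
have xi : 0 < x < 1 by rewrite x0; lra.
have xbi : 0 < x + b < 1 by rewrite xb andbT; lra.
apply/eqP; rewrite -subr_eq0; apply/eqP; apply: nm_eq0; apply/eqP.
set y := z1 (x + b) - z0 x; rewrite -sqrf_eq0 (nm2 norm_dot) {1}/y ipBl subr_eq0; apply/eqP.
apply/eqP; rewrite -subr_eq0 -normr_le0; apply/ler_addgt0Pr => e ep; rewrite add0r.
have e2 : 0 < e / 2 by rewrite divr_gt0.
have [d1 d10 h1] := mollify_cont01 y L1 c1 e1 xbi e2.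
have [d2 d20 h2] := mollify_cont01 y L0 c0 e0 xi e2.
pose d := Num.min (Num.min d1 d2) (Num.min x (1 - (x + b))).
have d0 : 0 < d by rewrite !lt_min d10 d20 x0 subr_gt0.
pose r := d / 2; have r0 : 0 < r by rewrite divr_gt0.
have : r < d by rewrite /r; lra.
rewrite !lt_min => /andP[/andP[r1 r2] /andP[r3 r4]].
have := h1 r r0 r1; have := h2 r r0 r2.
rewrite transport_hat//; [|lra|lra].
rewrite !ler_norml => /andP[? ?] /andP[? ?]; apply/andP; split; lra.
Qed.

End transport.

(** * Derivatives of orbits *)

Section orbit_calculus.
Context {R : realType} {X : lmodType R[i]}.
Ltac vec := lmod (R[i] : comPzRingType) (X : Type).
Variables (K : set X) (p : X -> R).
Hypothesis KP : banach K p.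

(** From the left, the derivative sits at the wrong end of the increment;
    continuity of [g] moves it to [t]. *)
Lemma two_sided_derivative (f g : R -> X) (b : R) :
  (forall t, 0 <= t -> K (f t)) -> (forall t, 0 <= t -> K (g t)) ->
  (forall e : R, 0 < e -> exists2 d : R, 0 < d & forall s t, 0 <= s -> s <= t -> t <= b ->
     t - s < d -> p (f t - f s - (t - s)%:C *: g s) <= e * (t - s)) ->
  (forall e : R, 0 < e -> exists2 d : R, 0 < d & forall s t, 0 <= s -> s <= t -> t <= b ->
     t - s < d -> p (g t - g s) <= e) ->
  forall t, 0 < t -> t < b -> forall e : R, 0 < e -> exists2 d : R, 0 < d & forall h : R, `|h| < d ->
     0 <= t + h /\ p (f (t + h) - f t - h%:C *: g t) <= e * `|h|.
Proof.
move=> Kf Kg df cg t t0 tb e e0.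
have e2 : 0 < e / 2 by rewrite divr_gt0.
have [d1 d10 h1] := df _ e2; have [d2 d20 h2] := cg _ e2.
exists (Num.min (Num.min d1 d2) (Num.min t (b - t))).
  by rewrite !lt_min d10 d20 t0 subr_gt0.
move=> h; rewrite !lt_min => /andP[/andP[hd1 hd2] /andP[ht hb]].
have [h0|h0] := leP 0 h.
  rewrite (ger0_norm h0) in hd1 hd2 ht hb *; split; first lra.
  have := h1 t (t + h) (ltW t0); rewrite (addrC t h) addrK => a.
  by apply: le_trans (a _ _ _) _ => //; [lra|lra|rewrite ler_wpM2r//; lra].
have hn : `|h| = - h by rewrite ltr0_norm.
rewrite !hn in hd1 hd2 ht hb *.
have th0 : 0 <= t + h by lra.
have tht : t + h <= t by lra.
split=> //.
have e3 : t - (t + h) = - h by ring.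
have a1 : p (f t - f (t + h) - (- h)%:C *: g (t + h)) <= e / 2 * (- h).
  by have := h1 (t + h) t th0 tht (ltW tb); rewrite e3; apply.
have a2 : p (g t - g (t + h)) <= e / 2.
  by apply: h2 => //; [exact: ltW|rewrite e3].
have K1 := Kf _ th0; have K2 := Kf _ (ltW t0); have K3 := Kg _ th0; have K4 := Kg _ (ltW t0).
have -> : f (t + h) - f t - h%:C *: g t =
   (- h)%:C *: (g t - g (t + h)) - (f t - f (t + h) - (- h)%:C *: g (t + h)).
  by rewrite rmorphN /=; vec.
apply: le_trans (pBD KP _ _) _.
- by apply: (KZ KP); exact: (KB KP).
- by apply: (KB KP); [exact: (KB KP)|exact: (KZ KP)].
rewrite (pZr KP); last exact: (KB KP).
rewrite normrN hn; have : 0 <= - h by lra.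
move=> hp; have := ler_wpM2l hp a2; lra.
Qed.

Variable S : R -> X -> X.
Hypothesis SP : C0_semigroup K p S.
Variable T : uop X.
Hypothesis TP : infinitesimal_generator K p S T.

Let KS t x : 0 <= t -> K x -> K (S t x).
Proof. exact: (sg_stable SP). Qed.

Lemma orbit_app_K x t : dom T x -> 0 <= t -> K (app T (S t x)).
Proof. by move=> Tx t0; apply: (app_K TP); exact: (orbit_dom KP SP TP). Qed.

Lemma orbit_app_norm x t : dom T x -> 0 <= t -> p (app T (S t x)) = p (S t (app T x)).
Proof.
move=> Tx t0; apply: (p_eq_tri KP (orbit_app_K Tx t0)); last exact: (orbit_app KP SP TP).
by apply: KS => //; exact: (app_K TP).
Qed.

Lemma orbit_bound x (b : R) : dom T x -> exists C : R, 0 <= C /\ forall t, 0 <= t -> t <= b ->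
  p (S t x) <= C /\ p (app T (S t x)) <= C.
Proof.
move=> Tx; have Kx := dom_K TP Tx; have KT := app_K TP Tx.
have [M M0 hM] := bounded_on KP SP b.
exists (M * (p x + p (app T x))); split.
  by rewrite mulr_ge0 ?(ltW M0)// addr_ge0 ?(bn_ge0 KP).
move=> t t0 tb; rewrite orbit_app_norm//.
split; apply: le_trans (hM t _ t0 tb _) _ => //; rewrite ler_wpM2l ?(ltW M0)//.
  by rewrite lerDl (bn_ge0 KP).
by rewrite lerDr (bn_ge0 KP).
Qed.

Lemma orbit_step x (b e : R) : dom T x -> 0 < e -> exists2 d : R, 0 < d & forall s t, 0 <= s ->
  s <= t -> t <= b -> t - s < d -> p (S t x - S s x - (t - s)%:C *: app T (S s x)) <= e * (t - s).
Proof.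
move=> Tx e0; have Kx := dom_K TP Tx; have KT := app_K TP Tx.
have [d d0 hd] := orbit_derivative KP SP TP b Tx e0.
exists d => // s t s0 st tb ts; have t0 := le_trans s0 st.
have K1 := KS t0 Kx; have K2 := KS s0 Kx; have K3 := orbit_app_K Tx s0; have K4 := KS s0 KT.
rewrite (_ : p _ = p (S t x - S s x - (t - s)%:C *: S s (app T x))); first exact: hd.
apply: (p_eq_tri KP); try by apply: (KB KP); [exact: (KB KP)|exact: (KZ KP)].
have -> : S t x - S s x - (t - s)%:C *: app T (S s x) - (S t x - S s x - (t - s)%:C *: S s (app T x)) =
    - (t - s)%:C *: (app T (S s x) - S s (app T x)).
  by move: (S t x) (S s x) (app T _) (S s _) => *; vec.
by rewrite -rmorphN /= (pZr KP) ?(orbit_app KP SP TP)// ?mulr0//; exact: (KB KP).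
Qed.

Lemma orbit_app_continuous x (b e : R) : dom T x -> 0 < e -> exists2 d : R, 0 < d & forall s t,
  0 <= s -> s <= t -> t <= b -> t - s < d -> p (app T (S t x) - app T (S s x)) <= e.
Proof.
move=> Tx e0; have Kx := dom_K TP Tx; have KT := app_K TP Tx.
have [d d0 hd] := S_uniformly_continuous KP SP b KT e0.
exists d => // s t s0 st tb ts; have t0 := le_trans s0 st.
have K1 := KS t0 KT; have K2 := orbit_app_K Tx t0; have K3 := orbit_app_K Tx s0; have K4 := KS s0 KT.
apply: le_trans (hd s t s0 st tb ts).
apply: le_trans (ptri KP K2 K1 K3) _; rewrite (orbit_app KP SP TP)// add0r.
by apply: le_trans (ptri KP K1 K4 K3) _; rewrite (pBC KP K4 K3) (orbit_app KP SP TP)// addr0.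
Qed.

Lemma orbit_two_sided x t (e : R) : dom T x -> 0 < t -> 0 < e -> exists2 d : R, 0 < d &
  forall h : R, `|h| < d -> 0 <= t + h /\ p (S (t + h) x - S t x - h%:C *: app T (S t x)) <= e * `|h|.
Proof.
move=> Tx t0 e0.
apply: (@two_sided_derivative (S^~ x) (fun t => app T (S t x)) (t + 1)) => //; last lra.
- by move=> s s0; apply: KS => //; exact: (dom_K TP).
- by move=> s s0; exact: orbit_app_K.
- by move=> e' e'0; exact: orbit_step.
- by move=> e' e'0; exact: orbit_app_continuous.
Qed.

Lemma antiderivative_two_sided x : K x -> exists Y : R -> X,
  (forall t, 0 <= t -> K (Y t)) /\
  forall t (e : R), 0 < t -> 0 < e -> exists2 d : R, 0 < d &
    forall h : R, `|h| < d -> 0 <= t + h /\ p (Y (t + h) - Y t - h%:C *: S t x) <= e * `|h|.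
Proof.
move=> Kx; have [Y [KY _ hY]] := orbit_antiderivative KP SP Kx.
exists Y; split=> // t e t0 e0.
apply: (@two_sided_derivative Y (S^~ x) (t + 1)) => //; last lra.
- by move=> s s0; exact: KS.
- by move=> e'; exact: hY.
- by move=> e'; exact: (S_uniformly_continuous KP SP).
Qed.

End orbit_calculus.

(** * Orbits of the delay system *)

Section delay_orbits.
Context {R : realType} {H : completeNormedModType R[i]}.
Ltac vec := lmod (R[i] : comPzRingType) (H : Type).
Variables (dot : {dot H for Num.conj}) (A B C : uop H) (alpha tau a xi c1 : R).
Hypothesis norm_dot : forall x : H, `|x| ^+ 2 = dot x x.
Hypotheses (B_linear : linear_op B) (B_dense : densely_defined B).
Hypotheses (tau_gt0 : 0 < tau) (xi_gt0 : 0 < xi) (c1_gt0 : 0 < c1).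
Hypothesis Bs_below : forall v, dom (adjoint dot B) v ->
  c1%:C * `|v| <= `|app (adjoint dot B) v|.
Local Notation ip := (rdot dot).
Local Notation Bs := (adjoint dot B).
Local Notation Cs := (adjoint dot C).
Local Notation Aa := (frac_power dot A alpha).
Local Notation K := (energy_space dot B).
Local Notation p := (energy_norm dot B xi).
Local Notation T := (delay_op dot A B C alpha tau a).
Variable S : R -> state H -> state H.
Hypothesis SP : C0_semigroup K p S.
Hypothesis TP : infinitesimal_generator K p S T.
Implicit Types U V : state H.

Let KP : banach K p.
Proof. exact: (energy_banach norm_dot B_linear B_dense xi_gt0 c1_gt0 Bs_below). Qed.

Lemma delay_domP U : dom T U ->
  [/\ dom Bs U.1.1.1, dom Bs U.1.1.2, dom Aa U.1.2 & H1_01 dot U.2] /\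
  continuous_rep U.2 0 = app Bs U.1.1.1 /\
  dom B (a%:C *: app Bs U.1.1.2 + continuous_rep U.2 1).
Proof. by case: U => [[[u v] th] z] [h1 h2 h3]. Qed.

Lemma delay_appE U :
  [/\ (app T U).1.1.1 = U.1.1.2,
      (app T U).1.1.2 = - app B (continuous_rep U.2 1 + a%:C *: app Bs U.1.1.2) + app C U.1.2,
      (app T U).1.2 = - app Aa U.1.2 - app Cs U.1.1.2 &
      (app T U).2 = fun x => (- tau^-1)%:C *: wderiv dot U.2 x].
Proof. by case: U => [[[u v] th] z]. Qed.

Variable x : state H.
Hypothesis Tx : dom T x.

Let X t := app Bs (S t x).1.1.1.

Let KO t : 0 <= t -> K (S t x).
Proof. by move=> t0; apply: (sg_stable SP t0); exact: (dom_K TP). Qed.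

Lemma orbit_domP t : 0 <= t ->
  [/\ dom Bs (S t x).1.1.1, dom Bs (S t x).1.1.2, dom Aa (S t x).1.2 & H1_01 dot (S t x).2] /\
  continuous_rep (S t x).2 0 = X t /\
  dom B (a%:C *: app Bs (S t x).1.1.2 + continuous_rep (S t x).2 1).
Proof. by move=> t0; apply: delay_domP; exact: (orbit_dom KP SP TP). Qed.

Lemma nm_X_diff s t : 0 <= s -> 0 <= t -> nm (X s - X t) <= p (S s x - S t x).
Proof.
move=> s0 t0; rewrite -(energy_spaceB norm_dot B_linear B_dense (KO s0) (KO t0)).2.
by case: (energy_norm_bounds B norm_dot xi_gt0 (S s x - S t x)).
Qed.

(** The derivative of the history component along the orbit is [- z_rho / tau]:
    after a time [tau s] the history has moved by [s]. *)
Lemma orbit_transport (t s r : R) : 0 <= t -> 0 <= s -> 0 < r -> r + s < 1 ->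
  continuous_rep (S (t + tau * s) x).2 (r + s) = continuous_rep (S t x).2 r.
Proof.
move=> t0 s0 r0 rs.
have tn0 q : 0 <= q -> 0 <= t + tau * q by move=> q0; rewrite addr_ge0// mulr_ge0// ltW.
pose Z q := (S (t + tau * q) x).2.
pose W q := wderiv dot (Z q).
have H1 q : 0 <= q -> H1_01 dot (Z q) by move=> q0; have [[]] := orbit_domP (tn0 q q0).
have [C1 [C10 hC]] := orbit_bound KP SP TP (t + tau * s) Tx.
have tle q : q <= s -> t + tau * q <= t + tau * s by move=> qs; rewrite lerD2l ler_wpM2l// ltW.
have sqC U : p U <= C1 -> q2 U.2 <= C1 ^+ 2 / xi.
  move=> h; rewrite ler_pdivlMr// mulrC.
  have [_ _ _ /le_trans] := energy_norm_bounds B norm_dot xi_gt0 U; apply.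
  by rewrite ler_pXn2r ?nnegrE ?energy_norm_ge0.
pose Q := Num.max (C1 ^+ 2 / xi) (tau ^+ 2 * (C1 ^+ 2 / xi)).
have [c0 e0] := continuous_rep_spec norm_dot (H1 0 (lexx 0)).
have [c1' e1] := continuous_rep_spec norm_dot (H1 s s0).
have tauC : tau%:C != 0 :> R[i] by rewrite (inj_eq (@complexI _)) gt_eqF.
have -> : continuous_rep (S t x).2 r = continuous_rep (Z 0) r by rewrite /Z mulr0 addr0.
apply: (@transport_pointwise R H dot norm_dot Z W s Q) => //.
- by move=> q /andP[q0 _]; case: (H1 q q0).
- by move=> q /andP[q0 _]; case: (wderiv_spec (H1 q q0)).
- by move=> q /andP[q0 _]; case: (wderiv_spec (H1 q q0)).
- move=> q /andP[q0 qs]; apply: le_trans (sqC (S (t + tau * q) x) _) _.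
    by have [] := hC _ (tn0 q q0) (tle q qs).
  by rewrite /Q le_max lexx.
- move=> q /andP[q0 qs].
  have [_ _ _ ez] := delay_appE (S (t + tau * q) x).
  have -> : W q = fun y => (- tau)%:C *: (app T (S (t + tau * q) x)).2 y.
    apply/funext => y; rewrite ez scalerA -rmorphM /= mulrNN divff ?gt_eqF//.
    by rewrite scale1r.
  have KT : K (app T (S (t + tau * q) x)) by apply: (orbit_app_K KP SP TP Tx); exact: tn0.
  rewrite q2Z//; last by have /energy_spaceP[] := KT.
  rewrite Re_norm_real normrN (gtr0_norm tau_gt0).
  apply: (@le_trans _ _ (tau ^+ 2 * (C1 ^+ 2 / xi))); last by rewrite /Q le_max lexx orbT.
  rewrite ler_wpM2l ?sqr_ge0//; apply: sqC.
  by have [] := hC _ (tn0 q q0) (tle q qs).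
- move=> e ep; pose e' := e * Num.sqrt xi / tau.
  have sx : 0 < Num.sqrt xi by rewrite sqrtr_gt0.
  have e'0 : 0 < e' by rewrite divr_gt0// mulr_gt0.
  have [d d0 hd] := orbit_step KP SP TP (t + tau * s) Tx e'0.
  exists (d / tau) => [|q q' q0 qq' q's qd]; first by rewrite divr_gt0.
  have := hd (t + tau * q) (t + tau * q') (tn0 q q0) _ (tle q' q's).
  have -> : t + tau * q' - (t + tau * q) = tau * (q' - q) by ring.
  have qn : 0 <= q' - q by rewrite subr_ge0.
  move=> h.
  have {}h : p (S (t + tau * q') x - S (t + tau * q) x -
      (tau * (q' - q))%:C *: app T (S (t + tau * q) x)) <= e' * (tau * (q' - q)).
    by apply: h; [rewrite lerD2l ler_wpM2l// ltW|rewrite mulrC -ltr_pdivlMr].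
  set V := _ - _ - _ in h.
  have -> : (fun y => (q' - q)%:C *: W q y + (Z q' y - Z q y)) = V.2.
    have [_ _ _ ez] := delay_appE (S (t + tau * q) x).
    have -> : V.2 = fun y => Z q' y - Z q y - (tau * (q' - q))%:C *: (app T (S (t + tau * q) x)).2 y by [].
    apply/funext => y; rewrite ez scalerA -rmorphM /=.
    have -> : tau * (q' - q) * - tau^-1 = - (q' - q) by field; rewrite gt_eqF.
    by rewrite -/(W q) rmorphN /=; vec.
  rewrite -(ler_pM2l xi_gt0).
  have [_ _ _ /le_trans] := energy_norm_bounds B norm_dot xi_gt0 V; apply.
  apply: (@le_trans _ _ ((e' * (tau * (q' - q))) ^+ 2)).
    rewrite ler_pXn2r ?nnegrE ?energy_norm_ge0//.
    by rewrite mulr_ge0 ?(ltW e'0)// mulr_ge0// ltW.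
  have -> : e' * (tau * (q' - q)) = Num.sqrt xi * (e * (q' - q)).
    by rewrite /e'; field; rewrite gt_eqF.
  by rewrite exprMn sqr_sqrtr// ltW.
Qed.

(** Going back along the characteristic through [(t, s)] one meets the boundary
    [rho = 0] at time [t - tau * s], where the domain condition prescribes [X]; the
    end [s = 1] is reached by continuity. *)
Lemma orbit_history (t s : R) : tau <= t -> 0 <= s <= 1 -> continuous_rep (S t x).2 s = X (t - tau * s).
Proof.
move=> taut.
have t0 : 0 <= t by exact: le_trans (ltW tau_gt0) taut.
have [[_ _ _ H1t] _] := orbit_domP t0.
have [ct _] := continuous_rep_spec norm_dot H1t.
have lt1 r : 0 <= r -> r < 1 -> continuous_rep (S t x).2 r = X (t - tau * r).
  move=> r0 r1; have q0 : 0 <= t - tau * r.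
    by rewrite subr_ge0; apply: le_trans taut; rewrite ler_piMr// ltW.
  have [[_ _ _ H1q] [zq _]] := orbit_domP q0.
  have [cq _] := continuous_rep_spec norm_dot H1q.
  apply/eqP; rewrite -subr_eq0; apply/eqP; apply: eq_of_nm_small => e e0.
  have e2 : 0 < e / 2 by rewrite divr_gt0.
  have r01 : 0 <= r <= 1 by rewrite r0 ltW.
  have z01 : 0 <= (0 : R) <= 1 by rewrite lexx ler01.
  have [d1 d10 h1] := ct r r01 _ e2; have [d2 d20 h2] := cq 0 z01 _ e2.
  pose h := Num.min (Num.min d1 d2) (1 - r) / 2.
  have m0 : 0 < Num.min (Num.min d1 d2) (1 - r) by rewrite !lt_min d10 d20 subr_gt0.
  have h0 : 0 < h by rewrite divr_gt0.
  have : h < Num.min (Num.min d1 d2) (1 - r) by rewrite /h; lra.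
  rewrite !lt_min => /andP[/andP[hd1 hd2] hr].
  have hr1 : h + r < 1 by lra.
  have tr := orbit_transport q0 r0 h0 hr1; rewrite subrK in tr.
  have := h1 (h + r); rewrite addrK (gtr0_norm h0) => /(_ _ hd1) a1.
  have := h2 h; rewrite subr0 (gtr0_norm h0) => /(_ _ hd2) a2.
  have {}a1 : nm (continuous_rep (S t x).2 (h + r) - continuous_rep (S t x).2 r) < e / 2.
    by apply: a1; apply/andP; split; lra.
  have {}a2 : nm (continuous_rep (S (t - tau * r) x).2 h - X (t - tau * r)) < e / 2.
    by rewrite -zq; apply: a2; apply/andP; split; lra.
  rewrite tr nmC in a1.
  set z := continuous_rep _ r in a1 *; set w := X _ in a2 *; set y := continuous_rep _ h in a1 a2.
  have -> : z - w = (z - y) + (y - w) by vec.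
  by have := nmD (z - y) (y - w); lra.
move=> /andP[s0]; rewrite le_eqVlt => /orP[/eqP ->|s1]; last exact: lt1.
rewrite mulr1.
have q0 : 0 <= t - tau by rewrite subr_ge0.
apply/eqP; rewrite -subr_eq0; apply/eqP; apply: eq_of_nm_small => e e0.
have e2 : 0 < e / 2 by rewrite divr_gt0.
have r01 : 0 <= (1 : R) <= 1 by rewrite ler01 lexx.
have [d1 d10 h1] := ct 1 r01 _ e2.
have [d2 d20 h2] := S_uniformly_continuous KP SP t (dom_K TP Tx) e2.
pose h := Num.min (Num.min d1 (d2 / tau)) 1 / 2.
have m0 : 0 < Num.min (Num.min d1 (d2 / tau)) 1 by rewrite !lt_min d10 divr_gt0// ltr01.
have h0 : 0 < h by rewrite divr_gt0.
have : h < Num.min (Num.min d1 (d2 / tau)) 1 by rewrite /h; lra.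
rewrite !lt_min => /andP[/andP[hd1 hd2] hr].
have th0 : 0 < tau * h by rewrite mulr_gt0.
have th1 : tau * h < tau by rewrite -[X in _ < X]mulr1 ltr_pM2l.
have a1 : nm (continuous_rep (S t x).2 (1 - h) - continuous_rep (S t x).2 1) < e / 2.
  by apply: h1; [apply/andP; split; lra|rewrite addrAC subrr add0r normrN gtr0_norm].
rewrite lt1 in a1; [|lra|lra].
have te : t - tau * (1 - h) = t - tau + tau * h by ring.
rewrite te in a1.
have qh : 0 <= t - tau + tau * h by lra.
have a2 : nm (X (t - tau + tau * h) - X (t - tau)) <= e / 2.
  apply: le_trans (nm_X_diff qh q0) _; apply: h2 => //; [lra|lra|].
  by rewrite addrAC subrr add0r mulrC -ltr_pdivlMr.
rewrite nmC in a1; set z := continuous_rep _ 1 in a1 *.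
set w := X (t - tau) in a2 *; set y := X _ in a1 a2.
have -> : z - w = (z - y) + (y - w) by vec.
by have := nmD (z - y) (y - w); lra.
Qed.

End delay_orbits.

(** * Differential calculus along the real line *)

Section real_calculus.
Context {R : realType}.
Local Notation mu := (@lebesgue_measure R).

Lemma is_derive_eps (f : R -> R) (t d : R) :
  (forall e : R, 0 < e -> exists2 c : R, 0 < c & forall h : R, `|h| < c ->
     `|f (t + h) - f t - h * d| <= e * `|h|) -> is_derive t 1 f d.
Proof.
move=> fh.
have lim : h^-1 *: (f (h *: (1 : R) + t) - f t) @[h --> (0 : R)^'] --> d.
  apply/cvgrPdist_lt => e e0.
  have e2 : 0 < e / 2 by rewrite divr_gt0.
  have [c c0 hc] := fh _ e2.
  rewrite near_withinE; exists c => //= h; rewrite /ball_ /= sub0r normrN => he h0.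
  have hp : 0 < `|h| by rewrite normr_gt0.
  rewrite -(ltr_pM2l hp) -normrM [h%:A]mulr1.
  have -> : h * (d - h^-1 *: (f (h + t) - f t)) = - (f (t + h) - f t - h * d).
    by rewrite /GRing.scale /= (addrC h) mulrBr mulrA divff// mul1r; ring.
  rewrite normrN; apply: le_lt_trans (hc h he) _.
  by rewrite mulrC ltr_pM2l//; lra.
have dv : derivable f t 1 by apply/cvg_ex; exists d.
by split=> //; rewrite /derive; apply: cvg_lim.
Qed.

Lemma is_derive_continuous (f : R -> R) (t d : R) : is_derive t 1 f d -> {for t, continuous f}.
Proof. by move=> [df _]; apply/differentiable_continuous/derivable1_diffP. Qed.

Lemma monotone_le (f f' : R -> R) (s t : R) : s <= t ->
  (forall r, s <= r <= t -> is_derive r 1 f (f' r)) ->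
  (forall r, s <= r <= t -> f' r <= 0) -> f t <= f s.
Proof.
move=> st df f'0.
have oc r : r \in `]s, t[ -> s <= r <= t by rewrite in_itv/= => /andP[? ?]; rewrite !ltW.
apply: (@ler0_derive1_nincr _ f s t) => //.
- by move=> r /oc/df[].
- by move=> r /oc rt; rewrite derive1E; have [_ ->] := df r rt; exact: f'0.
- apply: continuous_in_subspaceT => r; rewrite inE/= in_itv/= => /df.
  exact: is_derive_continuous.
Qed.

Lemma is_derive_delay (f : R -> R) (t c d : R) : is_derive (t - c) 1 f d ->
  is_derive t 1 (fun r => f (r - c)) d.
Proof.
move=> df.
have ds : is_derive t 1 (fun r : R => r - c) 1.
  by have := is_deriveB (is_derive_id t 1) (is_derive_cst c t 1); rewrite subr0.
by have := @is_derive1_comp _ f (fun r => r - c) t _ _ df ds; rewrite mulr1.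
Qed.

Lemma continuous_antiderivative (g : R -> R) (s : R) : continuous g ->
  exists G : R -> R, forall t, s < t -> is_derive t 1 G (g t).
Proof.
move=> cg; exists (fun t => \int[mu]_(r in `[s, t]) g r) => t st.
have [||dG eG] := @continuous_FTC1_closed R g s t (t + 1) _ _ st (cg t).
- by rewrite ltrDl.
- apply: continuous_compact_integrable; first exact: segment_compact.
  exact: continuous_subspaceT.
by split; [exact: dG|rewrite -derive1E; exact: eG].
Qed.

End real_calculus.

Section vector_calculus.
Context {R : realType} {H : completeNormedModType R[i]}.
Ltac vec := lmod (R[i] : comPzRingType) (H : Type).
Variable dot : {dot H for Num.conj}.
Hypothesis norm_dot : forall x : H, `|x| ^+ 2 = dot x x.
Local Notation ip := (rdot dot).
Implicit Types f g : R -> H.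

(** Differentiability along the real line of functions with values in a complex
    space, which carries no real normed structure of its own. *)
Definition vderive (t : R) f (d : H) : Prop :=
  forall e : R, 0 < e -> exists2 c : R, 0 < c & forall h : R, `|h| < c ->
    nm (f (t + h) - f t - h%:C *: d) <= e * `|h|.

Lemma vderive_lin (k l : R) t f g d d' : vderive t f d -> vderive (t : R) g d' ->
  vderive t (fun r => k%:C *: f r + l%:C *: g r) (k%:C *: d + l%:C *: d').
Proof.
move=> df dg e e0; pose M := `|k| + `|l| + 1.
have M0 : 0 < M by rewrite ltr_wpDl// addr_ge0.
have e1 : 0 < e / M by rewrite divr_gt0.
have [c c0 hc] := df _ e1; have [c' c'0 hc'] := dg _ e1.
exists (Num.min c c'); first by rewrite lt_min c0.
move=> h; rewrite lt_min => /andP[h1 h2].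
have -> : k%:C *: f (t + h) + l%:C *: g (t + h) - (k%:C *: f t + l%:C *: g t) -
    h%:C *: (k%:C *: d + l%:C *: d') =
  k%:C *: (f (t + h) - f t - h%:C *: d) + l%:C *: (g (t + h) - g t - h%:C *: d') by vec.
apply: le_trans (nmD _ _) _; rewrite !nmZr.
have a1 := ler_wpM2l (normr_ge0 k) (hc h h1); have a2 := ler_wpM2l (normr_ge0 l) (hc' h h2).
apply: le_trans (lerD a1 a2) _; rewrite -mulrDl mulrA ler_wpM2r//.
apply: (@le_trans _ _ (M * (e / M))); first by rewrite ler_wpM2r ?(ltW e1)// /M; lra.
by rewrite mulrC divfK// gt_eqF.
Qed.

Lemma vderive_shift t f (c : R) d : vderive (t - c) f d -> vderive (t : R) (fun r => f (r - c)) d.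
Proof.
move=> df e /df[c' c'0 hc']; exists c' => // h /hc'.
by rewrite (addrAC t h).
Qed.

Lemma vderive_cst t (x : H) : vderive (t : R) (fun=> x) 0.
Proof.
move=> e e0; exists 1 => // h _; rewrite subrr scaler0 subr0 nm0.
by rewrite mulr_ge0// ltW.
Qed.

Lemma vderive_scale (t : R) (x : H) (k : R -> R) (d : R) : is_derive t 1 k d ->
  vderive t (fun r => (k r)%:C *: x) (d%:C *: x).
Proof.
move=> dk e e0.
have n1 : 0 < nm x + 1 by rewrite ltr_wpDl// nm_ge0.
have e1 : 0 < e / (nm x + 1) by rewrite divr_gt0.
have [dv dE] := dk.
have : h^-1 *: (k (h *: (1 : R) + t) - k t) @[h --> (0 : R)^'] --> d.
  by rewrite -dE; exact: dv.
move=> /cvgrPdist_lt/(_ _ e1); rewrite near_withinE => -[c /= c0 hc].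
exists c => // h hlt.
have -> : (k (t + h))%:C *: x - (k t)%:C *: x - h%:C *: (d%:C *: x) =
  (k (t + h) - k t - h * d)%:C *: x by rewrite !rmorphB /= rmorphM /=; vec.
rewrite nmZr; have [->|h0] := eqVneq h 0.
  by rewrite addr0 subrr mul0r subr0 normr0 mul0r mulr0.
have := hc h; rewrite /ball_ /= sub0r normrN => /(_ hlt h0).
rewrite [h%:A]mulr1 => hk.
have -> : k (t + h) - k t - h * d = - (h * (d - h^-1 *: (k (h + t) - k t))).
  by rewrite /GRing.scale /= (addrC h) mulrBr mulrA divff// mul1r; ring.
rewrite normrN normrM -mulrA (mulrC e) ler_wpM2l//.
apply: (@le_trans _ _ (e / (nm x + 1) * nm x)); first by rewrite ler_wpM2r ?nm_ge0 ?(ltW hk).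
by rewrite mulrAC ler_pdivrMr// ler_wpM2l ?(ltW e0)//; lra.
Qed.

Lemma is_derive_ip (t : R) f g d d' : vderive t f d -> vderive t g d' ->
  is_derive t 1 (fun r => ip (f r) (g r)) (ip d (g t) + ip (f t) d').
Proof.
move=> df dg; apply: is_derive_eps => e e0.
have nf := nm_ge0 (f t); have ng := nm_ge0 (g t); have nd := nm_ge0 d; have nd' := nm_ge0 d'.
pose M := 1 + nm (f t) + nm (g t) + nm d + 2 * nm d' + nm d * nm d'.
have M0 : 0 < M by rewrite /M; have := mulr_ge0 nd nd'; lra.
pose e1 := Num.min 1 (e / (3 * M)).
have e10 : 0 < e1 by rewrite lt_min ltr01 divr_gt0// mulr_gt0.
have [e11 e1M] : e1 <= 1 /\ e1 <= e / (3 * M) by rewrite !ge_min !lexx orbT.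
have [c c0 hc] := df _ e10; have [c' c'0 hc'] := dg _ e10.
exists (Num.min (Num.min c c') e1); first by rewrite lt_min e10 andbT lt_min c0.
move=> h; rewrite lt_min => /andP[]; rewrite lt_min => /andP[h1 h2] h3.
have := hc h h1; have := hc' h h2.
set al := f (t + h) - _ - _; set be := g (t + h) - _ - _ => nb na.
have h0 := normr_ge0 h.
have fE : f (t + h) = f t + h%:C *: d + al by rewrite /al; vec.
have gE : g (t + h) = g t + h%:C *: d' + be by rewrite /be; vec.
clearbody al be; rewrite fE gE !(ipDl, ipDr) !(ipZl, ipZr).
set x := _ - _ - _.
have -> : x = h * h * ip d d' + ip al (g t) + h * ip al d' + ip al be + ip (f t) be + h * ip d be.
  by rewrite /x; ring.
have b1 : `|h * h * ip d d'| <= `|h| * e1 * (nm d * nm d').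
  rewrite !normrM; apply: ler_pM; rewrite ?mulr_ge0//; last exact: ip_abs.
  by rewrite ler_wpM2l// ltW.
have b2 : `|ip al (g t)| <= `|h| * e1 * nm (g t).
  by apply: le_trans (ip_abs norm_dot _ _) _; rewrite ler_wpM2r// mulrC.
have b3 : `|h * ip al d'| <= `|h| * e1 * nm d'.
  rewrite normrM -mulrA ler_wpM2l//; apply: le_trans (ip_abs norm_dot _ _) _.
  rewrite ler_wpM2r//; apply: le_trans na _; rewrite ler_piMr ?(ltW e10)//.
  exact: le_trans (ltW h3) e11.
have b4 : `|ip al be| <= `|h| * e1 * 1.
  apply: le_trans (ip_abs norm_dot _ _) _; rewrite mulr1 mulrC.
  have : nm be <= 1.
    by apply: le_trans nb _; apply: mulr_ile1 => //; [exact: ltW|exact: le_trans (ltW h3) e11].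
  move=> be1; apply: (@le_trans _ _ (1 * nm al)); first by rewrite ler_wpM2r ?nm_ge0.
  by rewrite mul1r mulrC.
have b5 : `|ip (f t) be| <= `|h| * e1 * nm (f t).
  by apply: le_trans (ip_abs norm_dot _ _) _; rewrite mulrC ler_wpM2r// mulrC.
have b6 : `|h * ip d be| <= `|h| * e1 * nm d.
  rewrite normrM -mulrA ler_wpM2l//; apply: le_trans (ip_abs norm_dot _ _) _.
  rewrite mulrC ler_wpM2r//; apply: le_trans nb _; rewrite ler_piMr ?(ltW e10)//.
  exact: le_trans (ltW h3) e11.
have tri6 (x1 x2 x3 x4 x5 x6 : R) : `|x1 + x2 + x3 + x4 + x5 + x6| <=
    `|x1| + `|x2| + `|x3| + `|x4| + `|x5| + `|x6|.
  by do 4 (apply: le_trans (ler_normD _ _) _; rewrite lerD2r); exact: ler_normD.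
apply: le_trans (tri6 _ _ _ _ _ _) _.
apply: (@le_trans _ _ (`|h| * e1 * M)).
  rewrite /M; have := mulr_ge0 (mulr_ge0 h0 (ltW e10)) nd'; lra.
rewrite mulrC mulrCA (mulrC e) ler_wpM2l//.
apply: (@le_trans _ _ (M * (e / (3 * M)))); first by rewrite ler_wpM2l// ltW.
by rewrite (_ : M * _ = e / 3); [lra|field; rewrite gt_eqF].
Qed.

Lemma is_derive_nm2 (t : R) f d : vderive t f d ->
  is_derive t 1 (fun r => nm (f r) ^+ 2) (2 * ip (f t) d).
Proof.
move=> df; have := is_derive_ip df df; rewrite (ipC _ d) -mulr2n mulr_natl.
by under eq_fun do rewrite -nm2//.
Qed.

(** The Cauchy-Schwarz bound of an increment by the integral of the squared
    speed, stated with any function growing faster than that integral. *)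
Lemma energy_increment f f' (q q' : R -> R) (s t : R) : s <= t ->
  (forall r, s <= r <= t -> vderive r f (f' r)) ->
  (forall r, s <= r <= t -> is_derive r 1 q (q' r)) ->
  (forall r, s <= r <= t -> nm (f' r) ^+ 2 <= q' r) ->
  nm (f t - f s) ^+ 2 <= (t - s) * (q t - q s).
Proof.
rewrite le_eqVlt => /predU1P[->|st] df dq fq.
  by rewrite !subrr nm0 expr0n mul0r.
have st0 : 0 < t - s by rewrite subr_gt0.
set y := f t - f s; pose l := t - s.
pose k r := ip (f r) y - (l / 2 * q r + nm y ^+ 2 / (2 * l) * r).
have dk r : s <= r <= t -> is_derive r 1 k (ip (f' r) y - (l / 2 * q' r + nm y ^+ 2 / (2 * l))).
  move=> rt; have d1 := is_derive_ip (df r rt) (vderive_cst r y); rewrite ip0r addr0 in d1.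
  have d2 := is_deriveZ (l / 2) (dq r rt).
  have d3 := is_deriveZ (nm y ^+ 2 / (2 * l)) (is_derive_id r 1).
  have := is_deriveB d1 (is_deriveD d2 d3); rewrite [_ *: (1 : R)]mulr1; exact.
have := monotone_le (ltW st) dk; rewrite /k => mono.
have {}mono : ip (f t) y - (l / 2 * q t + nm y ^+ 2 / (2 * l) * t) <=
    ip (f s) y - (l / 2 * q s + nm y ^+ 2 / (2 * l) * s).
  apply: mono => r rt; have := ip_young norm_dot (f' r) y st0; rewrite -/l.
  have := ler_wpM2l (_ : 0 <= l / 2) (fq r rt); rewrite divr_ge0 ?(ltW st0)// => /(_ isT).
  lra.
have e1 : ip (f t) y - ip (f s) y = nm y ^+ 2 by rewrite -ipBl -/y -nm2.
have e2 : nm y ^+ 2 / (2 * l) * t - nm y ^+ 2 / (2 * l) * s = nm y ^+ 2 / 2.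
  by rewrite /l; field; rewrite gt_eqF.
have e3 : l * (q t - q s) = (l / 2 * q t - l / 2 * q s) * 2 by field.
rewrite e3; lra.
Qed.

End vector_calculus.

(** * The Lyapunov functional *)

Section lyapunov.
Context {R : realType} {H : completeNormedModType R[i]}.
Ltac vec := lmod (R[i] : comPzRingType) (H : Type).
Variable dot : {dot H for Num.conj}.
Hypothesis norm_dot : forall x : H, `|x| ^+ 2 = dot x x.
Local Notation ip := (rdot dot).
Local Notation vderive := (@vderive R H).
Variables (c1 c2 kap tau a : R).
Hypotheses (c1_gt0 : 0 < c1) (c2_gt0 : 0 < c2) (kap_gt0 : 0 < kap) (tau_gt0 : 0 < tau).
Hypothesis a_ge_tau : tau <= a.

Definition rate_k1 : R := c1^-1 ^+ 2.
(** Chosen so that [rate_N * tau ^+ 2 / 4] leaves [- |P|^2] after absorbing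
    [|v|^2 <= rate_k1 * |P|^2]. *)
Definition rate_N : R := 4 * (rate_k1 + 1) / tau ^+ 2.
(** Coefficient of the variation [D] in the derivative of [lyap_Psi]. *)
Definition rate_K1 : R := 2 * tau * rate_N + 2 * tau * (1 + rate_N) ^+ 2.
(** Bound of the ratio of [lyap_Psi] to [lyap_F]. *)
Definition rate_K2 : R := 1 + rate_k1 + (a - tau) + rate_N + rate_N * tau ^+ 2.
Definition rate_eps : R := Num.min (2^-1 / rate_K1) (Num.min (kap / 2 / c2 ^+ 2) (2^-1 / rate_K2)).
Definition decay_rate : R := 2 / 3 * Num.min (Num.min rate_eps kap)
  (Num.min (rate_eps / (rate_k1 / 2 + tau ^+ 2)) ((4 * tau)^-1)).

Let k1_gt0 : 0 < rate_k1. Proof. by rewrite exprn_gt0// invr_gt0. Qed.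
Let N_gt0 : 0 < rate_N. Proof. by rewrite divr_gt0 ?exprn_gt0// mulr_gt0// ltr_wpDl// ltW. Qed.
Let K1_gt0 : 0 < rate_K1.
Proof.
have N1 : 0 < 1 + rate_N by rewrite addr_gt0.
have tau2 : 0 < 2 * tau by rewrite mulr_gt0.
by apply: addr_gt0; apply: mulr_gt0 => //; exact: exprn_gt0.
Qed.
Let K2_gt0 : 0 < rate_K2.
Proof.
have aN : 0 <= a - tau by rewrite subr_ge0.
have := mulr_gt0 N_gt0 (exprn_gt0 2 tau_gt0); have := k1_gt0; have := N_gt0.
by rewrite /rate_K2 => ? ? ?; lra.
Qed.
Let eps_gt0 : 0 < rate_eps.
Proof.
have h : 0 < 2^-1 :> R by rewrite invr_gt0.
have c22 : 0 < c2 ^+ 2 by rewrite exprn_gt0.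
by rewrite !lt_min; apply/and3P; split; apply: divr_gt0 => //; exact: divr_gt0.
Qed.

Let kp_gt0 : 0 < rate_k1 / 2 + tau ^+ 2.
Proof. by apply: addr_gt0; [exact: divr_gt0|exact: exprn_gt0]. Qed.

Lemma decay_rate_gt0 : 0 < decay_rate.
Proof.
have lm (x y : R) : 0 < x -> 0 < y -> 0 < Num.min x y by rewrite lt_min => -> ->.
apply: mulr_gt0; first exact: divr_gt0.
apply: (lm); apply: (lm) => //; first exact: divr_gt0.
by rewrite invr_gt0 mulr_gt0.
Qed.

Variables (u v th X P W v' th' : R -> H) (Q I : R -> R).
Hypothesis du : forall t : R, tau <= t -> vderive t u (v t).
Hypothesis dv : forall t : R, tau <= t -> vderive t v (v' t).
Hypothesis dth : forall t : R, tau <= t -> vderive t th (th' t).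
Hypothesis dX : forall t : R, tau <= t -> vderive t X (P t).
Hypothesis dW : forall t : R, tau <= t -> vderive t W (X t).
Hypothesis dQ : forall t : R, tau <= t -> is_derive t 1 Q (nm (P t) ^+ 2).
Hypothesis dI : forall t : R, tau <= t -> is_derive t 1 I (Q t).
Hypothesis u_le : forall t : R, tau <= t -> nm (u t) ^+ 2 <= rate_k1 * nm (X t) ^+ 2.
Hypothesis v_le : forall t : R, tau <= t -> nm (v t) ^+ 2 <= rate_k1 * nm (P t) ^+ 2.
Hypothesis dissipation : forall t : R, 2 * tau <= t ->
  ip (v' t) (v t) + ip (th' t) (th t) <=
  - ip (X (t - tau)) (P t) - a * nm (P t) ^+ 2 - kap * nm (th t) ^+ 2.
Hypothesis v_balance : forall t : R, 2 * tau <= t ->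
  ip (v' t) (u t) <= - ip (X (t - tau)) (X t) - a * ip (P t) (X t) + c2 * (nm (th t) * nm (X t)).

Let Q_mono (s t : R) : tau <= s -> s <= t -> Q s <= Q t.
Proof.
move=> s0 st; rewrite -lerN2.
apply: (@monotone_le _ (fun r => - Q r) (fun r => - nm (P r) ^+ 2)) => // r /andP[sr _].
  by apply: is_deriveN; apply: dQ; exact: le_trans sr.
by rewrite oppr_le0 sqr_ge0.
Qed.

(** The memory term is the integral of [Q r - Q s] for [s] from [r - tau] to [r];
    adding its derivative [tau * |P r|^2 - (Q r - Q (r - tau))] turns the delayed
    term of the energy balance into minus the variation of [P] over the delay, up
    to a multiple of [|P r|^2]. *)
Definition lyap_F (r : R) : R :=
  2^-1 * (nm (v r) ^+ 2 + nm (X r) ^+ 2 + nm (th r) ^+ 2 + (tau * Q r - I r + I (r - tau))).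
(** The integral of [X r - X s] for [s] from [r - tau] to [r]; its derivative is
    [tau * P r - (X r - X (r - tau))]. *)
Definition lyap_w (r : R) : H :=
  tau%:C *: X r + (-1)%:C *: (1%:C *: W r + (-1)%:C *: W (r - tau)).
Definition lyap_Psi (r : R) : R :=
  ip (v r) (u r) + (a - tau) / 2 * nm (X r) ^+ 2 - rate_N * ip (lyap_w r) (X r).
Definition lyap_L (r : R) : R := lyap_F r + rate_eps * lyap_Psi r.

Section window.
Variable t : R.
Hypothesis t2 : 2 * tau <= t.

Let b : H := X t - X (t - tau).
Let e : H := tau%:C *: P t - b.
Let dq : R := Q t - Q (t - tau).
(* [2 * D] is the integral of [|P r - P t|^2] over the window *)
Let D : R := (dq - 2 * ip b (P t) + tau * nm (P t) ^+ 2) / 2.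
Let m : R := tau * Q t - I t + I (t - tau).
Let w : H := tau%:C *: X t - (W t - W (t - tau)).

Let win (r : R) : t - tau <= r <= t -> tau <= r.
Proof. by move=> /andP[h _]; have := t2; lra. Qed.
Let le_win : t - tau <= t. Proof. by rewrite gerBl ltW. Qed.
Let et : t - (t - tau) = tau. Proof. by ring. Qed.
Let t1 : tau <= t. Proof. by have := tau_gt0; have := t2; lra. Qed.

Let X_increment (r : R) : t - tau <= r <= t -> nm (X t - X r) ^+ 2 <= (t - r) * (Q t - Q r).
Proof.
move=> rt; have [h1 h2] := andP rt.
apply: (energy_increment norm_dot h2 (f' := P) (q' := fun r => nm (P r) ^+ 2)) => // s /andP[rs st].
  by apply: dX; apply: win; rewrite st (le_trans h1).
by apply: dQ; apply: win; rewrite st (le_trans h1).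
Qed.

Let endpoint : t - tau <= t - tau <= t. Proof. by rewrite lexx le_win. Qed.

Let e_le : nm e ^+ 2 <= 2 * tau * D.
Proof.
have := X_increment endpoint; rewrite et -/b -/dq => h.
rewrite /e (nmB2 norm_dot) nmZr (gtr0_norm tau_gt0) exprMn ipZl (ipC dot _ b) /D.
have -> : 2 * tau * ((dq - 2 * ip b (P t) + tau * nm (P t) ^+ 2) / 2) =
  tau * dq - 2 * (tau * ip b (P t)) + tau ^+ 2 * nm (P t) ^+ 2 by field.
lra.
Qed.

Let D_ge0 : 0 <= D.
Proof. by have := le_trans (sqr_ge0 _) e_le; rewrite pmulr_rge0// mulr_gt0. Qed.

(* Increments of [X r - r P(t)], whose speed measures the variation of [P]. *)
Let drift_increment (r : R) : t - tau <= r <= t ->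
  nm (X t - X r - (t - r)%:C *: P t) ^+ 2 <= 2 * tau * D.
Proof.
move=> rt; have [h1 h2] := andP rt.
pose f (s : R) : H := 1%:C *: X s + (-1)%:C *: (s%:C *: P t).
pose f' (s : R) : H := 1%:C *: P s + (-1)%:C *: (1%:C *: P t).
pose q (s : R) := Q s - 2 * ip (X s) (P t) + nm (P t) ^+ 2 * s.
have df (s : R) : t - tau <= s <= t -> vderive s f (f' s).
  move=> st; apply: vderive_lin; first by apply: dX; exact: win.
  by apply: vderive_scale; exact: is_derive_id.
have dq' (s : R) : t - tau <= s <= t -> is_derive s 1 q (nm (f' s) ^+ 2).
  move=> st; have d1 := dQ (win st).
  have d2 := is_derive_ip norm_dot (dX (win st)) (vderive_cst s (P t)).
  have d3 := is_deriveD (is_deriveB d1 (is_deriveZ (2 : R) d2)) (is_deriveZ (nm (P t) ^+ 2) (is_derive_id s (1 : R))).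
  apply: (is_derive_eq d3); rewrite /f'.
  have -> : 1%:C *: P s + (-1)%:C *: (1%:C *: P t) = P s - P t :> H by rewrite !scale1r; vec.
  rewrite (nmB2 norm_dot) ip0r addr0 [_ *: (1 : R)]mulr1.
  by rewrite /GRing.scale /=; ring.
have sub (s : R) : r <= s <= t -> t - tau <= s <= t.
  by move=> /andP[rs st]; rewrite st (le_trans h1 rs).
have inc := energy_increment norm_dot h2 (fun s st => df s (sub s st)) (fun s st => dq' s (sub s st))
  (fun s _ => lexx _).
have -> : X t - X r - (t - r)%:C *: P t = f t - f r.
  by rewrite /f !scale1r rmorphB /=; vec.
apply: le_trans inc _.
have qmono : q (t - tau) <= q r.
  rewrite -lerN2; apply: (@monotone_le _ (fun r => - q r) (fun r => - nm (f' r) ^+ 2)) => // s /andP[a1 a2].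
    by apply: is_deriveN; apply: dq'; rewrite a1 (le_trans a2).
  by rewrite oppr_le0 sqr_ge0.
have q2D : q t - q (t - tau) = 2 * D.
  by rewrite /q /D /dq /b ipBl; field.
have -> : 2 * tau * D = tau * (2 * D) by ring.
have qt : q r <= q t.
  rewrite -lerN2; apply: (@monotone_le _ (fun r => - q r) (fun r => - nm (f' r) ^+ 2)) => // s /sub st.
    by apply: is_deriveN; exact: dq'.
  by rewrite oppr_le0 sqr_ge0.
by apply: ler_pM; rewrite ?subr_ge0//; lra.
Qed.

(* second order Taylor estimate: the integral over the window of the increments
   bounded by [drift_increment] *)
Let w_P : nm (w - (tau ^+ 2 / 2)%:C *: P t) ^+ 2 <= 2 * tau ^+ 3 * D.
Proof.
pose f (s : R) : H := 1%:C *: (1%:C *: (s%:C *: X t) + (-1)%:C *: W s) + (-1)%:C *: ((t * s - s ^+ 2 / 2)%:C *: P t).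
pose f' (s : R) : H := 1%:C *: (1%:C *: (1%:C *: X t) + (-1)%:C *: X s) + (-1)%:C *: ((t - s)%:C *: P t).
have dk (s : R) : is_derive s 1 (fun s : R => t * s - s ^+ 2 / 2) (t - s).
  apply: (@is_derive_quadratic _ _ _ _ 2^-1) => // h.
  rewrite (_ : _ - _ - _ = - (2^-1 * h ^+ 2)); last by field.
  by rewrite normrN ger0_norm// mulr_ge0// sqr_ge0.
have df (s : R) : t - tau <= s <= t -> vderive s f (f' s).
  move=> st; apply: vderive_lin.
    apply: vderive_lin; last by apply: dW; exact: win.
    by apply: vderive_scale; exact: is_derive_id.
  exact: vderive_scale.
have dl (s : R) : is_derive s 1 (fun s : R => 2 * tau * D * s) (2 * tau * D).
  have := is_deriveZ (2 * tau * D) (is_derive_id s (1 : R)).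
  by rewrite [_ *: (1 : R)]mulr1.
have := energy_increment norm_dot le_win df (fun s _ => dl s).
have -> : f t - f (t - tau) = w - (tau ^+ 2 / 2)%:C *: P t.
  rewrite /f /w.
  have -> : t * t - t ^+ 2 / 2 = t ^+ 2 / 2 by field.
  have -> : t * (t - tau) - (t - tau) ^+ 2 / 2 = t ^+ 2 / 2 - tau ^+ 2 / 2 by field.
  by rewrite !rmorphB /= !scale1r; vec.
rewrite et => h; apply: le_trans (h _) _ => [s st|].
  have -> : f' s = X t - X s - (t - s)%:C *: P t by rewrite /f' !scale1r; vec.
  exact: drift_increment.
by rewrite le_eqVlt; apply/orP; left; apply/eqP; ring.
Qed.

(* the speed of [f] is bounded by [tau * (Q t - Q s)], whose integral is [tau * m] *)
Let w_m : nm w ^+ 2 <= tau ^+ 2 * m.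
Proof.
pose f (s : R) : H := 1%:C *: (s%:C *: X t) + (-1)%:C *: W s.
pose f' (s : R) : H := 1%:C *: (1%:C *: X t) + (-1)%:C *: X s.
have df (s : R) : t - tau <= s <= t -> vderive s f (f' s).
  move=> st; apply: vderive_lin; last by apply: dW; exact: win.
  by apply: vderive_scale; exact: is_derive_id.
have dk (s : R) : t - tau <= s <= t -> is_derive s 1 (fun s => tau * (Q t * s - I s)) (tau * (Q t - Q s)).
  move=> st; have d1 := is_deriveB (is_deriveZ (Q t) (is_derive_id s (1 : R))) (dI (win st)).
  rewrite [_ *: (1 : R)]mulr1 in d1; exact: (is_deriveZ tau d1).
have := energy_increment norm_dot le_win df dk.
have -> : f t - f (t - tau) = w by rewrite /f /w !rmorphB /= !scale1r; vec.
rewrite et => h; apply: le_trans (h _) _ => [s st|].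
  have -> : f' s = X t - X s by rewrite /f' !scale1r; vec.
  apply: le_trans (X_increment st) _; have [s1 s2] := andP st.
  by rewrite ler_wpM2r ?subr_ge0 ?Q_mono ?win//; lra.
by rewrite le_eqVlt; apply/orP; left; apply/eqP; rewrite /m; ring.
Qed.

Let m_ge0 : 0 <= m.
Proof. by have := le_trans (sqr_ge0 _) w_m; rewrite pmulr_rge0// exprn_gt0. Qed.

Let m_le : m <= tau * dq.
Proof.
have h : I (t - tau) - I t <= - (tau * Q (t - tau)).
  have := @monotone_le _ (fun r => Q (t - tau) * r - I r) (fun r => Q (t - tau) - Q r) _ _ le_win.
  move=> mono; have {}mono : Q (t - tau) * t - I t <= Q (t - tau) * (t - tau) - I (t - tau).
    apply: mono => r rt; last by rewrite subr_le0 Q_mono//; [exact: win endpoint|case/andP: rt].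
    have := is_deriveB (is_deriveZ (Q (t - tau)) (is_derive_id r (1 : R))) (dI (win rt)).
    by rewrite [_ *: (1 : R)]mulr1.
  lra.
by rewrite /m /dq; lra.
Qed.

Let dq_le : dq <= 4 * D + 2 * tau * nm (P t) ^+ 2.
Proof.
have h := e_le.
have y := ip_young norm_dot (- e) (P t) (_ : 0 < tau^-1).
rewrite invr_gt0 in y; have {}y := y tau_gt0.
rewrite nmN ipNl in y.
have y2 : tau^-1 / 2 * nm e ^+ 2 <= D.
  rewrite -(ler_pM2l (mulr_gt0 (ltr0n _ 2) tau_gt0)).
  rewrite (_ : 2 * tau * (tau^-1 / 2 * nm e ^+ 2) = nm e ^+ 2)//.
  by field; rewrite gt_eqF.
have y3 : nm (P t) ^+ 2 / (2 * tau^-1) = tau * nm (P t) ^+ 2 / 2 by field; rewrite gt_eqF.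
have y4 : ip e (P t) = tau * nm (P t) ^+ 2 - ip b (P t) by rewrite /e ipBl ipZl (nm2 norm_dot).
have y5 : 2 * D = dq - 2 * ip b (P t) + tau * nm (P t) ^+ 2 by rewrite /D; field.
lra.
Qed.

Let wE : lyap_w t = w. Proof. by rewrite /lyap_w /w scale1r; vec. Qed.

Let eps_K1 : rate_eps * rate_K1 <= 2^-1.
Proof. by rewrite -ler_pdivlMr// /rate_eps ge_min lexx. Qed.
Let eps_c2 : rate_eps * c2 ^+ 2 <= kap / 2.
Proof. by rewrite -ler_pdivlMr ?exprn_gt0// /rate_eps !ge_min lexx orbT. Qed.
Let eps_K2 : rate_eps * rate_K2 <= 2^-1.
Proof. by rewrite -ler_pdivlMr// /rate_eps !ge_min lexx !orbT. Qed.

Let rate_le : [/\ 3 / 2 * decay_rate <= rate_eps, 3 / 2 * decay_rate <= kap,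
  3 / 2 * decay_rate * (rate_k1 / 2 + tau ^+ 2) <= rate_eps & 3 / 2 * decay_rate * (4 * tau) <= 1].
Proof.
have -> : 3 / 2 * decay_rate = Num.min (Num.min rate_eps kap)
  (Num.min (rate_eps / (rate_k1 / 2 + tau ^+ 2)) ((4 * tau)^-1)) by rewrite /decay_rate; field.
have tau4 : 0 < 4 * tau by rewrite mulr_gt0.
have ml (x y : R) : Num.min x y <= x by rewrite ge_min lexx.
have mr (x y : R) : Num.min x y <= y by rewrite ge_min lexx orbT.
split.
- exact: le_trans (ml _ _) (ml _ _).
- exact: le_trans (ml _ _) (mr _ _).
- by rewrite -ler_pdivlMr//; exact: le_trans (mr _ _) (ml _ _).
- by rewrite -ler_pdivlMr// mul1r; exact: le_trans (mr _ _) (mr _ _).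
Qed.

Let F_ge0 : 0 <= lyap_F t.
Proof.
have v0 := sqr_ge0 (nm (v t)); have x0 := sqr_ge0 (nm (X t)); have h0 := sqr_ge0 (nm (th t)).
by have m0 := m_ge0; rewrite /lyap_F -/m; lra.
Qed.

Let Psi_le : `|lyap_Psi t| <= rate_K2 * lyap_F t.
Proof.
have v0 := sqr_ge0 (nm (v t)); have x0 := sqr_ge0 (nm (X t)); have h0 := sqr_ge0 (nm (th t)).
have m0 := m_ge0; have k0 := k1_gt0; have N0 := N_gt0.
have at0 : 0 <= a - tau by rewrite subr_ge0.
have b1 : `|ip (v t) (u t)| <= 2^-1 * nm (v t) ^+ 2 + 2^-1 * (rate_k1 * nm (X t) ^+ 2).
  apply: le_trans (ip_abs norm_dot _ _) _.
  have := sqr_ge0 (nm (v t) - nm (u t)); have := u_le t1; lra.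
have b2 : `|ip w (X t)| <= 2^-1 * (tau ^+ 2 * m) + 2^-1 * nm (X t) ^+ 2.
  apply: le_trans (ip_abs norm_dot _ _) _.
  have := sqr_ge0 (nm w - nm (X t)); have := w_m; lra.
rewrite /lyap_Psi wE.
apply: le_trans (ler_normB _ _) _; apply: le_trans (lerD (ler_normD _ _) (lexx _)) _.
rewrite (normrM rate_N) (gtr0_norm N0) (ger0_norm (_ : 0 <= (a - tau) / 2 * _)); last first.
  by rewrite mulr_ge0// divr_ge0.
have b3 := ler_wpM2l (ltW N0) b2.
apply: le_trans (lerD (lerD b1 (lexx _)) b3) _; rewrite /lyap_F -/m.
have -> : rate_K2 = 1 + rate_k1 + (a - tau) + rate_N + rate_N * tau ^+ 2 by [].
have p1 := mulr_ge0 (ltW k0) v0; have p2 := mulr_ge0 (ltW k0) h0; have p3 := mulr_ge0 (ltW k0) m0.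
have p4 := mulr_ge0 at0 v0; have p5 := mulr_ge0 at0 h0; have p6 := mulr_ge0 at0 m0.
have p7 := mulr_ge0 (ltW N0) v0; have p8 := mulr_ge0 (ltW N0) h0; have p9 := mulr_ge0 (ltW N0) m0.
have Nt0 : 0 <= rate_N * tau ^+ 2 by rewrite mulr_ge0 ?sqr_ge0// ltW.
have q1 := mulr_ge0 Nt0 v0; have q2 := mulr_ge0 Nt0 h0; have q3 := mulr_ge0 Nt0 x0.
lra.
Qed.

Lemma lyap_equiv : 2^-1 * lyap_F t <= lyap_L t <= 3 / 2 * lyap_F t.
Proof.
have F0 := F_ge0; have := Psi_le; rewrite ler_norml => /andP[h1 h2].
have e0 := ltW eps_gt0.
have a1 := ler_wpM2l e0 h1; have a2 := ler_wpM2l e0 h2.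
have a3 := ler_wpM2r F0 eps_K2.
by rewrite /lyap_L; apply/andP; split; lra.
Qed.

Let F' : R := ip (v' t) (v t) + ip (P t) (X t) + ip (th' t) (th t) +
  2^-1 * (tau * nm (P t) ^+ 2 - Q t + Q (t - tau)).
Let Psi' : R := ip (v' t) (u t) + nm (v t) ^+ 2 + (a - tau) * ip (P t) (X t) -
  rate_N * (ip e (X t) + ip w (P t)).

Let dF : is_derive t 1 lyap_F F'.
Proof.
have d1 := is_derive_nm2 norm_dot (dv t1); have d2 := is_derive_nm2 norm_dot (dX t1).
have d3 := is_derive_nm2 norm_dot (dth t1).
have d4 := is_deriveD (is_deriveB (is_deriveZ tau (dQ t1)) (dI t1))
  (@is_derive_delay _ I t tau _ (dI (win endpoint))).
have := is_deriveZ (2^-1 : R) (is_deriveD (is_deriveD (is_deriveD d1 d2) d3) d4).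
move=> d; apply: (is_derive_eq d).
by rewrite /F' /GRing.scale /= (ipC dot (v t)) (ipC dot (X t)) (ipC dot (th t)); field.
Qed.

Let dPsi : is_derive t 1 lyap_Psi Psi'.
Proof.
have d1 := is_derive_ip norm_dot (dv t1) (du t1).
have d2 := is_derive_nm2 norm_dot (dX t1).
have dw : vderive t lyap_w (tau%:C *: P t + (-1)%:C *: (1%:C *: X t + (-1)%:C *: X (t - tau))).
  apply: vderive_lin; first exact: dX.
  apply: vderive_lin; first exact: dW.
  apply: vderive_shift; apply: dW; exact: win endpoint.
have d3 := is_derive_ip norm_dot dw (dX t1).
have := is_deriveB (is_deriveD d1 (is_deriveZ ((a - tau) / 2) d2)) (is_deriveZ rate_N d3).
move=> d; apply: (is_derive_eq d).
have -> : tau%:C *: P t + (-1)%:C *: (1%:C *: X t + (-1)%:C *: X (t - tau)) = e.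
  by rewrite /e /b !scale1r; vec.
by rewrite wE /Psi' /GRing.scale /= (ipC dot (X t)) (nm2 norm_dot (v t)); field.
Qed.

Let p2 : R := nm (P t) ^+ 2.
Let x2 : R := nm (X t) ^+ 2.
Let h2 : R := nm (th t) ^+ 2.

Let F'_le : F' <= - (a - tau) * p2 - D - kap * h2.
Proof.
have h := dissipation t2.
have e1 : ip b (P t) = ip (X t) (P t) - ip (X (t - tau)) (P t) by rewrite /b ipBl.
have e2 := ipC dot (P t) (X t).
rewrite /F' /D /dq e1 e2 /p2 /h2; lra.
Qed.

Let Psi'_le : Psi' <= - p2 - x2 / 2 + rate_K1 * D + c2 ^+ 2 * h2.
Proof.
have N0 := N_gt0; have hb := v_balance t2; have he := e_le; have hw := w_P; have hv := v_le t1.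
have eX : - ((1 + rate_N) * ip e (X t)) <= (1 + rate_N) ^+ 2 * (2 * tau * D) + x2 / 4.
  have N1 : 0 < 1 + rate_N by lra.
  have l0 : 0 < 2 * (1 + rate_N) by lra.
  have := ip_young norm_dot (- e) (X t) l0; rewrite ipNl nmN => y.
  have {}y := ler_wpM2l (ltW N1) y.
  have e1 : (1 + rate_N) * (2 * (1 + rate_N) / 2 * nm e ^+ 2 + nm (X t) ^+ 2 / (2 * (2 * (1 + rate_N)))) =
     (1 + rate_N) ^+ 2 * nm e ^+ 2 + x2 / 4 by rewrite /x2; field; rewrite gt_eqF.
  rewrite e1 in y; have := ler_wpM2l (sqr_ge0 (1 + rate_N)) he; lra.
have wP : - ip w (P t) <= 2 * tau * D - tau ^+ 2 / 4 * p2.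
  set om := w - _ in hw.
  have l0 : 0 < 2 / tau ^+ 2 by rewrite divr_gt0 ?exprn_gt0.
  have := ip_young norm_dot (- om) (P t) l0; rewrite ipNl nmN => y.
  have e1 : 2 / tau ^+ 2 / 2 * nm om ^+ 2 + nm (P t) ^+ 2 / (2 * (2 / tau ^+ 2)) =
     (tau ^+ 2)^-1 * nm om ^+ 2 + tau ^+ 2 / 4 * p2 by rewrite /p2; field; rewrite gt_eqF.
  rewrite e1 in y.
  have i0 : 0 <= (tau ^+ 2)^-1 by rewrite invr_ge0 sqr_ge0.
  have y2 := ler_wpM2l i0 hw.
  have e2 : (tau ^+ 2)^-1 * (2 * tau ^+ 3 * D) = 2 * tau * D by field; rewrite gt_eqF.
  have e3 : ip om (P t) = ip w (P t) - tau ^+ 2 / 2 * p2 by rewrite /om ipBl ipZl /p2 -(nm2 norm_dot).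
  lra.
have wP' := ler_wpM2l (ltW N0) wP.
have e4 : rate_N * (2 * tau * D - tau ^+ 2 / 4 * p2) = 2 * tau * rate_N * D - (rate_k1 + 1) * p2.
  by rewrite /rate_N; field; rewrite gt_eqF.
have cx : c2 * (nm (th t) * nm (X t)) <= x2 / 4 + c2 ^+ 2 * h2.
  by have := sqr_ge0 (nm (X t) / 2 - c2 * nm (th t)); rewrite /x2 /h2; lra.
have e5 : ip e (X t) = tau * ip (P t) (X t) - x2 + ip (X (t - tau)) (X t).
  by rewrite /e /b ipBl ipZl ipBl /x2 (nm2 norm_dot); ring.
have e6 : rate_K1 * D = 2 * tau * rate_N * D + (1 + rate_N) ^+ 2 * (2 * tau * D).
  by rewrite /rate_K1; ring.
rewrite /Psi' e6; rewrite e4 in wP'; rewrite -/p2 in hv; lra.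
Qed.

(** The damping [- D] of [lyap_F] pays for the errors in the derivative of
    [lyap_Psi], which in return makes [|P|^2] and [|X|^2] available. *)
Lemma lyap_derivative : exists2 l, is_derive t 1 lyap_L l & l <= - (decay_rate * lyap_L t).
Proof.
exists (F' + rate_eps * Psi'); first exact: (is_deriveD dF (is_deriveZ rate_eps dPsi)).
have [r1 r2 r3 r4] := rate_le; have r0 := ltW decay_rate_gt0.
have /andP[_ LF] := lyap_equiv; have D0 := D_ge0; have hm := m_le; have hq := dq_le.
have e0 := ltW eps_gt0.
have p0 : 0 <= p2 by exact: sqr_ge0.
have x0 : 0 <= x2 by exact: sqr_ge0.
have h0 : 0 <= h2 by exact: sqr_ge0.
have at0 : 0 <= (a - tau) * p2 by rewrite mulr_ge0// subr_ge0.
have b1 := ler_wpM2l e0 Psi'_le.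
have b2 := ler_wpM2r D0 eps_K1; have b3 := ler_wpM2r h0 eps_c2.
have hF := F'_le.
have l_le : F' + rate_eps * Psi' <= - (2^-1 * D + kap / 2 * h2 + rate_eps * p2 + rate_eps / 2 * x2).
  lra.
apply: le_trans l_le _; rewrite lerN2.
have c1' := ler_wpM2l r0 LF; apply: le_trans c1' _.
have hv := v_le t1; rewrite -/p2 in hv.
have mq : m <= 4 * tau * D + 2 * tau ^+ 2 * p2.
  apply: le_trans hm _; have := ler_wpM2l (ltW tau_gt0) hq; rewrite -/p2; lra.
have FF : lyap_F t <= x2 / 2 + h2 / 2 + (rate_k1 / 2 + tau ^+ 2) * p2 + 2 * tau * D.
  by rewrite /lyap_F -/m -/x2 -/h2; lra.
have c0 : 0 <= 3 / 2 * decay_rate by rewrite mulr_ge0.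
have := ler_wpM2l c0 FF.
have s1 := ler_wpM2r x0 r1; have s2 := ler_wpM2r h0 r2; have s3 := ler_wpM2r p0 r3.
have s4 := ler_wpM2r D0 r4.
lra.
Qed.

Lemma lyap_energy : nm (v t) ^+ 2 + nm (X t) ^+ 2 + nm (th t) ^+ 2 <= 2 * lyap_F t /\
  2 * lyap_F t <= nm (v t) ^+ 2 + nm (X t) ^+ 2 + nm (th t) ^+ 2 + tau * (Q t - Q (t - tau)).
Proof. by have m0 := m_ge0; have hm := m_le; rewrite /lyap_F -/m -/dq; split; lra. Qed.

End window.

(** The comparison of [lyap_L] with the energy in both directions costs the factor
    [3]; the memory term is only needed at the initial time. *)
Lemma lyapunov_decay (t0 t : R) : 2 * tau <= t0 -> t0 <= t ->
  nm (v t) ^+ 2 + nm (X t) ^+ 2 + nm (th t) ^+ 2 <=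
  3 * (nm (v t0) ^+ 2 + nm (X t0) ^+ 2 + nm (th t0) ^+ 2 + tau * (Q t0 - Q (t0 - tau))) *
    expR (- (decay_rate * (t - t0))).
Proof.
move=> h0 ht; have h1 : 2 * tau <= t by exact: le_trans ht.
have /andP[E1 _] := lyap_equiv h1; have /andP[_ E2] := lyap_equiv h0.
have [e1 _] := lyap_energy h1; have [_ e2] := lyap_energy h0.
pose k (r : R) : R := expR (decay_rate * r) * lyap_L r.
have : k t <= k t0.
  have dex (r : R) : is_derive r 1 (fun r : R => expR (decay_rate * r)) (decay_rate * expR (decay_rate * r)).
    have d1 : is_derive r 1 (fun r : R => decay_rate * r) decay_rate.
      by have := is_deriveZ decay_rate (is_derive_id r (1 : R)); rewrite [_ *: (1 : R)]mulr1.
    have := @is_derive1_comp _ expR (fun r => decay_rate * r) r _ _ (is_derive_expR _) d1.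
    by rewrite mulrC.
  have ex (r : R) : exists l : R, t0 <= r <= t -> is_derive r 1 lyap_L l /\ l <= - (decay_rate * lyap_L r).
    have [rt|nr] := boolP (t0 <= r <= t); last by exists 0.
    by have [l dl hl] := @lyap_derivative r (le_trans h0 (andP rt).1); exists l.
  have [l hl] := choice ex.
  pose k' (r : R) : R := expR (decay_rate * r) * l r + lyap_L r * (decay_rate * expR (decay_rate * r)).
  have dk r : t0 <= r <= t -> is_derive r 1 k (k' r).
    by move=> /hl[dl _]; exact: (is_deriveM (dex r) dl).
  apply: (monotone_le ht dk) => r /hl[_ l_le].
  have -> : k' r = expR (decay_rate * r) * (l r + decay_rate * lyap_L r).
    by rewrite /k'; move: decay_rate (lyap_L r) (l r) (expR _) => *; ring.
  apply: mulr_ge0_le0; first exact: expR_ge0.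
  by move: l_le; move: (lyap_L r) (decay_rate) (l r) => *; lra.
rewrite /k; move: E1 E2; move: (lyap_L t0) (lyap_L t) => L0 Lt E1 E2 hk.
have : Lt <= L0 * expR (- (decay_rate * (t - t0))).
  have -> : expR (- (decay_rate * (t - t0))) = expR (decay_rate * t0) * expR (- (decay_rate * t)).
    by rewrite -expRD; congr expR; move: decay_rate => ?; ring.
  have := ler_wpM2r (expR_ge0 (- (decay_rate * t))) hk.
  have ee : expR (decay_rate * t) * expR (- (decay_rate * t)) = 1 by rewrite -expRD subrr expR0.
  by rewrite mulrAC ee mul1r mulrAC mulrC.
set x := expR _; have x0 : 0 <= x by exact: expR_ge0.
move=> hL; set A := (X in 3 * X * x).
have : L0 * x <= 3 / 4 * A * x by rewrite ler_wpM2r//; move: e2; rewrite -/A; lra.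
lra.
Qed.

End lyapunov.

(** * Exponential stability *)

Section auxiliary.
Context {R : realType} {H : completeNormedModType R[i]}.
Local Notation mu := (@lebesgue_measure R).
Local Notation RR := (measurableTypeR R).

Lemma q2_le_cst (z : R -> H) (c : R) : L2_01 z -> 0 <= c ->
  ae (fun t => I01 t -> nm (z t) ^+ 2 <= c) -> q2 z <= c.
Proof.
move=> /L2_rep[z' [mz iz ez]] c0 zc; rewrite -(q2_ae ez).
have -> : q2 z' = \int[mu]_(t in I01) Num.min (sq z' t) c.
  apply: Rintegral_null; apply: (aeS _ (aeI ez zc)) => t [e1 e2] It.
  by apply/esym/min_idPl; rewrite /sq e1// e2.
have Ic := integrable_cst01 c.
have IM : mu.-integrable I01 (EFin \o (fun t => Num.min (sq z' t) c)).
  apply: (le_integrable01 _ _ Ic).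
    by apply: measurable_minr; [exact: smeas_sq|exact: measurable_cst].
  by move=> t _; rewrite ger0_norm ?ge_min ?lexx ?orbT// le_min sq_ge0.
apply: (@le_trans _ _ (\int[mu]_(t in I01) (fun=> c) t)).
  by apply: (le_Rintegral mI01 IM Ic) => t _; rewrite ge_min lexx orbT.
rewrite /Rintegral (integral_cst mu mI01) [X in (_ * X)%E](_ : _ = 1%E) ?mule1//.
exact: I01_measure.
Qed.

Lemma continuous_max (f : R -> R) (c : R) : (forall t, c <= t -> {for t, continuous f}) ->
  continuous (fun t => f (Num.max t c)).
Proof.
move=> cf t; apply: (@continuous_comp _ _ _ (fun t => Num.max t c) f).
  apply: (@lip_continuous _ _ 1) => // s h; rewrite mul1r.
  case: (leP (s + h) c) => h1; case: (leP s c) => h2; rewrite ?subrr ?normr0//.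
  - by rewrite distrC ger0_norm; have := ler_norm (- h); rewrite normrN; lra.
  - by rewrite ger0_norm; have := ler_norm h; lra.
  - by rewrite addrAC subrr add0r.
by apply: cf; rewrite le_max lexx orbT.
Qed.

Lemma nm2_continuous (f : R -> H) (t : R) :
  (forall e : R, 0 < e -> exists2 d : R, 0 < d & forall h : R, `|h| < d -> nm (f (t + h) - f t) <= e) ->
  {for t, continuous (fun r => nm (f r) ^+ 2)}.
Proof.
move=> hf.
have c : {for t, continuous (fun r => nm (f r))}.
  apply/cvgrPdist_le => e e0; have [d d0 hd] := hf _ e0.
  exists d => //= s; rewrite /ball_ /= distrC => /hd.
  have -> : t + (s - t) = s by ring.
  move=> h.
  have a1 := nmD (f s - f t) (f t); have a2 := nmD (f t - f s) (f s).
  rewrite !subrK in a1 a2; rewrite (nmC (f t)) in a2.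
  by rewrite ler_norml; apply/andP; split; lra.
by under [X in {for _, continuous X}]eq_fun do rewrite expr2; exact: (continuousM c c).
Qed.

End auxiliary.

Section components.
Context {R : realType} {H : completeNormedModType R[i]}.
Variables (K : set (state H)) (p : state H -> R).
Hypothesis KP : banach K p.

(** Transfers the derivative of an orbit to its components. *)
Lemma component_derive (phi : state H -> H) (c : R) (f g : R -> state H) (t : R) : 0 < c ->
  (forall U, K U -> nm (phi U) <= c * p U) ->
  (forall U V, K U -> K V -> phi (U - V) = phi U - phi V) ->
  (forall (k : R) U, K U -> phi (k%:C *: U) = k%:C *: phi U) ->
  (forall r, 0 <= r -> K (f r)) -> K (g t) -> 0 < t ->
  (forall e : R, 0 < e -> exists2 d : R, 0 < d & forall h : R, `|h| < d ->
     0 <= t + h /\ p (f (t + h) - f t - h%:C *: g t) <= e * `|h|) ->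
  vderive t (fun r => phi (f r)) (phi (g t)).
Proof.
move=> c0 pb pB pZ Kf Kg t0 df e e0.
have ec : 0 < e / c by rewrite divr_gt0.
have [d d0 hd] := df _ ec; exists d => // h /hd[th hp].
have K1 := Kf _ th; have K2 := Kf _ (ltW t0).
rewrite -pB// -pZ// -pB//; [|exact: (KB KP)|exact: (KZ KP)].
apply: le_trans (pb _ _) _; first by apply: (KB KP); [exact: (KB KP)|exact: (KZ KP)].
have := ler_wpM2l (ltW c0) hp => /le_trans; apply.
by rewrite mulrA (mulrC c) divfK// gt_eqF.
Qed.

End components.

Section stability.
Context {R : realType} {H : completeNormedModType R[i]}.
Ltac vec := lmod (R[i] : comPzRingType) (H : Type).
Variables (dot : {dot H for Num.conj}) (A B C : uop H) (alpha tau a xi c1 c2 kap : R).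
Hypothesis norm_dot : forall x : H, `|x| ^+ 2 = dot x x.
Hypotheses (B_linear : linear_op B) (B_dense : densely_defined B).
Hypotheses (tau_gt0 : 0 < tau) (xi_gt0 : 0 < xi) (c1_gt0 : 0 < c1) (c2_gt0 : 0 < c2).
Hypotheses (kap_gt0 : 0 < kap) (a_ge_tau : tau <= a).
Local Notation ip := (rdot dot).
Local Notation Bs := (adjoint dot B).
Local Notation Cs := (adjoint dot C).
Local Notation Aa := (frac_power dot A alpha).
Local Notation K := (energy_space dot B).
Local Notation p := (energy_norm dot B xi).
Local Notation T := (delay_op dot A B C alpha tau a).
Hypothesis Bs_below : forall v, dom Bs v -> c1%:C * `|v| <= `|app Bs v|.
Hypothesis dom_C : dom Aa `<=` dom C.
Hypothesis dom_Cs : dom Bs `<=` dom Cs.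
Hypothesis Cs_bound : forall v, dom Bs v -> `|app Cs v| <= c2%:C * `|app Bs v|.
Hypothesis Aa_coercive : forall x, dom Aa x -> kap * nm x ^+ 2 <= ip (app Aa x) x.
Variable S : R -> state H -> state H.
Hypothesis SP : C0_semigroup K p S.
Hypothesis TP : infinitesimal_generator K p S T.

Let KP : banach K p.
Proof. exact: (energy_banach norm_dot B_linear B_dense xi_gt0 c1_gt0 Bs_below). Qed.

Let a_gt0 : 0 < a. Proof. exact: lt_le_trans a_ge_tau. Qed.

Section orbit.
Variable x : state H.
Hypothesis Tx : dom T x.

Let u (t : R) : H := (S t x).1.1.1.
Let v (t : R) : H := (S t x).1.1.2.
Let th (t : R) : H := (S t x).1.2.
Let X (t : R) : H := app Bs (u t).
Let P (t : R) : H := app Bs (v t).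
Let v' (t : R) : H := (app T (S t x)).1.1.2.
Let th' (t : R) : H := (app T (S t x)).1.2.

Let KO (t : R) : 0 <= t -> K (S t x).
Proof. by move=> t0; apply: (sg_stable SP t0); exact: (dom_K TP). Qed.

Let domO (t : R) : 0 <= t -> [/\ dom Bs (u t), dom Bs (v t) & dom Aa (th t)].
Proof.
move=> t0; have [[h1 h2 h3 _] _] := orbit_domP norm_dot B_linear B_dense xi_gt0 c1_gt0 Bs_below SP TP Tx t0.
by split.
Qed.

Let KT (t : R) : 0 <= t -> K (app T (S t x)).
Proof. by move=> t0; exact: (orbit_app_K KP SP TP Tx). Qed.

Let bnd := energy_norm_bounds B norm_dot xi_gt0.

Let phiX (U : state H) : H := app Bs U.1.1.1.

Let phiX_B U V : K U -> K V -> phiX (U - V) = phiX U - phiX V.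
Proof. by move=> KU KV; rewrite /phiX (energy_spaceB norm_dot B_linear B_dense KU KV).2. Qed.

Let phiX_Z (k : R) U : K U -> phiX (k%:C *: U) = k%:C *: phiX U.
Proof.
move=> /energy_spaceP[Uu _].
exact: (linZ k%:C (Bs_linear norm_dot B_linear B_dense) Uu).2.
Qed.

Let phiX_le U : K U -> nm (phiX U) <= 1 * p U.
Proof. by move=> _; rewrite mul1r; case: (bnd U). Qed.

Let du (t : R) : tau <= t -> vderive t u (v t).
Proof.
move=> taut; have t0 : 0 < t by exact: lt_le_trans taut.
have := @component_derive R H K p KP (fun U => U.1.1.1) c1^-1 (S^~ x) (fun t => app T (S t x)) t.
have -> : (app T (S t x)).1.1.1 = v t by have [] := delay_appE dot A B C alpha tau a (S t x).
apply => //; rewrite ?invr_gt0//.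
- move=> U /energy_spaceP[/(nm_le_Bs c1_gt0 Bs_below) h _]; apply: le_trans h _.
  by rewrite mulrC ler_wpM2l ?invr_ge0 ?(ltW c1_gt0)//; case: (bnd U).
- exact: KT (ltW t0).
- by move=> e e0; exact: (orbit_two_sided KP SP TP).
Qed.

Let dX (t : R) : tau <= t -> vderive t X (P t).
Proof.
move=> taut; have t0 : 0 < t by exact: lt_le_trans taut.
have := @component_derive R H K p KP phiX 1 (S^~ x) (fun t => app T (S t x)) t.
have -> : phiX (app T (S t x)) = P t.
  by rewrite /phiX /P /v; have [-> _ _ _] := delay_appE dot A B C alpha tau a (S t x).
apply => //; first exact: KT (ltW t0).
by move=> e e0; exact: (orbit_two_sided KP SP TP).
Qed.

Let dv (t : R) : tau <= t -> vderive t v (v' t).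
Proof.
move=> taut; have t0 : 0 < t by exact: lt_le_trans taut.
apply: (@component_derive R H K p KP (fun U => U.1.1.2) 1 (S^~ x) (fun t => app T (S t x)) t) => //.
- by move=> U _; rewrite mul1r; case: (bnd U).
- exact: KT (ltW t0).
- by move=> e e0; exact: (orbit_two_sided KP SP TP).
Qed.

Let dth (t : R) : tau <= t -> vderive t th (th' t).
Proof.
move=> taut; have t0 : 0 < t by exact: lt_le_trans taut.
apply: (@component_derive R H K p KP (fun U => U.1.2) 1 (S^~ x) (fun t => app T (S t x)) t) => //.
- by move=> U _; rewrite mul1r; case: (bnd U).
- exact: KT (ltW t0).
- by move=> e e0; exact: (orbit_two_sided KP SP TP).
Qed.

Let dW : exists W : R -> H, forall t : R, tau <= t -> vderive t W (X t).
Proof.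
have [Y [KY hY]] := antiderivative_two_sided KP SP (dom_K TP Tx).
exists (fun t => phiX (Y t)) => t taut; have t0 : 0 < t by exact: lt_le_trans taut.
apply: (@component_derive R H K p KP phiX 1 Y (S^~ x) t) => //; first exact: KO (ltW t0).
by move=> e e0; exact: hY.
Qed.

Let P_continuous (t : R) : tau <= t -> {for t, continuous (fun r => nm (P r) ^+ 2)}.
Proof.
move=> taut; have t0 : 0 < t by exact: lt_le_trans taut.
apply: nm2_continuous => e e0.
have [d d0 hd] := orbit_app_continuous KP SP TP (t + 1) Tx e0.
exists (Num.min d (Num.min t 1)); first by rewrite !lt_min d0 t0 ltr01.
move=> h; rewrite !lt_min => /and3P[h1 h2 h3].
have PE r : P r = phiX (app T (S r x)).
  by rewrite /phiX /P /v; have [-> _ _ _] := delay_appE dot A B C alpha tau a (S r x).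
have th0 : 0 <= t + h by move: h2; rewrite ltr_norml => /andP[? _]; lra.
have K1 := KT th0; have K2 := KT (ltW t0).
rewrite !PE -phiX_B//.
apply: le_trans (phiX_le (KB KP K1 K2)) _; rewrite mul1r.
move: h1 h3; rewrite !ltr_norml => /andP[h11 h12] /andP[h31 h32].
have [hp|hn] := leP 0 h; first by apply: hd; lra.
by rewrite (pBC KP)//; apply: hd; lra.
Qed.

Let dQ : exists Q I : R -> R, (forall t : R, tau <= t -> is_derive t 1 Q (nm (P t) ^+ 2)) /\
  (forall t : R, tau <= t -> is_derive t 1 I (Q t)).
Proof.
have half (t : R) : tau <= t -> tau / 2 < t by have := tau_gt0; lra.
have [Q hQ] := continuous_antiderivative (tau / 2) (continuous_max P_continuous).
have {}hQ (t : R) : tau <= t -> is_derive t 1 Q (nm (P t) ^+ 2).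
  by move=> taut; have := hQ t (half t taut); rewrite max_l.
have [I hI] := continuous_antiderivative (tau / 2) (continuous_max (fun t taut => is_derive_continuous (hQ t taut))).
exists Q, I; split=> // t taut.
by have := hI t (half t taut); rewrite max_l.
Qed.

Let hist (t : R) : tau <= t -> continuous_rep (S t x).2 1 = X (t - tau).
Proof.
move=> taut; have := orbit_history norm_dot B_linear B_dense tau_gt0 xi_gt0 c1_gt0 Bs_below SP TP Tx taut.
by move=> /(_ 1); rewrite mulr1; apply; rewrite ler01 lexx.
Qed.

Let v'_ip (t : R) y : tau <= t -> dom Bs y ->
  ip (v' t) y = - ip (X (t - tau)) (app Bs y) - a * ip (P t) (app Bs y) + ip (th t) (app Cs y).
Proof.
move=> taut By; have t0 : 0 <= t by exact: le_trans (ltW tau_gt0) taut.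
have [[_ _ dA _] [_ dB]] := orbit_domP norm_dot B_linear B_dense xi_gt0 c1_gt0 Bs_below SP TP Tx t0.
have -> : v' t = - app B (continuous_rep (S t x).2 1 + a%:C *: P t) + app C (th t).
  by have [_ h _ _] := delay_appE dot A B C alpha tau a (S t x).
rewrite addrC in dB.
rewrite ipDl ipNl (adjoint_ip By dB) (adjoint_ip (dom_Cs By) (dom_C dA)).
by rewrite ipDl ipZl hist//; ring.
Qed.

Let dissip (t : R) : tau <= t -> ip (v' t) (v t) + ip (th' t) (th t) <=
  - ip (X (t - tau)) (P t) - a * nm (P t) ^+ 2 - kap * nm (th t) ^+ 2.
Proof.
move=> taut; have t0 : 0 <= t by exact: le_trans (ltW tau_gt0) taut.
have [_ Bv At] := domO t0; rewrite v'_ip//.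
have -> : th' t = - app Aa (th t) - app Cs (v t).
  by have [] := delay_appE dot A B C alpha tau a (S t x).
rewrite ipBl ipNl (ipC dot (app Cs _)) -(nm2 norm_dot (app Bs (v t))).
by have := Aa_coercive At; rewrite -/(P t); lra.
Qed.

Let balance (t : R) : tau <= t -> ip (v' t) (u t) <=
  - ip (X (t - tau)) (X t) - a * ip (P t) (X t) + c2 * (nm (th t) * nm (X t)).
Proof.
move=> taut; have t0 : 0 <= t by exact: le_trans (ltW tau_gt0) taut.
have [Bu _ _] := domO t0; rewrite v'_ip// lerD2l.
apply: le_trans (ip_le norm_dot _ _) _; rewrite mulrCA ler_wpM2l ?nm_ge0//.
by have := Cs_bound Bu; rewrite !nmE -rCM lecR.
Qed.

Let sq_below w : dom Bs w -> nm w ^+ 2 <= rate_k1 c1 * nm (app Bs w) ^+ 2.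
Proof.
move=> /(nm_le_Bs c1_gt0 Bs_below) h; rewrite /rate_k1 -exprMn mulrC.
by rewrite ler_pXn2r ?nnegrE ?nm_ge0// mulr_ge0 ?nm_ge0// invr_ge0 ltW.
Qed.

Let energy (t : R) : R := nm (v t) ^+ 2 + nm (X t) ^+ 2 + nm (th t) ^+ 2.

(** The memory term at time [3 * tau] is estimated by integrating the balance of
    [v], [X] and [theta] over the preceding delay, on which the orbit is bounded
    by [M]. *)
Lemma orbit_energy_decay (M : R) : 0 <= M ->
  (forall t : R, 0 <= t -> t <= 4 * tau -> p (S t x) <= M) ->
  forall t : R, 3 * tau <= t -> energy t <=
    3 * (1 + tau * (2 / a * (2^-1 + 2 * tau / a))) * M ^+ 2 *
      expR (- (decay_rate c1 c2 kap tau a * (t - 3 * tau))).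
Proof.
move=> M0 hM t ht; have tau0 := tau_gt0; have a0 := a_gt0.
have [W hW] := dW; have [Q [I [hQ hI]]] := dQ.
have u_le (r : R) : tau <= r -> nm (u r) ^+ 2 <= rate_k1 c1 * nm (X r) ^+ 2.
  by move=> hr; apply: sq_below; have [] := domO (le_trans (ltW tau_gt0) hr).
have v_le (r : R) : tau <= r -> nm (v r) ^+ 2 <= rate_k1 c1 * nm (P r) ^+ 2.
  by move=> hr; apply: sq_below; have [] := domO (le_trans (ltW tau_gt0) hr).
have tau2 (r : R) : 2 * tau <= r -> tau <= r by lra.
have h3 : 2 * tau <= 3 * tau by lra.
apply: le_trans (lyapunov_decay norm_dot c1_gt0 c2_gt0 kap_gt0 tau_gt0 a_ge_tau du dv dth dX hW hQ hI
  u_le v_le (fun r hr => dissip (tau2 r hr)) (fun r hr => balance (tau2 r hr)) h3 ht) _.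
rewrite ler_wpM2r ?expR_ge0// -(mulrA 3) ler_pM2l//.
have nX (r : R) : 0 <= r -> r <= 4 * tau -> nm (X r) ^+ 2 <= M ^+ 2.
  move=> r0 r4; rewrite ler_pXn2r ?nnegrE ?nm_ge0//.
  by apply: le_trans (hM r r0 r4); case: (bnd (S r x)).
have enM (r : R) : 0 <= r -> r <= 4 * tau -> energy r <= M ^+ 2.
  move=> r0 r4; apply: (@le_trans _ _ (p (S r x) ^+ 2)).
    rewrite energy_norm2// /energy_sq /energy -/(u r) -/(X r) -/(v r) -/(th r).
    by have := mulr_ge0 (ltW xi_gt0) (q2_ge0 (S r x).2); lra.
  by rewrite ler_pXn2r ?nnegrE ?energy_norm_ge0// hM.
have e3 := enM (3 * tau) (_ : 0 <= _) (_ : _ <= _).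
have {}e3 : energy (3 * tau) <= M ^+ 2 by apply: e3; lra.
have e2 : energy (2 * tau) <= M ^+ 2 by apply: enM; lra.
have -> : 3 * tau - tau = 2 * tau by ring.
pose c := 2 * M ^+ 2 / a.
pose f (r : R) := 2^-1 * (nm (v r) ^+ 2 + nm (X r) ^+ 2 + nm (th r) ^+ 2) + a / 2 * Q r - c * r.
pose f' (r : R) := ip (v' r) (v r) + ip (P r) (X r) + ip (th' r) (th r) + a / 2 * nm (P r) ^+ 2 - c.
have df (r : R) : 2 * tau <= r <= 3 * tau -> is_derive r 1 f (f' r).
  move=> /andP[/tau2 hr _].
  have d1 := is_derive_nm2 norm_dot (dv hr); have d2 := is_derive_nm2 norm_dot (dX hr).
  have d3 := is_derive_nm2 norm_dot (dth hr).
  have := is_deriveB (is_deriveD (is_deriveZ (2^-1 : R) (is_deriveD (is_deriveD d1 d2) d3))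
    (is_deriveZ (a / 2) (hQ r hr))) (is_deriveZ c (is_derive_id r (1 : R))).
  move=> d; apply: (is_derive_eq d).
  by rewrite /f' [c *: (1 : R)]mulr1 /GRing.scale /= (ipC dot (v r)) (ipC dot (X r)) (ipC dot (th r)); field.
have f'0 (r : R) : 2 * tau <= r <= 3 * tau -> f' r <= 0.
  move=> /andP[r2 r3]; have hd := dissip (tau2 r r2).
  have x1 : nm (X r) ^+ 2 <= M ^+ 2 by apply: nX; lra.
  have x2 : nm (X (r - tau)) ^+ 2 <= M ^+ 2 by apply: nX; lra.
  have y := ip_young norm_dot (P r) (X r - X (r - tau)) a0.
  have z := nmD2 norm_dot (X r) (X (r - tau)); have z' := nmB2 norm_dot (X r) (X (r - tau)).
  have z0 := sqr_ge0 (nm (X r + X (r - tau))).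
  have dx : nm (X r - X (r - tau)) ^+ 2 <= 4 * M ^+ 2 by lra.
  have dx2 : nm (X r - X (r - tau)) ^+ 2 / (2 * a) <= c.
    rewrite ler_pdivrMr ?mulr_gt0//; apply: le_trans dx _.
    by rewrite le_eqVlt; apply/orP; left; apply/eqP; rewrite /c; field; rewrite gt_eqF.
  have k0 : 0 <= kap * nm (th r) ^+ 2 by rewrite mulr_ge0 ?sqr_ge0// ltW.
  have sy := ipC dot (P r) (X (r - tau)).
  rewrite ipBr in y; rewrite /f'; lra.
have mono := monotone_le h3 df f'0.
have en0 : 0 <= energy (3 * tau) by rewrite /energy !addr_ge0// sqr_ge0.
have dq : a / 2 * (Q (3 * tau) - Q (2 * tau)) <= M ^+ 2 * (2^-1 + 2 * tau / a).
  have ec : c * (3 * tau) - c * (2 * tau) = M ^+ 2 * (2 * tau / a).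
    by rewrite /c; field; rewrite gt_eqF.
  by move: mono en0 e2; rewrite /f /energy; lra.
have dq2 : Q (3 * tau) - Q (2 * tau) <= 2 / a * (2^-1 + 2 * tau / a) * M ^+ 2.
  have a2 : 0 < a / 2 by rewrite divr_gt0.
  rewrite -(ler_pM2l a2); apply: le_trans dq _.
  by rewrite le_eqVlt; apply/orP; left; apply/eqP; field; rewrite gt_eqF.
have := ler_wpM2l (ltW tau_gt0) dq2; rewrite -/(energy (3 * tau)); lra.
Qed.

(** The history component at time [t] consists of the values of [X] on the
    preceding delay, to which the pointwise decay applies. *)
Lemma orbit_norm_decay (M : R) : 0 <= M ->
  (forall t : R, 0 <= t -> t <= 4 * tau -> p (S t x) <= M) ->
  forall t : R, 4 * tau <= t -> p (S t x) ^+ 2 <=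
    (1 + xi) * (3 * (1 + tau * (2 / a * (2^-1 + 2 * tau / a))) * M ^+ 2 *
      expR (- (decay_rate c1 c2 kap tau a * (t - 4 * tau)))).
Proof.
move=> M0 hM t ht; have tau0 := tau_gt0; have t0 : 0 <= t by lra.
have taut : tau <= t by lra.
set r := decay_rate _ _ _ _ _; set k := 3 * _ * _; set E := k * _.
have r0 : 0 < r by exact: decay_rate_gt0.
have k0 : 0 <= k.
  have : 0 <= tau * (2 / a * (2^-1 + 2 * tau / a)).
    by rewrite !mulr_ge0 ?divr_ge0 ?addr_ge0 ?mulr_ge0 ?invr_ge0 ?divr_ge0 ?(ltW tau_gt0) ?(ltW a_gt0)// ?mulr_ge0 ?(ltW tau_gt0).
  by move=> h; rewrite /k mulr_ge0 ?sqr_ge0// mulr_ge0// addr_ge0.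
have en (s : R) : t - tau <= s -> energy s <= E.
  move=> hs; have hs3 : 3 * tau <= s by lra.
  apply: le_trans (orbit_energy_decay M0 hM hs3) _.
  rewrite -/r -/k ler_wpM2l// ler_expR lerN2 ler_wpM2l ?(ltW r0)//; lra.
have E0 : 0 <= E by rewrite mulr_ge0 ?expR_ge0.
have nX (s : R) : t - tau <= s -> nm (X s) ^+ 2 <= E.
  move=> /en; apply: le_trans; rewrite /energy.
  by have := sqr_ge0 (nm (v s)); have := sqr_ge0 (nm (th s)); lra.
have qE : q2 (S t x).2 <= E.
  have [[_ _ _ Hz] _] := orbit_domP norm_dot B_linear B_dense xi_gt0 c1_gt0 Bs_below SP TP Tx t0.
  have [_ ez] := continuous_rep_spec norm_dot Hz.
  apply: q2_le_cst => //; first by case: Hz.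
  apply: (aeS _ ez) => s es Is; rewrite -es//.
  have s01 : 0 <= s <= 1 by move: Is; rewrite /I01/= in_itv/= => /andP[? ?]; rewrite !ltW.
  have -> := orbit_history norm_dot B_linear B_dense tau_gt0 xi_gt0 c1_gt0 Bs_below SP TP Tx taut s01.
  by apply: nX; rewrite lerD2l lerN2 ler_piMr ?(ltW tau_gt0)//; case/andP: s01.
rewrite energy_norm2// /energy_sq -/(u t) -/(X t) -/(v t) -/(th t).
have := ler_wpM2l (ltW xi_gt0) qE.
have : energy t <= E by apply: en; lra.
by rewrite /energy; lra.
Qed.

End orbit.

Lemma domain_decay : exists N w : R, [/\ 0 < N, 0 < w & forall x, dom T x ->
  forall t : R, 0 <= t -> p (S t x) <= N * expR (- (w * t)) * p x].
Proof.
have tau0 := tau_gt0; have a0 := a_gt0.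
have [M M0 hM] := bounded_on KP SP (4 * tau).
pose r := decay_rate c1 c2 kap tau a.
have r0 : 0 < r by exact: decay_rate_gt0.
pose k := (1 + xi) * (3 * (1 + tau * (2 / a * (2^-1 + 2 * tau / a)))).
have k0 : 0 <= k.
  have h : 0 <= tau * (2 / a * (2^-1 + 2 * tau / a)).
    by rewrite !mulr_ge0 ?divr_ge0 ?addr_ge0 ?mulr_ge0 ?invr_ge0 ?divr_ge0 ?(ltW tau_gt0) ?(ltW a_gt0)// ?mulr_ge0 ?(ltW tau_gt0).
  by rewrite /k mulr_ge0 ?addr_ge0 ?(ltW xi_gt0)// mulr_ge0// addr_ge0.
pose N2 := (k + 1) * M ^+ 2 * expR (4 * (r * tau)).
have N20 : 0 < N2 by rewrite !mulr_gt0 ?expR_gt0 ?exprn_gt0// ltr_wpDl.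
exists (Num.sqrt N2), (r / 2); split; rewrite ?sqrtr_gt0 ?divr_gt0// => x Tx t t0.
have Kx := dom_K TP Tx; have px : 0 <= p x by exact: energy_norm_ge0.
have nn : 0 < Num.sqrt N2 * expR (- (r / 2 * t)) by rewrite mulr_gt0 ?sqrtr_gt0 ?expR_gt0.
suff : p (S t x) ^+ 2 <= (Num.sqrt N2 * expR (- (r / 2 * t)) * p x) ^+ 2.
  by rewrite ler_pXn2r ?nnegrE ?energy_norm_ge0// mulr_ge0// ltW.
have -> : (Num.sqrt N2 * expR (- (r / 2 * t)) * p x) ^+ 2 =
    (k + 1) * (M * p x) ^+ 2 * expR (- (r * (t - 4 * tau))).
  have e1 : expR (- (r / 2 * t)) ^+ 2 = expR (- (r * t)).
    by rewrite expr2 -expRD; congr expR; field.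
  have e2 : expR (- (r * (t - 4 * tau))) = expR (4 * (r * tau)) * expR (- (r * t)).
    by rewrite -expRD; congr expR; ring.
  have s2 : Num.sqrt N2 ^+ 2 = N2 by rewrite sqr_sqrtr// ltW.
  rewrite 2!exprMn e1 e2 s2 /N2.
  by move: (p x) (expR _) (expR _) => *; ring.
have hMx s : 0 <= s -> s <= 4 * tau -> p (S s x) <= M * p x by move=> s0 s1; exact: hM.
have Mx0 : 0 <= M * p x by rewrite mulr_ge0// ltW.
have [ht|ht] := leP (4 * tau) t.
  apply: le_trans (orbit_norm_decay Tx Mx0 hMx ht) _.
  rewrite -/r; set E := expR _; have E0 : 0 <= E by exact: expR_ge0.
  have -> : (1 + xi) * (3 * (1 + tau * (2 / a * (2^-1 + 2 * tau / a))) * (M * p x) ^+ 2 * E) =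
      k * (M * p x) ^+ 2 * E by rewrite /k -!mulrA.
  by rewrite ler_wpM2r// ler_wpM2r ?sqr_ge0//; lra.
have h1 : p (S t x) ^+ 2 <= (M * p x) ^+ 2.
  by rewrite ler_pXn2r ?nnegrE ?energy_norm_ge0// hMx// ltW.
apply: le_trans h1 _; rewrite mulrAC ler_peMl ?sqr_ge0//.
have : 1 <= expR (- (r * (t - 4 * tau))).
  rewrite -[X in X <= _]expR0 ler_expR oppr_ge0.
  by apply: mulr_ge0_le0; [exact: ltW|rewrite subr_le0 ltW].
move=> h; apply: (@le_trans _ _ (1 * 1)); first by rewrite mul1r.
by apply: ler_pM => //; lra.
Qed.

(** The estimate extends from the domain by density, each [S t] being bounded. *)
Lemma semigroup_decay : exists N w : R, [/\ 0 < N, 0 < w & forall x, K x ->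
  forall t : R, 0 <= t -> p (S t x) <= N * expR (- (w * t)) * p x].
Proof.
have [N [w [N0 w0 hN]]] := domain_decay; exists N, w; split=> // x Kx t t0.
have [M M0 hM] := bounded_on KP SP t.
set c := N * _; have c0 : 0 < c by rewrite mulr_gt0 ?expR_gt0.
apply/ler_addgt0Pr => e e0; have Mc : 0 < M + c by rewrite addr_gt0.
have [y Ty xy] := generator_dense KP SP TP Kx (divr_gt0 e0 Mc).
have Ky := dom_K TP Ty; have K1 := sg_stable SP t0 Kx; have K2 := sg_stable SP t0 Ky.
apply: le_trans (p_le_tri KP K1 K2) _.
have h1 : p (S t x - S t y) <= M * (e / (M + c)).
  rewrite (SB_norm KP SP)//; apply: le_trans (hM t _ t0 _ _) _ => //; first exact: (KB KP).
  by rewrite ler_wpM2l// ltW.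
have h2 : p (S t y) <= c * (p x + e / (M + c)).
  apply: le_trans (hN y Ty t t0) _; rewrite -/c ler_wpM2l ?(ltW c0)//.
  by have := p_le_tri KP Ky Kx; rewrite (pBC KP Ky Kx); lra.
have h3 : M * (e / (M + c)) + c * (e / (M + c)) = e by rewrite -mulrDl mulrC divfK// gt_eqF.
lra.
Qed.

End stability.

Theorem theorem2p2 (R : realType)
  (H : completeNormedModType R[i]) (dot : {dot H for Num.conj})
  (norm_dot : forall x : H, `|x| ^+ 2 = dot x x)
  (A B C : uop H) (alpha tau a xi c1 c2 : R)
  (A_self_adjoint : self_adjoint dot A)
  (A_positive : strictly_positive dot A)
  (alpha01 : 0 <= alpha <= 1)
  (tau_gt0 : 0 < tau) (a_gt0 : 0 < a) (xi_gt0 : 0 < xi)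
  (B_linear : linear_op B) (B_dense : densely_defined B) (B_closed : closed_op B)
  (C_linear : linear_op C) (C_dense : densely_defined C) (C_closed : closed_op C)
  (A_BBs : op_eq A (op_comp B (adjoint dot B)))
  (c1_gt0 : 0 < c1)
  (Bs_below : forall v, dom (adjoint dot B) v ->
     c1%:C * `|v| <= `|app (adjoint dot B) v|)
  (dom_C : dom (frac_power dot A alpha) `<=` dom C)
  (dom_Cs : dom (adjoint dot B) `<=` dom (adjoint dot C))
  (c2_gt0 : 0 < c2)
  (Cs_bound : forall v, dom (adjoint dot B) v ->
     `|app (adjoint dot C) v| <= c2%:C * `|app (adjoint dot B) v|)
  (S : R -> state H -> state H)
  (S_C0 : C0_semigroup (energy_space dot B) (energy_norm dot B xi) S)
  (S_generated : infinitesimal_generator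
     (energy_space dot B) (energy_norm dot B xi) S
     (delay_op dot A B C alpha tau a))
  (a_ge_tau : tau <= a) (xi_ge : 2 * tau / a <= xi) :
  exists M w : R, [/\ 0 < M, 0 < w &
    forall t : R, 0 <= t ->
      (op_norm (energy_space dot B) (energy_norm dot B xi) (S t)
         <= (M * expR (- (w * t)))%:E)%E].
Proof.
have [c c_gt0 A_pos] := A_positive.
have [kap kap_gt0 coercive] := frac_power_coercive norm_dot A_self_adjoint c_gt0 A_pos alpha01.
have [M [w [M0 w0 decay]]] := semigroup_decay norm_dot B_linear B_dense tau_gt0 xi_gt0 c1_gt0 c2_gt0
  kap_gt0 a_ge_tau Bs_below dom_C dom_Cs Cs_bound coercive S_C0 S_generated.
exists M, w; split=> // t t0; apply: ge_ereal_sup => _ [x [Kx px] <-].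
rewrite lee_fin; apply: le_trans (decay x Kx t t0) _.
by rewrite ler_piMr// mulr_ge0 ?expR_ge0// ltW.
Qed.
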